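(* There exists a functor $\mu\colon \mathbf{Groups}\to\mathbf{Groups}$ associating to each group $\Gamma$ a boundedly acyclic group $\mu(\Gamma)$ into which $\Gamma$ embeds. The group $\mu(\Gamma)$ has the following properties: (1) Torsion elements of $\mu(\Gamma)$ are conjugate (in $\mu(\Gamma)$) to elements of (the embedded copy of) $\Gamma$. (2) If $\Gamma$ is infinite, then $\mu(\Gamma)$ has the same cardinality as $\Gamma$; otherwise $\mu(\Gamma)$ is countably infinite. (3) The group $\mu(\Gamma)$ contains a non-abelian free subgroup. (4) If $\Gamma$ is $n$-generated, then $\mu(\Gamma)$ is $(n+3)$-generated. In particular, if $\Gamma$ is finitely generated, then $\mu(\Gamma)$ is finitely generated.
   Context: All groups are discrete; $\mathbf{Groups}$ is the category of groups and homomorphisms. For a group $\Gamma$ and $n\ge 0$, let $C^n_b(\Gamma;\mathbb{R})$ be the space of bounded functions $f\colon\Gamma^{n+1}\to\mathbb{R}$ that are invariant under the diagonal left-translation action of $\Gamma$, with coboundary $(\delta f)(g_0,\dots,g_{n+1})=\sum_{j=0}^{n+1}(-1)^j f(g_0,\dots,\widehat{g_j},\dots,g_{n+1})$. The bounded cohomology $H^n_b(\Gamma;\mathbb{R})$ is the $n$-th cohomology of this complex. A group $\Gamma$ is boundedly acyclic if $H^n_b(\Gamma;\mathbb{R})\cong 0$ for all $n\ge1$. A group is $n$-generated if it admits a generating set with $n$ elements. *)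

(* Defs.v *)
From HB Require Import structures.
From mathcomp Require Import all_boot all_order all_algebra.
From mathcomp Require Import boolp classical_sets functions cardinality reals.

Set Implicit Arguments.
Unset Strict Implicit.
Unset Printing Implicit Defensive.

Import Order.TTheory GRing.Theory Num.Theory.

Local Open Scope classical_set_scope.
Local Open Scope card_scope.
Local Open Scope group_scope.

Notation "{ 'ghom' G -> H }" := (UMagmaMorphism.type G H)
  (at level 0, G at level 98, H at level 99, format "{ 'ghom'  G  ->  H }")
  : type_scope.

(* The carrier of a [groupType] is a choiceType, which is no restriction
   classically. No extensionality field is needed: under functional extensionality and proof
   irrelevance, pointwise equal homomorphisms are equal as elements of
   [{ghom G -> H}]. *)
Record group_functor := GroupFunctor {
  fobj :> groupType -> groupType;
  fmap : forall G H : groupType, {ghom G -> H} -> {ghom fobj G -> fobj H};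
  fmap_id : forall G : groupType, fmap (@idfun G : {ghom G -> G}) =1 idfun;
  fmap_comp : forall (G H K : groupType)
      (g : {ghom H -> K}) (f : {ghom G -> H}),
    fmap (g \o f : {ghom G -> K}) =1 fmap g \o fmap f
}.

Definition torsion (G : groupType) (x : G) : Prop :=
  exists2 n : nat, (0 < n)%N & x ^+ n = 1.

Definition generated (G : groupType) (S : set G) : set G :=
  smallest (fun M : set G => group_closed [in M]) S.

Definition n_generated (n : nat) (G : groupType) : Prop :=
  exists S : set G, S #= `I_n /\ generated S = [set: G].

Definition finitely_generated (G : groupType) : Prop :=
  exists S : set G, finite_set S /\ generated S = [set: G].

Definition free_on (F : groupType) (X : set F) : Prop :=
  forall (H : groupType) (f : F -> H),
    exists2 phi : {ghom F -> H}, (forall x, X x -> phi x = f x) &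
      forall psi : {ghom F -> H}, (forall x, X x -> psi x = f x) -> psi =1 phi.

Definition free_group (F : groupType) : Prop := exists X : set F, free_on X.

Definition has_nonabelian_free_subgroup (G : groupType) : Prop :=
  exists (F : groupType) (j : {ghom F -> G}),
    [/\ injective j, free_group F & exists x y : F, ~ commute x y].

Local Open Scope ring_scope.

Section BoundedCohomology.
Context {G : groupType} {R : realType}.

Section Cochains.
Context {n : nat}.

Definition bounded_cochain : {pred ('I_n.+1 -> G) -> R} :=
  [pred f | `[< (exists M : R, forall g, `|f g| <= M) /\
                (forall (a : G) (g : 'I_n.+1 -> G),
                    f (fun i => a * g i)%g = f g) >]].

Lemma bounded_cochain_zmod_closed : zmod_closed bounded_cochain.
Proof.
split; first by apply/asboolP; split=> //; exists 0 => g; rewrite normr0.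
move=> f h /asboolP[[M fM] fi] /asboolP[[N hN] hi]; apply/asboolP; split.
  exists (M + N) => g; rewrite (le_trans (ler_normB _ _))//.
  exact: lerD.
by move=> a g; congr (_ - _); [exact: fi|exact: hi].
Qed.

HB.instance Definition _ :=
  GRing.isZmodClosed.Build _ bounded_cochain bounded_cochain_zmod_closed.

(* C^n_b(G; R); the additive structure is the pointwise one. *)
Record bcochain := BCochain {
  bcochain_fun :> ('I_n.+1 -> G) -> R;
  bcochainP : bcochain_fun \in bounded_cochain
}.

HB.instance Definition _ := [isSub for bcochain_fun].
HB.instance Definition _ := [Choice of bcochain by <:].
HB.instance Definition _ := [SubChoice_isSubZmodule of bcochain by <:].

End Cochains.
Arguments bcochain : clear implicits.

(* [fun i => g (lift j i)] is the tuple g with its j-th entry omitted. *)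
Definition delta_fun n (f : ('I_n.+1 -> G) -> R) (g : 'I_n.+2 -> G) : R :=
  \sum_(j < n.+2) (-1) ^+ j * f (fun i => g (lift j i)).

Lemma delta_fun_bounded n (f : bcochain n) : delta_fun f \in bounded_cochain.
Proof.
case: f => f /= /asboolP[[M fM] fi]; apply/asboolP; split.
  exists (\sum_(j < n.+2) M) => g; rewrite (le_trans (ler_norm_sum _ _ _))//.
  by apply: ler_sum => j _; rewrite normrM normrX normrN normr1 expr1n mul1r.
by move=> a g; apply: eq_bigr => j _; rewrite (fi a (fun i => g (lift j i))).
Qed.

Definition delta n (f : bcochain n) : bcochain n.+1 :=
  BCochain (delta_fun_bounded f).

Lemma delta_is_zmod_morphism n : zmod_morphism (@delta n).
Proof.
move=> f h; apply/val_inj/funext => g /=.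
rewrite /delta_fun [RHS]/GRing.add /= /GRing.opp /= -sumrB.
by apply: eq_bigr => j _; rewrite -mulrBr.
Qed.

HB.instance Definition _ n :=
  GRing.isZmodMorphism.Build _ _ (@delta n) (@delta_is_zmod_morphism n).

Section Cohomology.
Context {n : nat}.

Definition cocycle_pred : {pred bcochain n} := [pred f | delta f == 0].

Lemma cocycle_pred_zmod_closed : zmod_closed cocycle_pred.
Proof.
split=> [|f h /eqP f0 /eqP h0]; apply/eqP; first by rewrite raddf0.
by rewrite raddfB /= f0 h0 subrr.
Qed.

HB.instance Definition _ :=
  GRing.isZmodClosed.Build _ cocycle_pred cocycle_pred_zmod_closed.

Record cocycle := Cocycle {
  cocycle_val :> bcochain n;
  cocycleP : cocycle_val \in cocycle_pred
}.

HB.instance Definition _ := [isSub for cocycle_val].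
HB.instance Definition _ := [Choice of cocycle by <:].
HB.instance Definition _ := [SubChoice_isSubZmodule of cocycle by <:].

End Cohomology.
Arguments cocycle : clear implicits.

(* The complex starts in degree 0, so the only 0-coboundary is 0. *)
Definition is_coboundary n : bcochain n -> Prop :=
  match n with
  | 0 => fun f => f = 0
  | m.+1 => fun f => exists b : bcochain m, f = delta b
  end.

Definition coboundary_pred n : {pred cocycle n} :=
  [pred z | `[< is_coboundary (cocycle_val z) >]].

Lemma coboundary_pred_zmod_closed n : zmod_closed (@coboundary_pred n).
Proof.
case: n => [|n]; split.
- exact/asboolP.
- by move=> y z /asboolP/= y0 /asboolP/= z0; apply/asboolP; rewrite /= y0 z0 subrr.
- by apply/asboolP; exists 0; rewrite [RHS]raddf0.
- move=> y z /asboolP[b yb] /asboolP[c zc]; apply/asboolP.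
  by exists (b - c); rewrite [RHS]raddfB /= -yb -zc.
Qed.

HB.instance Definition _ n := GRing.isZmodClosed.Build _ (@coboundary_pred n)
  (@coboundary_pred_zmod_closed n).

End BoundedCohomology.

Arguments bcochain : clear implicits.
Arguments cocycle : clear implicits.
Arguments coboundary_pred : clear implicits.

Definition bounded_cohomology (G : groupType) (R : realType) (n : nat) :
    zmodType :=
  Quotient.quot (coboundary_pred G R n : zmodClosed _).

Definition boundedly_acyclic (R : realType) (G : groupType) : Prop :=
  forall n : nat, (0 < n)%N -> forall x : bounded_cohomology G R n, x = 0.

(* Main.v *)
Require Import Defs.
From HB Require Import structures.
From mathcomp Require Import all_boot all_order all_algebra.
From mathcomp Require Import boolp classical_sets functions cardinality filter reals.
From mathcomp Require Import ring lra zify.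

(** Let [Q] ([lampgroup]) be the group generated by [G] and one letter [t] subject
    to [[g, t^k h t^-k] = 1] for [g, h] in [G] and [k > 0]; it is the restricted
    wreath product of [G] with the integers.  The [tower] over [G] has the
    generators [G], [t] and one letter [b_j] for each integer [j]; besides the
    multiplication table of [G] it has the relations
    [[u, b_j^k v b_j^-k] = 1] ([k > 0]) for all words [u], [v] in [G], [t] and the
    letters [b_i] with [i < j] that are trivial in [Q].  Shifting the letters
    [b_j] by one is an automorphism of the tower, and [mu G] ([telescope]) is the
    semidirect product of the tower with the infinite cyclic group [<z>] acting
    by this shift.  All this is functorial in [G].

    Bounded acyclicity.  Killing [z] and all [b_j] maps [mu G] onto [Q].  The
    kernel [N] is generated by [z] and an increasing union of subgroups [M_j],
    given by the words below [b_j] that are trivial in [Q]; the conjugates of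
    [M_j] by the positive powers of [b_j] commute with [M_j], and [z] maps the
    union to itself.  A group [N] with this structure has uniformly bounded
    primitives for bounded cocycles ([lamplighter_acyclic]).  Indeed, for a
    random element [w] of the product of [K] conjugates of [M_j], setting the
    entry at one uniformly chosen place changes the law of [w] very little when
    [K] is large, by the law of large numbers.  So the average of a cocycle
    against such random elements is nearly constant, and the prism homotopy gives
    an [M_j]-invariant cochain whose coboundary is close to the cocycle.
    Averaging over the powers of [z] and passing to an ultralimit gives an exact
    [N]-invariant primitive.  The same theorem applies to [Q], with [z] replaced
    by [t].  A double complex argument ([extension_acyclic]) then shows that
    [mu G] is boundedly acyclic; it is here that the uniform bound on the
    primitives for [N] is needed.

    Torsion.  A relation uses finitely many letters, so torsion can be studied in
    the tower with letters [b_i, ..., b_j].  Adding the letter [b_j] gives a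
    group [E] that behaves like an amalgam of the previous stage [A] and of
    [B = <C, b_j>] over [C], the kernel of the map from the previous stage to
    [Q]; the group [B] is torsion free by its action on pairs of an element of
    [A] and an integer.  No normal form theorem is used.  Instead, a
    representation of [E] on functions yields a cocycle [D] that plays the role
    of the signed count of the edges [E/C] on the path from the base vertex to a
    translate of it in the Bass-Serre tree.  If no nontrivial power of a torsion
    element [q] of order [k > 1] fixed a vertex, one could label the vertices
    [E/A] and [E/B] modulo [k] so that [q] shifts the labels by one, and counting
    edges would give a multiple of [k] that is equal to one; and if a nontrivial
    power fixes a vertex, then so does [q] ([torsion_centralizer],
    [torsion_base]).  Hence torsion elements are conjugate into the previous
    stage, and in the end into [G].

    The remaining properties are elementary.  The group [mu G] is generated by
    [G], [t], [b_0] and [z].  The letters [t] and [b_0] generate a free group, as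
    is seen by mapping a tower with finitely many letters [b_i], [i <= 0], to the
    free group.  The cardinality is that of the words, which for infinite [G]
    needs an injection of [G * G] into [G] ([square_embeds]). *)

Set Implicit Arguments.
Unset Strict Implicit.
Unset Printing Implicit Defensive.

Import Order.TTheory GRing.Theory Num.Theory.

Local Open Scope classical_set_scope.
Local Open Scope card_scope.
Local Open Scope group_scope.
Local Open Scope ring_scope.

(** * Cochains on lists *)

Section Coboundary.
Variables (R : realType) (X : Type).
Implicit Types (c b : seq X -> R) (s t : seq X).

(** The homogeneous coboundary, with a cochain of any degree taken as a function
    on lists: deleting the head gives the first term and the other terms are,
    up to sign, the coboundary of the cochain with its first entry fixed.  On
    lists there is no bookkeeping of indices, and identities follow by induction
    on the list; [dd_sum_del] recovers the alternating sum. *)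
Fixpoint dd c s : R :=
  if s is x :: s' then c s' - dd (fun t => c (x :: t)) s' else 0.

Lemma dd_ext c c' s :
  (forall t, (size t).+1 = size s -> c t = c' t) -> dd c s = dd c' s.
Proof.
elim: s c c' => [//|x s IH] c c' E /=.
by rewrite E // (IH _ (fun t => c' (x :: t))) // => t st; rewrite E //= st.
Qed.

Lemma ddB c c' s : dd (fun t => c t - c' t) s = dd c s - dd c' s.
Proof. by elim: s c c' => [|x s IH] c c' /=; [rewrite subr0 | rewrite IH; lra]. Qed.

Lemma dd0 s : dd (fun=> 0) s = 0.
Proof. by elim: s => [|x s IH] //=; rewrite IH subr0. Qed.

Lemma ddN c s : dd (fun t => - c t) s = - dd c s.
Proof.
rewrite (dd_ext (c' := fun t => 0 - c t)); last by move=> t _; rewrite sub0r.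
by rewrite ddB dd0 sub0r.
Qed.

Lemma ddD c c' s : dd (fun t => c t + c' t) s = dd c s + dd c' s.
Proof.
rewrite (dd_ext (c' := fun t => c t - (- c' t))); last by move=> t _; rewrite opprK.
by rewrite ddB ddN opprK.
Qed.

Lemma ddZ (a : R) c s : dd (fun t => a * c t) s = a * dd c s.
Proof.
by elim: s c => [|x s IH] c /=; [rewrite mulr0 | rewrite IH mulrBr].
Qed.

Lemma dd_sum (I : Type) (r : seq I) (P : pred I) (F : I -> seq X -> R) s :
  dd (fun t => \sum_(i <- r | P i) F i t) s = \sum_(i <- r | P i) dd (F i) s.
Proof.
elim: r => [|i r IH].
  rewrite big_nil -[RHS](dd0 s); apply: dd_ext => t _; exact: big_nil.
rewrite big_cons; under dd_ext do rewrite big_cons.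
by case: (P i); rewrite -IH // -ddD.
Qed.

(** An alternating sum of equal terms: this is why only the parity of the degree
    matters when a cocycle has been replaced by a constant. *)
Lemma dd_const (a : R) s : dd (fun=> a) s = if odd (size s) then a else 0.
Proof. by elim: s => [|x s IH] //=; rewrite IH; case: odd; rewrite /= ?subr0 ?subrr. Qed.

Lemma dd_dd c s : dd (dd c) s = 0.
Proof.
elim: s c => [|x s IH] c //=.
by rewrite ddB IH subr0 subrr.
Qed.

(** The cone with apex [x] is a contracting homotopy of the full (not invariant)
    complex. *)
Lemma dd_cone c x s : dd (fun t => c (x :: t)) s = c s - dd c (x :: s).
Proof. by rewrite /= subKr. Qed.

Lemma dd_bound c s (B : R) :
  (forall t, (size t).+1 = size s -> `|c t| <= B) -> `|dd c s| <= (size s)%:R * B.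
Proof.
elim: s c => [|x s IH] c cB /=; first by rewrite normr0 mul0r.
rewrite (le_trans (ler_normB _ _)) // -natr1 mulrDl mul1r addrC.
by apply: lerD; [apply: IH => t st; apply: cB; rewrite /= st | apply: cB].
Qed.

Lemma dd_sum_del c s :
  dd c s = \sum_(j < size s) (-1) ^+ j * c (take j s ++ drop j.+1 s).
Proof.
elim: s c => [|x s IH] c; first by rewrite big_ord0.
rewrite /= big_ord_recl expr0 mul1r take0 drop0 cat0s IH -sumrN; congr (_ + _).
by apply: eq_bigr => j _; rewrite exprS mulN1r mulNr.
Qed.

End Coboundary.

Lemma dd_map (R : realType) X Y (f : X -> Y) (c : seq Y -> R) s :
  dd c (map f s) = dd (fun t => c (map f t)) s.
Proof. by elim: s c => [|x s IH] c //=; rewrite IH. Qed.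

(** The two differentials of a double complex commute. *)
Lemma dd_comm (R : realType) X Y (c : seq X -> seq Y -> R) s t :
  dd (fun t' => dd (c^~ t') s) t = dd (fun s' => dd (c s') t) s.
Proof.
elim: s c => [|x s IH] c /=; first exact: dd0.
by rewrite ddB IH.
Qed.

(** A Markov operator [e], that is, the expectation [e x F] of [F] at a random
    point attached to [x], acts on cochains by moving the entries of a list
    independently.  The prism operator is the chain homotopy between this action
    and the identity; on lists of length [n] its norm is at most [n], because [e]
    does not increase the sup norm. *)
Section Prism.
Variables (R : realType) (X : Type) (e : X -> (X -> R) -> R).
Hypothesis eB : forall x F F', e x (fun y => F y - F' y) = e x F - e x F'.
Hypothesis eC : forall x a, e x (fun=> a) = a.
Hypothesis e_bound : forall x F B, (forall y, `|F y| <= B) -> `|e x F| <= B.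
Implicit Types (c b : seq X -> R) (s t : seq X).

Fixpoint pushc c s : R :=
  if s is x :: s' then e x (fun y => pushc (fun t => c (y :: t)) s') else c [::].

Fixpoint prism c s : R :=
  if s is x :: s' then
    e x (fun y => pushc (fun t => c [:: x, y & t]) s') - prism (fun t => c (x :: t)) s'
  else 0.

Lemma e_ext x F F' : F =1 F' -> e x F = e x F'.
Proof. by move=> /funext ->. Qed.

Lemma pushc_ext c c' s :
  (forall t, size t = size s -> c t = c' t) -> pushc c s = pushc c' s.
Proof.
elim: s c c' => [|x s IH] c c' E /=; first exact: E.
by apply: e_ext => y; apply: IH => t st; apply: E; rewrite /= st.
Qed.

Lemma pushcB c c' s : pushc (fun t => c t - c' t) s = pushc c s - pushc c' s.
Proof.
elim: s c c' => [|x s IH] c c' //=.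
by rewrite -eB; apply: e_ext => y; rewrite IH.
Qed.

Lemma prism_ext c c' s :
  (forall t, size t = (size s).+1 -> c t = c' t) -> prism c s = prism c' s.
Proof.
elim: s c c' => [|x s IH] c c' E //=; congr (_ - _).
  by apply: e_ext => y; apply: pushc_ext => t st; apply: E; rewrite /= st.
by apply: IH => t st; apply: E; rewrite /= st.
Qed.

Lemma prismB c c' s : prism (fun t => c t - c' t) s = prism c s - prism c' s.
Proof.
elim: s c c' => [|x s IH] c c' /=; first by rewrite subr0.
rewrite IH; under e_ext do rewrite pushcB.
by rewrite eB; lra.
Qed.

Lemma dd_e x (F : X -> seq X -> R) s :
  dd (fun t => e x (F^~ t)) s = e x (fun y => dd (F y) s).
Proof.
elim: s F => [|z s IH] F /=; first by rewrite eC.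
by rewrite eB IH.
Qed.

Lemma pushc_dd c s : pushc (dd c) s = dd (pushc c) s.
Proof.
elim: s c => [|x s IH] c //=.
under e_ext do rewrite pushcB.
rewrite eB eC; congr (_ - _).
rewrite (dd_e x (fun y t => pushc (fun t0 => c (y :: t0)) t)).
by apply: e_ext => y; rewrite IH.
Qed.

Lemma prismP c s : pushc c s - c s = dd (prism c) s + prism (dd c) s.
Proof.
elim: s c => [|x s IH] c /=; first by rewrite subrr addr0.
rewrite prismB ddB (dd_e x (fun y t => pushc (fun t0 => c [:: x, y & t0]) t)).
have -> : e x (fun y => pushc (fun t => c (y :: t) - (c (x :: t) -
              dd (fun t0 => c [:: x, y & t0]) t)) s) =
    e x (fun y => pushc (fun t => c (y :: t)) s) - (pushc (fun t => c (x :: t)) s -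
     e x (fun y => dd (pushc (fun t0 => c [:: x, y & t0])) s)).
  under e_ext do rewrite pushcB pushcB pushc_dd.
  by rewrite !eB eC.
have {IH} := IH (fun t => c (x :: t)).
set a := pushc _ _; set p := dd (prism _) _; set q := prism _ _.
set u := e x _; set v := e x _; set w := prism _ _ ; move=> H.
by rewrite (_ : c (x :: s) = a - (p + q)); lra.
Qed.

Lemma pushc_bound c s B :
  (forall t, size t = size s -> `|c t| <= B) -> `|pushc c s| <= B.
Proof.
elim: s c => [|x s IH] c cB /=; first exact: cB.
by apply: e_bound => y; apply: IH => t st; apply: cB; rewrite /= st.
Qed.

Lemma prism_bound c s B :
  (forall t, size t = (size s).+1 -> `|c t| <= B) -> `|prism c s| <= (size s)%:R * B.
Proof.
elim: s c => [|x s IH] c cB /=; first by rewrite normr0 mul0r.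
rewrite (le_trans (ler_normB _ _)) // -natr1 mulrDl mul1r addrC; apply: lerD.
  by apply: IH => t st; apply: cB; rewrite /= st.
apply: e_bound => y; apply: pushc_bound => t st; apply: cB.
by rewrite /= st.
Qed.

Lemma pushc_map (f : X -> X) c s :
  (forall x F, e (f x) F = e x (fun y => F (f y))) ->
  pushc c (map f s) = pushc (fun t => c (map f t)) s.
Proof.
move=> ef; elim: s c => [|x s IH] c //=.
by rewrite ef; apply: e_ext => y; rewrite IH.
Qed.

Lemma prism_map (f : X -> X) c s :
  (forall x F, e (f x) F = e x (fun y => F (f y))) ->
  prism c (map f s) = prism (fun t => c (map f t)) s.
Proof.
move=> ef; elim: s c => [|x s IH] c //=; rewrite IH ef; congr (_ - _).
by apply: e_ext => y; rewrite (pushc_map _ _ ef).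
Qed.

End Prism.

Section Invariant.
Variables (R : realType).

Definition bounded_on (X : Type) (n : nat) (B : R) (c : seq X -> R) :=
  forall s, size s = n -> `|c s| <= B.

Definition invariant_on (G : groupType) (N : set G) (n : nat) (c : seq G -> R) :=
  forall a s, N a -> size s = n -> c (map (fun x => (a * x)%g) s) = c s.

(** Here [n] is the degree, so that the cochains depend on [n.+1] elements. *)
Definition acyclic_in (G : groupType) (n : nat) : Prop :=
  forall (c : seq G -> R) B, bounded_on n.+1 B c -> invariant_on setT n.+1 c ->
    (forall s, size s = n.+2 -> dd c s = 0) ->
  exists b, [/\ exists B', bounded_on n B' b, invariant_on setT n b &
    forall s, size s = n.+1 -> dd b s = c s].

(** The constant [C] is independent of the cocycle.  Extensions need this: there
    one chooses a primitive for each member of an infinite family of cocycles,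
    and these must be bounded together. *)
Definition uniformly_acyclic_in (G : groupType) (N : set G) (n : nat) (C : R) :=
  forall (c : seq G -> R) B, bounded_on n.+1 B c -> invariant_on N n.+1 c ->
    (forall s, size s = n.+2 -> dd c s = 0) ->
  exists b, [/\ bounded_on n (C * B) b, invariant_on N n b &
    forall s, size s = n.+1 -> dd b s = c s].

Lemma nth_del (T : Type) (x0 : T) (s : seq T) j i :
  (j < size s)%N -> nth x0 (take j s ++ drop j.+1 s) i = nth x0 s (bump j i).
Proof.
move=> js; rewrite nth_cat size_take js /bump.
case: ltnP => ij; first by rewrite nth_take // leqNgt ij.
by rewrite nth_drop add1n addSn subnKC.
Qed.

(** Functions on the tuples of the bounded cochain complex and functions on lists
    of a fixed length are exchanged by [mkseq] and [nth]. *)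
Lemma acyclic_boundedly (G : groupType) :
  (forall n, (0 < n)%N -> acyclic_in G n) -> boundedly_acyclic R G.
Proof.
move=> acG n n0 x; rewrite -[x]reprK.
rewrite -[RHS](raddf0 (\pi_(bounded_cohomology G R n)%qT)).
apply/eqP; rewrite -Quotient.idealrBE subr0.
apply/asboolP; case: (repr x) => f fz /=.
case: n n0 x f fz => [//|n] _ x f /eqP df.
case: (f) (bcochainP f) df => f0 f0P /asboolP[[B f0B] f0I] df.
pose c (s : seq G) : R := f0 (fun i : 'I_n.+2 => nth 1%g s i).
have cdel m (h : ('I_m.+1 -> G) -> R) (s : seq G) : size s = m.+2 ->
    dd (fun t => h (fun i : 'I_m.+1 => nth 1%g t i)) s =
    delta_fun h (fun i : 'I_m.+2 => nth 1%g s i).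
  move=> ss; rewrite dd_sum_del ss /delta_fun; apply: eq_bigr => j _.
  by congr (_ * h _); apply: funext => i; rewrite nth_del // ss.
have [||||b [[B' bB] bI bc]] := acG n.+1 _ c B.
- by [].
- by move=> s _; exact: f0B.
- move=> a s _ ss; rewrite /c -[RHS](f0I a); congr f0; apply: funext => i.
  by rewrite (nth_map 1%g) // ss.
- move=> s ss; rewrite cdel //.
  by have /(congr1 (fun h : bcochain G R n.+2 => h (fun i => nth 1%g s i))) := df.
have bP : (fun g : 'I_n.+1 -> G => b (mkseq (fun i => g (inord i)) n.+1)) \in bounded_cochain.
  apply/asboolP; split.
    by exists B' => g; apply: bB; rewrite size_mkseq.
  move=> a g; rewrite -[RHS](bI a) ?size_mkseq //; congr b.
  by rewrite -map_comp; apply: eq_map.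
exists (BCochain bP); apply: val_inj => /=; apply: funext => g.
pose s := mkseq (fun i => g (inord i)) n.+2.
have gs : g = fun i : 'I_n.+2 => nth 1%g s i.
  by apply: funext => i; rewrite nth_mkseq // inord_val.
rewrite gs.
have -> : f0 (fun i => nth 1%g s i) = c s by [].
rewrite -bc ?size_mkseq // -cdel ?size_mkseq //.
apply: dd_ext => t; rewrite size_mkseq => -[st]; congr b.
apply: (@eq_from_nth _ 1%g); rewrite ?size_mkseq // => i; rewrite st => ilt.
by rewrite nth_mkseq // inordK.
Qed.

End Invariant.

(** * Extensions of groups *)

(** The double complex of a surjection [pi : G -> Q]: cochains in a list of [Q]
    and a list of [G], invariant under the diagonal action of [G].  Its rows are
    exact by the cone at [pi] of the first entry in [G], and its columns with at
    least one entry in [Q] are exact because such a cochain restricts to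
    cochains on [G] that are invariant under the kernel only. *)
Section KernelExtension.
Variables (R : realType) (G Q : groupType) (pi : {ghom G -> Q}).
Hypothesis pi_surj : forall y, exists x, pi x = y.
Hypothesis ker_acyclic : forall n, (0 < n)%N ->
  exists2 C : R, 0 <= C & uniformly_acyclic_in [set x | pi x = 1%g] n C.
Hypothesis quo_acyclic : forall n, (0 < n)%N -> acyclic_in R Q n.

Implicit Types (phi psi chi : seq Q -> seq G -> R) (ys : seq Q) (gs : seq G).

Definition bicochain p q phi := exists B : R, forall ys gs, size ys = p -> size gs = q ->
  `|phi ys gs| <= B /\ forall a,
  phi (map (fun x => (pi a * x)%g) ys) (map (fun x => (a * x)%g) gs) = phi ys gs.

Definition dh phi ys gs := dd (phi^~ gs) ys.
Definition dv phi ys gs := dd (phi ys) gs.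

Lemma dh_dv phi ys gs : dh (dv phi) ys gs = dv (dh phi) ys gs.
Proof. by rewrite /dh /dv (dd_comm phi). Qed.

Lemma dh_dh phi ys gs : dh (dh phi) ys gs = 0.
Proof. exact: dd_dd. Qed.

Lemma dv_dv phi ys gs : dv (dv phi) ys gs = 0.
Proof. exact: dd_dd. Qed.

Lemma dh_ext phi psi ys gs :
  (forall ys', (size ys').+1 = size ys -> phi ys' gs = psi ys' gs) ->
  dh phi ys gs = dh psi ys gs.
Proof. exact: dd_ext. Qed.

Lemma dv_ext phi psi ys gs :
  (forall gs', (size gs').+1 = size gs -> phi ys gs' = psi ys gs') ->
  dv phi ys gs = dv psi ys gs.
Proof. exact: dd_ext. Qed.

Lemma bicochain_dh p q phi : bicochain p q phi -> bicochain p.+1 q (dh phi).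
Proof.
case=> B Bphi; exists (p.+1%:R * B) => ys gs sy sg; split=> [|a].
  rewrite -sy; apply: dd_bound => t; rewrite sy => -[st].
  by have [] := Bphi t gs st sg.
rewrite /dh dd_map; apply: dd_ext => t; rewrite sy => -[st].
by have [_ ->] := Bphi t gs st sg.
Qed.

Lemma bicochain_dv p q phi : bicochain p q phi -> bicochain p q.+1 (dv phi).
Proof.
case=> B Bphi; exists (q.+1%:R * B) => ys gs sy sg; split=> [|a].
  rewrite -sg; apply: dd_bound => t; rewrite sg => -[st].
  by have [] := Bphi ys t sy st.
rewrite /dv dd_map; apply: dd_ext => t; rewrite sg => -[st].
by have [_ ->] := Bphi ys t sy st.
Qed.

Lemma bicochainB p q phi psi :
  bicochain p q phi -> bicochain p q psi -> bicochain p q (fun ys gs => phi ys gs - psi ys gs).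
Proof.
case=> B Bphi [C Cpsi]; exists (B + C) => ys gs sy sg; split=> [|a].
  rewrite (le_trans (ler_normB _ _)) //; apply: lerD.
    by have [] := Bphi ys gs sy sg.
  by have [] := Cpsi ys gs sy sg.
by have [_ ->] := Bphi ys gs sy sg; have [_ ->] := Cpsi ys gs sy sg.
Qed.

(** The apex [pi (head gs)] of the cone moves with the diagonal action, so the
    cone preserves invariance. *)
Lemma row_exact p q phi : bicochain p.+1 q.+1 phi ->
  (forall ys gs, size ys = p.+2 -> size gs = q.+1 -> dh phi ys gs = 0) ->
  exists2 chi, bicochain p q.+1 chi &
    forall ys gs, size ys = p.+1 -> size gs = q.+1 -> dh chi ys gs = phi ys gs.
Proof.
case=> B Bphi phi0.
exists (fun ys gs => phi (pi (head 1%g gs) :: ys) gs) => [|ys gs sy sg].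
  exists B => ys gs sy sg; have [] := Bphi (pi (head 1%g gs) :: ys) gs.
  - by rewrite /= sy.
  - by [].
  move=> h1 h2; split=> [//|a]; rewrite -(h2 a) /=.
  by case: gs sg h1 h2 => [//|g gs] /= _ _ _; rewrite gmulfM.
have := phi0 (pi (head 1%g gs) :: ys) gs; rewrite /= sy => /(_ erefl sg) phi0'.
by rewrite /dh (dd_cone (phi^~ gs)) [X in _ - X]phi0' subr0.
Qed.

(** Without an entry in [G] there is no such apex; here the cochain is a bounded
    [Q]-invariant cocycle, and the acyclicity of [Q] takes over. *)
Lemma row_exact0 p phi : bicochain p.+2 0 phi ->
  (forall ys, size ys = p.+3 -> dh phi ys [::] = 0) ->
  exists2 chi, bicochain p.+1 0 chi &
    forall ys, size ys = p.+2 -> dh chi ys [::] = phi ys [::].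
Proof.
case=> B Bphi phi0.
have [||||b [[B' bB] bI bphi]] := @quo_acyclic p.+1 _ (phi^~ [::]) B.
- by [].
- by move=> s ss; have [] := Bphi s [::] ss erefl.
- move=> y s _ ss; have [a <-] := pi_surj y.
  by have [_ /(_ a) <-] := Bphi s [::] ss erefl.
- by move=> s ss; exact: phi0.
exists (fun ys _ => b ys) => [|ys sy]; last exact: bphi.
exists B' => ys gs sy sg; split=> [|a]; first exact: bB.
exact: bI.
Qed.

(** For each list [ys] there is a kernel-invariant primitive of [phi ys], but the
    choice need not be equivariant.  It is made so by moving [ys] by the inverse
    of a lift of its head: two lifts differ by an element of the kernel, under
    which the primitive is invariant. *)
Lemma col_exact p q phi : bicochain p.+1 q.+1 phi ->
  (forall ys gs, size ys = p.+1 -> size gs = q.+2 -> dv phi ys gs = 0) ->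
  exists2 psi, bicochain p.+1 q psi &
    forall ys gs, size ys = p.+1 -> size gs = q.+1 -> dv psi ys gs = phi ys gs.
Proof.
case=> B Bphi phi0; case: q Bphi phi0 => [|q] Bphi phi0.
  have cst ys g : size ys = p.+1 -> phi ys [:: g] = phi ys [:: 1%g].
    by move=> sy; have := phi0 ys [:: 1%g; g] sy erefl; rewrite /dv /= !subr0; lra.
  (* In degree zero a cocycle does not depend on its entry in [G]. *)
  exists (fun ys _ => phi ys [:: 1%g]) => [|ys [//|g [|//]] sy _]; last first.
    by rewrite /dv /= subr0 (cst ys g).
  exists B => ys gs sy _; have [h1 h2] := Bphi ys [:: 1%g] sy erefl.
  split=> // a; rewrite -(h2 a) /= mulg1 [RHS]cst //.
  by rewrite size_map.
have [C C0 uC] := ker_acyclic (ltn0Sn q).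
pose sec y := xget 1%g [set x | pi x = y].
have secK y : pi (sec y) = y.
  by rewrite /sec; case: xgetP => [x _ //|/= h]; have [x xy] := pi_surj y; case: (h x).
have [beta betaP] : exists beta : seq Q -> seq G -> R, forall ys, size ys = p.+1 ->
   [/\ bounded_on q.+1 (C * B) (beta ys),
       invariant_on [set x | pi x = 1%g] q.+1 (beta ys) &
       forall s, size s = q.+2 -> dd (beta ys) s = phi ys s].
  suff /choice[beta betaP] : forall ys, exists b, size ys = p.+1 ->
   [/\ bounded_on q.+1 (C * B) b,
       invariant_on [set x | pi x = 1%g] q.+1 b &
       forall s, size s = q.+2 -> dd b s = phi ys s] by exists beta.
  move=> ys; have [sy|] := eqVneq (size ys) p.+1; last first.
    by move=> h; exists (fun=> 0) => e; rewrite e eqxx in h.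
  have [|||b bP] := uC (phi ys) B; last by exists b.
  - by move=> s ss; have [] := Bphi ys s sy ss.
  - move=> a s /= pa ss; have [_ /(_ a) <-] := Bphi ys s sy ss.
    by rewrite pa; congr phi; rewrite (eq_map (g := id)) ?map_id // => x; rewrite mul1g.
  - by move=> s ss; apply: phi0.
pose nrm ys gs (g : G) := beta (map (fun x => (pi g^-1 * x)%g) ys)
     (map (fun x => (g^-1 * x)%g) gs).
exists (fun ys gs => nrm ys gs (sec (head 1%g ys))) => [|ys gs sy sg].
  exists (C * B) => ys gs sy sg; split=> [|a].
    have [] := betaP (map (fun x => (pi (sec (head 1%g ys))^-1 * x)%g) ys).
      by rewrite size_map.
    by move=> + _ _; apply; rewrite size_map.
  case: ys sy => [//|y ys] sy.
  rewrite /nrm [head _ (y :: ys)]/= [head _ (map _ _)]/=.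
  set t := sec (pi a * y)%g.
  have [n n1 st] : exists2 n, pi n = 1%g & (t^-1 * a = n^-1 * (sec y)^-1)%g.
    exists ((sec y)^-1 * (a^-1 * t))%g.
      by rewrite !gmulfM !gmulfV !secK mulKg mulVg.
    by rewrite !invgM !invgK -!mulgA mulgV mulg1.
  have e1 z : (pi t^-1 * (pi a * z) = pi (sec y)^-1 * z)%g.
    by rewrite mulgA -gmulfM st gmulfM (gmulfV pi n) n1 invg1 mul1g.
  have -> : map (fun x => (pi t^-1 * x)%g) (map (fun x => (pi a * x)%g) (y :: ys)) =
     map (fun x => (pi (sec y)^-1 * x)%g) (y :: ys).
    by rewrite -map_comp; apply: eq_map => z /=; exact: e1.
  have -> : map (fun x => (t^-1 * x)%g) (map (fun x => (a * x)%g) gs) =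
      map (fun x => (n^-1 * x)%g) (map (fun x => ((sec y)^-1 * x)%g) gs).
    by rewrite -!map_comp; apply: eq_map => z /=; rewrite !mulgA st.
  have [|_ bI _] := betaP (map (fun x => (pi (sec y)^-1 * x)%g) (y :: ys)).
    by rewrite size_map.
  by apply: bI; rewrite ?size_map //= gmulfV n1 invg1.
have [|_ _ bphi] := betaP (map (fun x => (pi (sec (head 1%g ys))^-1 * x)%g) ys).
  by rewrite size_map.
rewrite /dv /nrm -(dd_map (fun x => ((sec (head 1%g ys))^-1 * x)%g)) bphi ?size_map //.
by have [_ ->] := Bphi ys gs sy sg.
Qed.

(** The staircase: a vertical primitive [psi0] of [phi] need not be horizontally
    closed, but [dh psi0] is closed in both directions with one entry of [G]
    fewer.  By induction it has a horizontally closed vertical primitive, which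
    is [dh chi] by exactness of the rows, and [psi0 - dv chi] is as required. *)
Lemma zigzag q : forall p phi, bicochain p.+1 q.+1 phi ->
  (forall ys gs, size ys = p.+2 -> size gs = q.+1 -> dh phi ys gs = 0) ->
  (forall ys gs, size ys = p.+1 -> size gs = q.+2 -> dv phi ys gs = 0) ->
  exists psi, [/\ bicochain p.+1 q psi,
    forall ys gs, size ys = p.+1 -> size gs = q.+1 -> dv psi ys gs = phi ys gs &
    forall ys gs, size ys = p.+2 -> size gs = q -> dh psi ys gs = 0].
Proof.
elim: q => [|q IH] p phi gphi hphi vphi; have [psi0 gpsi0 vpsi0] := col_exact gphi vphi.
  exists psi0; split=> // ys [|//] sy _.
  have <- : dv (dh psi0) ys [:: 1%g] = dh psi0 ys [::] by rewrite /dv /= subr0.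
  rewrite -dh_dv (dh_ext (psi := phi)) ?hphi // => ys'.
  by rewrite sy => -[sy']; apply: vpsi0.
have vtheta ys gs : size ys = p.+2 -> size gs = q.+2 -> dv (dh psi0) ys gs = 0.
  move=> sy sg; rewrite -dh_dv (dh_ext (psi := phi)) ?hphi // => ys'.
  by rewrite sy => -[sy']; apply: vpsi0.
have [|psi' [gpsi' vpsi' hpsi']] := IH _ _ (bicochain_dh gpsi0) _ vtheta.
  by move=> ys gs _ _; exact: dh_dh.
have [chi gchi hchi] : exists2 chi, bicochain p.+1 q chi &
    forall ys gs, size ys = p.+2 -> size gs = q -> dh chi ys gs = psi' ys gs.
  case: q {IH gphi hphi vphi psi0 gpsi0 vpsi0 vtheta vpsi'} gpsi' hpsi' => [|q] gpsi' hpsi'.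
    have [|chi gchi hchi] := row_exact0 gpsi' _; first by move=> ys /hpsi'; apply.
    by exists chi => // ys [|//] sy _; exact: hchi.
  exact: row_exact gpsi' hpsi'.
exists (fun ys gs => psi0 ys gs - dv chi ys gs); split.
- exact: bicochainB gpsi0 (bicochain_dv gchi).
- move=> ys gs sy sg; rewrite [LHS]ddB.
  by rewrite [X in _ - X]dv_dv subr0; exact: vpsi0.
- move=> ys gs sy sg; rewrite [LHS]ddB.
  rewrite [X in _ - X](dh_dv chi) [X in _ - X](dv_ext (psi := psi')) ?vpsi' ?subrr //.
  by move=> gs'; rewrite sg => -[sg']; exact: hchi.
Qed.

(** Taken as constant in one entry of [Q], a cocycle on [G] is closed in both
    directions, since the coboundary of a constant in two entries is zero.  Its
    horizontally closed vertical primitive is [dh chi] with [chi] independent of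
    [Q], and [chi] is the primitive. *)
Lemma extension_acyclic n : (0 < n)%N -> acyclic_in R G n.
Proof.
case: n => [//|n] _ c B cB cI c0.
have [|||psi [gpsi vpsi hpsi]] := @zigzag n.+1 0 (fun _ gs => c gs).
- by exists B => ys gs sy sg; split=> [|a]; [exact: cB | exact: cI].
- by move=> ys gs sy sg; rewrite /dh dd_const sy.
- by move=> ys gs sy sg; exact: c0.
have [chi [B' chiB] hchi] := row_exact gpsi hpsi.
exists (chi [::]); split.
- by exists B' => gs sg; have [] := chiB [::] gs erefl sg.
- by move=> a gs _ sg; have [_ /(_ a)] := chiB [::] gs erefl sg.
move=> gs sg; rewrite -(vpsi [:: 1%g]) //; apply: dd_ext => t; rewrite sg => -[st].
by rewrite -hchi // /dh /= subr0.
Qed.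

End KernelExtension.

(** * Resampling one coordinate at random *)

Section Average.
Variables (R : realType) (W : finType) (w0 : W).
Implicit Types F : W -> R.

Definition avg F : R := #|W|%:R^-1 * \sum_w F w.

Let cardW0 : #|W|%:R != 0 :> R.
Proof. by rewrite pnatr_eq0 -lt0n; apply/card_gt0P; exists w0. Qed.

Lemma avg_ext F F' : F =1 F' -> avg F = avg F'.
Proof. by move=> /funext ->. Qed.

Lemma avgC a : avg (fun=> a) = a.
Proof. by rewrite /avg sumr_const -[a *+ _]mulr_natl mulrA mulVf ?mul1r. Qed.

Lemma avgB F F' : avg (fun w => F w - F' w) = avg F - avg F'.
Proof. by rewrite /avg sumrB mulrBr. Qed.

Lemma avgD F F' : avg (fun w => F w + F' w) = avg F + avg F'.
Proof. by rewrite /avg big_split mulrDr. Qed.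

Lemma avgZ a F : avg (fun w => a * F w) = a * avg F.
Proof. by rewrite /avg -mulr_sumr mulrCA. Qed.

Lemma avg_sum (I : finType) (F : I -> W -> R) :
  avg (fun w => \sum_i F i w) = \sum_i avg (F i).
Proof. by rewrite /avg exchange_big mulr_sumr. Qed.

Lemma avg_le F F' : (forall w, F w <= F' w) -> avg F <= avg F'.
Proof.
by move=> h; rewrite /avg ler_wpM2l ?invr_ge0 ?ler0n // ler_sum.
Qed.

Lemma avg_norm F : `|avg F| <= avg (fun w => `|F w|).
Proof.
rewrite /avg normrM ger0_norm ?invr_ge0 ?ler0n //.
by rewrite ler_wpM2l ?invr_ge0 ?ler0n // ler_norm_sum.
Qed.

Lemma avg_bound F B : (forall w, `|F w| <= B) -> `|avg F| <= B.
Proof. by move=> h; rewrite (le_trans (avg_norm F)) // -[leRHS]avgC avg_le. Qed.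

(** The expectation over [n] independent uniform elements of [W]. *)
Fixpoint expect n (F : seq W -> R) : R :=
  if n is n'.+1 then avg (fun w => expect n' (fun ws => F (w :: ws))) else F [::].

Lemma expect_ext n (F F' : seq W -> R) :
  (forall ws, size ws = n -> F ws = F' ws) -> expect n F = expect n F'.
Proof.
elim: n F F' => [|n IH] F F' h /=; first exact: h.
by apply: avg_ext => w; apply: IH => ws sw; apply: h; rewrite /= sw.
Qed.

Lemma expectB n (F F' : seq W -> R) : expect n (fun w => F w - F' w) = expect n F - expect n F'.
Proof.
by elim: n F F' => [|n IH] F F' //=; rewrite -avgB; apply: avg_ext => w; rewrite IH.
Qed.

Lemma expectD n (F F' : seq W -> R) : expect n (fun w => F w + F' w) = expect n F + expect n F'.
Proof.
by elim: n F F' => [|n IH] F F' //=; rewrite -avgD; apply: avg_ext => w; rewrite IH.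
Qed.

Lemma expectZ n a (F : seq W -> R) : expect n (fun w => a * F w) = a * expect n F.
Proof.
by elim: n F => [|n IH] F //=; rewrite -avgZ; apply: avg_ext => w; rewrite IH.
Qed.

Lemma expectC n a : expect n (fun=> a) = a.
Proof. by elim: n => [|n IH] //=; under avg_ext do rewrite IH; rewrite avgC. Qed.

Lemma expect_sum (I : finType) n (F : I -> seq W -> R) :
  expect n (fun w => \sum_i F i w) = \sum_i expect n (F i).
Proof.
by elim: n F => [|n IH] F //=; rewrite -avg_sum; apply: avg_ext => w; rewrite IH.
Qed.

Lemma expect_le n (F F' : seq W -> R) :
  (forall ws, size ws = n -> F ws <= F' ws) -> expect n F <= expect n F'.
Proof.
elim: n F F' => [|n IH] F F' h /=; first exact: h.
by apply: avg_le => w; apply: IH => ws sw; apply: h; rewrite /= sw.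
Qed.

Lemma expect_norm n (F : seq W -> R) : `|expect n F| <= expect n (fun ws => `|F ws|).
Proof.
elim: n F => [|n IH] F //=; apply: le_trans (avg_norm _) _.
by apply: avg_le => w; exact: IH.
Qed.

Fixpoint zipw X Y (h : X -> W -> Y) (s : seq X) (ws : seq W) : seq Y :=
  if (s, ws) is (x :: s', w :: ws') then h x w :: zipw h s' ws' else [::].

Lemma size_zipw X Y (h : X -> W -> Y) s ws : size s = size ws -> size (zipw h s ws) = size s.
Proof. by elim: s ws => [|x s IH] [|w ws] //= [/IH ->]. Qed.

(** For the operator that moves [x] to the random point [h x w], the action on
    cochains is an expectation over independent copies of [w]. *)
Lemma pushc_avg X (h : X -> W -> X) (c : seq X -> R) s :
  pushc (fun x (g : X -> R) => avg (fun w => g (h x w))) c s =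
  expect (size s) (fun ws => c (zipw h s ws)).
Proof.
by elim: s c => [|x s IH] c //=; apply: avg_ext => w; rewrite IH.
Qed.

End Average.

(** Configurations [w] assign to each of [K] sites one of [d.+1] values.  Putting
    a prescribed value at a site [k] is a change of density by [likelihood k].
    For different sites these densities are uncorrelated, so their average over
    [k] is close to one in the mean square. *)
Section Resampling.
Variables (R : realType) (K d : nat).
Local Notation W := {ffun 'I_K -> 'I_d.+1}.
Implicit Types (w : W) (k l : 'I_K) (i j : 'I_d.+1) (F : W -> R).

Let w0 : W := [ffun=> ord0].

Definition setsite k i (w : W) : W := [ffun l => if l == k then i else w l].

Definition likelihood k i (w : W) : R := d.+1%:R * (w k == i)%:R.

(** Each configuration with value [i] at [k] arises from the [d.+1] configurations
    that agree with it at the other sites. *)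
Lemma avg_setsite k i F :
  avg (fun w => F (setsite k i w)) = avg (fun w => likelihood k i w * F w).
Proof.
rewrite /avg; congr (_ * _).
transitivity (\sum_(j < d.+1) \sum_(w : W | w k == i) F w); last first.
  rewrite sumr_const card_ord -mulr_natl mulr_sumr [RHS](bigID (fun w0 : W => w0 k == i)) /=.
  rewrite [X in _ + X]big1 ?addr0; last first.
    by move=> w /negbTE h; rewrite /likelihood h mulr0 mul0r.
  by apply: eq_bigr => w h; rewrite /likelihood h mulr1.
rewrite (partition_big (fun w : W => w k) predT) //=.
apply: eq_bigr => j _.
rewrite (reindex_onto (setsite k j) (setsite k i)) /=; last first.
  move=> w /eqP wk; apply/ffunP => l; rewrite !ffunE; case: eqP => // ->.
  by rewrite wk.
apply: eq_big => [w|w /andP[_ /eqP -> //]].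
rewrite ffunE eqxx eqxx /=; apply/eqP/eqP => [<-|wk].
  by rewrite !ffunE eqxx.
by apply/ffunP => l; rewrite !ffunE; case: eqP => // ->.
Qed.

(** The density for a list of independent configurations. *)
Fixpoint weight k (is_ : seq 'I_d.+1) (ws : seq W) : R :=
  if (is_, ws) is (i :: s', w :: ws') then likelihood k i w * weight k s' ws' else 1.

Lemma expect_setsite k is_ (F : seq W -> R) :
  expect (size is_) (fun ws => F (zipw (setsite k) is_ ws)) =
  expect (size is_) (fun ws => weight k is_ ws * F ws).
Proof.
elim: is_ F => [|i s IH] F /=; first by rewrite mul1r.
under avg_ext do rewrite (IH (fun t => F (_ :: t))).
rewrite (avg_setsite k i (fun w => expect (size s) (fun ws => weight k s ws * F (w :: ws)))).
apply: avg_ext => w; rewrite -expectZ.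
by apply: expect_ext => ws _; rewrite mulrA.
Qed.

Lemma avg_likelihood k i : avg (likelihood k i) = 1.
Proof.
rewrite -[RHS](avgC w0) (avg_setsite k i (fun=> 1)).
by apply: avg_ext => w; rewrite mulr1.
Qed.

Lemma avg_likelihoodM k l i :
  avg (fun w => likelihood k i w * likelihood l i w) = if k == l then d.+1%:R else 1.
Proof.
rewrite -avg_setsite; have [->|kl] := eqVneq k l.
  rewrite -[RHS](avgC w0); apply: avg_ext => w.
  by rewrite /likelihood ffunE eqxx eqxx mulr1.
rewrite -[RHS](avg_likelihood l i); apply: avg_ext => w.
by rewrite /likelihood ffunE [l == k]eq_sym (negbTE kl).
Qed.

Lemma expect_weight k is_ : expect (size is_) (weight k is_) = 1.
Proof.
elim: is_ => [|i s IH] //=.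
under avg_ext do rewrite expectZ IH mulr1.
exact: avg_likelihood.
Qed.

Lemma expect_weightM k l is_ : expect (size is_) (fun ws => weight k is_ ws * weight l is_ ws) =
  if k == l then d.+1%:R ^+ size is_ else 1.
Proof.
elim: is_ => [|i s IH] /=; first by rewrite mulr1 expr0; case: eqP.
transitivity (avg (fun w => (if k == l then d.+1%:R ^+ size s else 1) *
  (likelihood k i w * likelihood l i w)) : R).
  apply: avg_ext => w; rewrite -IH mulrC -expectZ; apply: expect_ext => ws _.
  by rewrite mulrACA.
by rewrite avgZ avg_likelihoodM; case: eqP => _; rewrite ?mulr1 // exprSr.
Qed.

(** In the second moment of the average over [k] the off-diagonal covariances
    vanish and each of the [K] diagonal terms is at most [d.+1 ^ n]. *)
Lemma resampling_variance is_ : (0 < K)%N ->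
  expect (size is_) (fun ws => (K%:R^-1 * (\sum_k weight k is_ ws) - 1) ^+ 2) <=
  K%:R^-1 * d.+1%:R ^+ size is_.
Proof.
move=> K0; set n := size is_.
have KN0 : K%:R != 0 :> R by rewrite pnatr_eq0 -lt0n.
have -> : expect n (fun ws => (K%:R^-1 * (\sum_k weight k is_ ws) - 1) ^+ 2) =
   K%:R^-1 ^+ 2 * (\sum_k \sum_l (expect n (fun ws => weight k is_ ws * weight l is_ ws) - 1)).
  transitivity (expect n (fun ws => K%:R^-1 ^+ 2 * \sum_k \sum_l
       (weight k is_ ws * weight l is_ ws - weight k is_ ws - weight l is_ ws + 1))).
    apply: expect_ext => ws _.
    have -> : \sum_k \sum_l (weight k is_ ws * weight l is_ ws - weight k is_ ws -
                 weight l is_ ws + 1) = (\sum_k (weight k is_ ws - 1)) ^+ 2.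
      rewrite expr2 mulr_suml; apply: eq_bigr => k _; rewrite mulr_sumr.
      by apply: eq_bigr => l _; ring.
    rewrite sumrB sumr_const card_ord -exprMn; congr (_ ^+ 2).
    by rewrite mulrBr mulVf.
  rewrite expectZ expect_sum; congr (_ * _); apply: eq_bigr => k _.
  rewrite expect_sum; apply: eq_bigr => l _.
  transitivity (expect n (fun ws => (weight k is_ ws * weight l is_ ws - weight k is_ ws) -
      (weight l is_ ws - 1))); first by apply: expect_ext => ws _; ring.
  by rewrite !expectB !expect_weight (expectC w0); ring.
under eq_bigr => k _.
  under eq_bigr do rewrite expect_weightM.
  rewrite (bigD1 k) //= eqxx big1 ?addr0; last first.
    by move=> l; rewrite eq_sym => /negbTE ->; rewrite subrr.
  over.
rewrite sumr_const card_ord -[(_ - _) *+ K]mulr_natl mulrA expr2 -[_ * _ * K%:R]mulrA mulVf // mulr1.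
by rewrite ler_wpM2l ?invr_ge0 ?ler0n // lerBlDr lerDl.
Qed.

(** The constant comes from [`|y| <= eps + eps^-1 * y ^ 2], applied to the deviation
    of the averaged density, and from the bound on the variance. *)
Lemma resampling is_ (F : seq W -> R) (B eps : R) : (0 < K)%N -> 0 <= B -> 0 < eps ->
  (forall ws, size ws = size is_ -> `|F ws| <= B) ->
  `|K%:R^-1 * (\sum_k expect (size is_) (fun ws => F (zipw (setsite k) is_ ws)))
     - expect (size is_) F| <= B * (eps + eps^-1 * (K%:R^-1 * d.+1%:R ^+ size is_)).
Proof.
move=> K0 B0 e0 FB; set n := size is_.
have -> : K%:R^-1 * (\sum_k expect n (fun ws => F (zipw (setsite k) is_ ws))) - expect n F =
   expect n (fun ws => (K%:R^-1 * (\sum_k weight k is_ ws) - 1) * F ws).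
  under eq_bigr do rewrite expect_setsite.
  rewrite -expect_sum -expectZ -expectB; apply: expect_ext => ws _.
  by rewrite -mulr_suml mulrBl mul1r mulrA.
apply: le_trans (expect_norm _ _) _.
apply: le_trans (_ : expect n (fun ws => B * (eps + eps^-1 *
     (K%:R^-1 * (\sum_k weight k is_ ws) - 1) ^+ 2)) <= _).
  apply: expect_le => ws sw; rewrite normrM mulrC; apply: ler_pM => //; first exact: FB.
  set y := _ - 1; have y2 : y ^+ 2 = `|y| ^+ 2 by rewrite real_normK // num_real.
  rewrite y2; have : 0 <= `|y| by []; move: `|y| => {y2} {}y y0.
  have [ye|ye] := leP y eps.
    apply: le_trans ye _; rewrite lerDl; apply: mulr_ge0; last exact: sqr_ge0.
    by rewrite invr_ge0 ltW.
  apply: (@le_trans _ _ (eps^-1 * y ^+ 2)); last by rewrite lerDr ltW.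
  rewrite expr2 mulrA -[leLHS]mul1r ler_wpM2r // mulrC ler_pdivlMr // mul1r.
  exact: ltW.
rewrite expectZ ler_wpM2l //.
by rewrite expectD (expectC w0) expectZ lerD2l ler_wpM2l ?invr_ge0 ?(ltW e0) // resampling_variance.
Qed.

End Resampling.

Record subgroup (G : groupType) (S : set G) : Prop := Subgroup {
  subgroup1 : S 1%g;
  subgroupM : forall x y, S x -> S y -> S (x * y)%g;
  subgroupV : forall x, S x -> S x^-1%g
}.

Lemma subgroupX (G : groupType) (S : set G) x n : subgroup S -> S x -> S (x ^+ n)%g.
Proof.
move=> [S1 SM _] Sx; elim: n => [|n IH]; first by rewrite expg0.
by rewrite expgS; exact: SM.
Qed.

(** * Lamplighter groups are boundedly acyclic *)

(** In a product of commuting factors a missing factor can be put on the left. *)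
Lemma mul_prod_at (G : groupType) (I : eqType) (r : seq I) k (f f' : I -> G) g :
  uniq r -> k \in r -> f k = 1%g -> f' k = g ->
  (forall l, l != k -> f l = f' l /\ commute g (f l)) ->
  (g * \prod_(l <- r) f l = \prod_(l <- r) f' l)%g.
Proof.
move=> + + fk f'k ff'; elim: r => [//|x r IH] /= /andP[xr ur].
rewrite !big_cons inE; have [kx _|kx /= kr] := eqVneq k x.
  rewrite -kx in xr *; rewrite fk f'k mul1g; congr (_ * _)%g.
  rewrite big_seq [RHS]big_seq; apply: eq_bigr => l lr.
  by have [|//] := ff' l; apply: contraNneq xr => <-.
have [<- cg] : f x = f' x /\ commute g (f x) by apply: ff'; rewrite eq_sym.
by rewrite -(IH ur kr) mulgA cg !mulgA.
Qed.

(** The hypothesis on [s] makes the conjugates of [M] by the powers of [s] commute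
    pairwise.  Thus [config w] is a product in which the order of the sites does
    not matter, with the value [a (w k)] at the site [k]. *)
Section Lamplighter.
Variables (R : realType) (G : groupType) (N M : set G) (s : G).
Hypotheses (sgN : subgroup N) (sgM : subgroup M) (MN : M `<=` N) (Ns : N s).
Hypothesis commM : forall x y i, M x -> M y -> (0 < i)%N ->
  commute x (s ^+ i * y * s ^- i)%g.

Definition site k (g : G) : G := (s ^+ k * g * s ^- k)%g.

Lemma site1 k : site k 1%g = 1%g.
Proof. by rewrite /site mulg1 mulgV. Qed.

Lemma site_commute k l x y : k != l -> M x -> M y -> commute (site k x) (site l y).
Proof.
wlog kl : k l x y / (k < l)%N => [H|].
  rewrite neq_ltn => /orP[kl|lk] Mx My.
    by apply: H => //; rewrite neq_ltn kl.
  by apply/commute_sym/H => //; rewrite neq_ltn lk.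
move=> _ Mx My; have := commM Mx My (_ : 0 < l - k)%N; rewrite subn_gt0 => /(_ kl).
set d := (l - k)%N => c.
have -> : l = (k + d)%N by rewrite subnKC // ltnW.
have -> : site (k + d) y = (s ^+ k * (s ^+ d * y * s ^- d) * s ^- k)%g.
  by rewrite /site expgnDr invgM !mulgA.
set z := (_ * _ * s ^- d)%g in c *.
have conjM u v : ((s ^+ k * u * s ^- k) * (s ^+ k * v * s ^- k) = s ^+ k * (u * v) * s ^- k)%g.
  by rewrite !mulgA mulgVK.
by rewrite /commute /site !conjM c.
Qed.

Variables (K d : nat) (a : 'I_d.+1 -> G).
Hypotheses (aM : forall i, M (a i)) (a0 : a ord0 = 1%g).
Local Notation W := {ffun 'I_K -> 'I_d.+1}.

Definition config (w : W) : G := (\prod_(k < K) site k (a (w k)))%g.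

Lemma config_setsite (k : 'I_K) i w :
  (site k (a i) * config (setsite k ord0 w) = config (setsite k i w))%g.
Proof.
apply: (@mul_prod_at _ _ _ k); rewrite ?index_enum_uniq ?mem_index_enum //.
- by rewrite ffunE eqxx a0 site1.
- by rewrite ffunE eqxx.
- move=> l lk; rewrite !ffunE (negbTE lk); split=> //.
  by apply: site_commute; rewrite // eq_sym.
Qed.

(** Elements of a coset [M x] are compared with a chosen representative, so that
    [retract] is an [M]-equivariant map of the group to [M]. *)
Definition coset_rep x := xget 1%g [set y | exists2 m, M m & y = (m * x)%g].
Definition retract x : G := (x * (coset_rep x)^-1)%g.

Lemma coset_repM m x : M m -> coset_rep (m * x)%g = coset_rep x.
Proof.
move=> Mm; rewrite /coset_rep; congr xget; apply/seteqP; split=> y [m' Mm' ->] /=.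
  by exists (m' * m)%g; [exact: subgroupM | rewrite mulgA].
exists (m' * m^-1)%g; last by rewrite !mulgA mulgVK.
by apply: subgroupM => //; exact: subgroupV.
Qed.

Lemma retractM m x : M m -> retract (m * x)%g = (m * retract x)%g.
Proof. by move=> Mm; rewrite /retract coset_repM // mulgA. Qed.

Lemma retract_in x : M (retract x).
Proof.
rewrite /retract /coset_rep; case: xgetP => [y _ [m Mm ->]|/(_ x)/=[]].
  by rewrite invgM mulVKg; exact: subgroupV.
by exists 1%g; [exact: subgroup1 | rewrite mul1g].
Qed.

(** The Markov operator attached to the site [k]: [x] moves to [s^-k] times a
    random configuration in which the retraction of [x] is put at the site [k].
    It is [M]-equivariant because the retraction is. *)
Definition lamp (k : 'I_K) x (F : G -> R) : R :=
  avg (fun w : W => F (retract x * (s ^- k * config (setsite k ord0 w)))%g).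

Let w0 : W := [ffun=> ord0].

Lemma lampB k x F F' : lamp k x (fun y => F y - F' y) = lamp k x F - lamp k x F'.
Proof. exact: avgB. Qed.

Lemma lampC k x c : lamp k x (fun=> c) = c.
Proof. exact: (avgC w0). Qed.

Lemma lamp_bound k x F B : (forall y, `|F y| <= B) -> `|lamp k x F| <= B.
Proof. by move=> FB; apply: (avg_bound w0). Qed.

Lemma lamp_inv k m x F : M m -> lamp k (m * x)%g F = lamp k x (fun y => F (m * y)%g).
Proof. by move=> Mm; apply: avg_ext => w; rewrite retractM // !mulgA. Qed.

(** The limit operator: a random configuration, the same for all [x]. *)
Definition spread (x : G) (F : G -> R) : R := avg (fun w : W => F (config w)).

Lemma pushc_spread c t : pushc spread c t = expect (size t) (fun ws => c (map config ws)).
Proof.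
rewrite (pushc_avg (fun (_ : G) (w : W) => config w)); apply: expect_ext => ws sw.
by congr c; elim: t ws sw => [|x t IH] [|w ws] //= [/IH ->].
Qed.

(** By [N]-invariance the factor [s^-k] may be dropped; then multiplying by the
    retraction at [k] is the same as setting the value there. *)
Lemma pushc_lamp (k : 'I_K) (c : seq G -> R) t is_ : invariant_on N (size t) c ->
  size is_ = size t -> map a is_ = map retract t ->
  pushc (lamp k) c t =
  expect (size is_) (fun ws => c (map config (zipw (@setsite K d k) is_ ws))).
Proof.
move=> cN st ast.
rewrite (pushc_avg (fun x (w : W) => retract x * (s ^- k * config (setsite k ord0 w)))%g) st.
apply: expect_ext => ws sw.
rewrite -[RHS](cN (s ^- k)%g); last 2 first.
- exact: (subgroupV sgN (subgroupX k sgN Ns)).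
- by rewrite size_map size_zipw ?st.
congr c; elim: t is_ ws st ast sw {cN} => [|x t IH] [|i is_] [|w ws] //= [st] [ax ast] [sw].
congr (_ :: _); last exact: IH.
by rewrite -(config_setsite k i w) ax /site !mulgA mulVg mul1g.
Qed.

Hypothesis K0 : (0 < K)%N.

Lemma lamp_approx n c B eps (t : seq G) : bounded_on n.+1 B c -> invariant_on N n.+1 c ->
  0 < eps -> size t = n.+1 -> (forall x, x \in t -> exists i, a i = retract x) ->
  `|K%:R^-1 * (\sum_(k < K) pushc (lamp k) c t) - pushc spread c (nseq n.+1 1%g)| <=
    B * (eps + eps^-1 * (K%:R^-1 * d.+1%:R ^+ n.+1)).
Proof.
move=> cB cN e0 st ta.
have [is_ sis ais] : exists2 is_, size is_ = size t & map a is_ = map retract t.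
  elim: t ta {st} => [|x t IH] ta; first by exists [::].
  have [i ai] := ta x (mem_head _ _).
  have [y yt|is_ sis ais] := IH; first by apply: ta; rewrite inE yt orbT.
  by exists (i :: is_); rewrite /= ?sis ?ai ?ais.
rewrite (eq_bigr (fun k => expect (size is_)
    (fun ws => c (map config (zipw (@setsite K d k) is_ ws))))); last first.
  by move=> k _; apply: pushc_lamp => //; rewrite st.
rewrite pushc_spread size_nseq -st -sis.
apply: (resampling (F := fun ws => c (map config ws))) => //.
  by apply: le_trans (cB (nseq n.+1 1%g) _); rewrite ?size_nseq.
by move=> ws sw; apply: cB; rewrite size_map sw sis.
Qed.

(** The action of [spread] commutes with the coboundary, so it maps a cocycle to a
    constant cocycle; in odd degree the coboundary of a constant is this same
    constant, which is therefore zero. *)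
Lemma spread_odd n c : (forall t, size t = n.+2 -> dd c t = 0) -> odd n ->
  pushc spread c (nseq n.+1 1%g) = 0.
Proof.
move=> c0 on; have := pushc_dd (e := spread) (fun x F F' => avgB _ _)
  (fun x b => avgC w0 _) c (nseq n.+2 1%g).
rewrite (pushc_ext _ (c' := fun=> 0)); last by move=> t; rewrite size_nseq => /c0.
rewrite (dd_ext (c' := fun=> pushc spread c (nseq n.+1 1%g))); last first.
  by move=> t; rewrite size_nseq => -[st]; rewrite !pushc_spread size_nseq st.
have on2 : odd n.+2 by rewrite /= negbK.
by rewrite dd_const size_nseq on2 => <-; rewrite pushc_spread (expectC w0).
Qed.

(** The average over the sites of the prism homotopies, corrected for even [n] by
    the constant that the cocycle becomes under [spread]: on lists of odd length
    [n.+1] a constant is its own coboundary.  For odd [n] the constant is zero by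
    [spread_odd]. *)
Definition lamp_primitive n c (t : seq G) : R :=
  (if odd n then 0 else pushc spread c (nseq n.+1 1%g)) -
  K%:R^-1 * (\sum_(k < K) prism (lamp k) c t).

Lemma avgK_bound (F : 'I_K -> R) B : (forall k, `|F k| <= B) ->
  `|K%:R^-1 * (\sum_(k < K) F k)| <= B.
Proof.
move=> FB; rewrite normrM ger0_norm ?invr_ge0 ?ler0n //.
rewrite ler_pdivrMl ?ltr0n // (le_trans (ler_norm_sum _ _ _)) //.
by rewrite (le_trans (ler_sum _ (fun k _ => FB k))) // sumr_const card_ord mulr_natl.
Qed.

Lemma lamp_primitive_bound n c B : bounded_on n.+1 B c ->
  bounded_on n (n.+1%:R * B) (lamp_primitive n c).
Proof.
move=> cB t st; rewrite (le_trans (ler_normB _ _)) // -natr1 mulrDl mul1r addrC.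
apply: lerD.
  apply: avgK_bound => k; rewrite -st; apply: prism_bound.
    exact: lamp_bound.
  by move=> t'; rewrite st; exact: cB.
have B0 : 0 <= B by apply: le_trans (cB (nseq n.+1 1%g) _); rewrite ?size_nseq.
case: odd; first by rewrite normr0.
apply: pushc_bound; last by move=> t'; rewrite size_nseq; exact: cB.
by move=> x F B' FB; apply: (avg_bound w0).
Qed.

Lemma lamp_primitive_inv n c : invariant_on N n.+1 c ->
  invariant_on M n (lamp_primitive n c).
Proof.
move=> cN m t Mm st; rewrite /lamp_primitive; congr (_ - _ * _).
apply: eq_bigr => k _.
rewrite (prism_map (f := fun x => (m * x)%g)) //; last by move=> x F; exact: lamp_inv.
apply: (prism_ext (lamp k)) => t' st'; apply: cN; first exact: MN.
by rewrite st' st.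
Qed.

Lemma lamp_primitiveP n c t : (forall t, size t = n.+2 -> dd c t = 0) -> size t = n.+1 ->
  dd (lamp_primitive n c) t - c t = pushc spread c (nseq n.+1 1%g)
     - K%:R^-1 * (\sum_(k < K) pushc (lamp k) c t).
Proof.
move=> c0 st; rewrite /lamp_primitive ddB ddZ dd_sum dd_const st.
have -> : (if odd n.+1 then if odd n then 0 else pushc spread c (nseq n.+1 1%g) else 0) =
   pushc spread c (nseq n.+1 1%g).
  rewrite -[odd n.+1]/(~~ odd n).
  by case: (boolP (odd n)) => on; [exact: esym (spread_odd c0 on) |].
have KN0 : K%:R != 0 :> R by rewrite pnatr_eq0 -lt0n.
have -> : \sum_(k < K) pushc (lamp k) c t =
    \sum_(k < K) (dd (prism (lamp k) c) t + c t).
  apply: eq_bigr => k _.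
  have := prismP (e := lamp k) (lampB k) (lampC k) c t.
  have -> : prism (lamp k) (dd c) t = 0.
    rewrite (prism_ext _ (c' := fun=> 0 - 0)); last by move=> t'; rewrite st subrr => /c0.
    by rewrite (prismB (lampB k)) subrr.
  by move=> /eqP; rewrite addr0 subr_eq => /eqP.
rewrite big_split /= sumr_const card_ord mulrDr -[c t *+ K]mulr_natl mulKf //.
by rewrite opprD addrA.
Qed.

End Lamplighter.

(** For a finite list [L] only finitely many retractions occur; they serve as
    values of the configurations, and the number [K] of sites is chosen so that
    the variance is small. *)
Lemma lamp_approximation (R : realType) (G : groupType) (N M : set G) (s : G) n
    (c : seq G -> R) B (L : seq G) (eps : R) :
  subgroup N -> subgroup M -> M `<=` N -> N s ->
  (forall x y i, M x -> M y -> (0 < i)%N -> commute x (s ^+ i * y * s ^- i)%g) ->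
  bounded_on n.+1 B c -> invariant_on N n.+1 c ->
  (forall t, size t = n.+2 -> dd c t = 0) -> 0 < eps ->
  exists b, [/\ bounded_on n (n.+1%:R * B) b, invariant_on M n b &
    forall t, size t = n.+1 -> {subset t <= L} -> `|dd b t - c t| <= eps].
Proof.
move=> sgN sgM MN Ns comm cB cN c0 e0.
have B0 : 0 <= B by apply: le_trans (cB (nseq n.+1 1%g) _); rewrite ?size_nseq.
pose al := 1%g :: map (retract M) L.
pose a (i : 'I_(size L).+1) := nth 1%g al i.
have aM i : M (a i).
  case: i => -[|i] iL; first exact: subgroup1 sgM.
  by rewrite /a /= (nth_map 1%g) //; exact: retract_in.
pose eta := eps / (2 * (B + 1)).
have B1 : 0 < 2 * (B + 1) by lra.
have eta0 : 0 < eta by rewrite divr_gt0.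
pose D : R := (size L).+1%:R ^+ n.+1.
have D0 : 0 <= D by rewrite exprn_ge0 ?ler0n.
have De0 : 0 <= D / eta ^+ 2 by rewrite divr_ge0 // sqr_ge0.
pose K := (Num.bound (D / eta ^+ 2)).+1.
have KD : K%:R^-1 * D <= eta ^+ 2.
  rewrite ler_pdivrMl ?ltr0n // -ler_pdivrMr ?exprn_gt0 //.
  rewrite ltW // (lt_trans (archi_boundP De0)) // ltr_nat.
  by rewrite /K.
exists (lamp_primitive M s K a n c); split.
- exact: lamp_primitive_bound.
- by apply: lamp_primitive_inv cN.
move=> t st tL; rewrite (lamp_primitiveP M s a (ltn0Sn _) c0 st) distrC.
apply: le_trans (lamp_approx sgN Ns comm aM erefl (ltn0Sn _) cB cN eta0 st _) _.
  move=> x /tL xL.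
  have iL : ((index x L).+1 < (size L).+1)%N by rewrite ltnS index_mem.
  by exists (Ordinal iL); rewrite /a /= (nth_map 1%g) ?index_mem // nth_index.
apply: le_trans (_ : B * (eta + eta^-1 * eta ^+ 2) <= _).
  by rewrite ler_wpM2l // lerD2l ler_wpM2l // invr_ge0 ltW.
rewrite expr2 mulKf ?gt_eqF // /eta.
have -> : B * (eps / (2 * (B + 1)) + eps / (2 * (B + 1))) = eps * (B / (B + 1)).
  by field; rewrite gt_eqF //; lra.
by rewrite ger_pMr // ler_pdivrMr; lra.
Qed.

Section Ultralimit.
Variables (R : realType) (I : Type) (U : set_system I).
Hypothesis UU : UltraFilter U.
Implicit Types (b : I -> R) (l : R).

(** Limits along an ultrafilter of bounded real families, for which the finitely
    many operations of a coboundary pass to the limit. *)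
Definition ulim b l := forall eps, 0 < eps -> U [set i | `|b i - l| <= eps].

Lemma ulim_exists b B : (forall i, `|b i| <= B) -> exists2 l, ulim b l & `|l| <= B.
Proof.
move=> bB; pose E := [set x : R | U [set i | x <= b i]].
have bBl i : - B <= b i <= B by rewrite -ler_norml.
have EB : ubound E B.
  move=> x /filter_ex[i /= xi]; apply: le_trans xi _.
  by have /andP[] := bBl i.
have EN : E (- B) by apply: filterS filterT => i _ /=; have /andP[] := bBl i.
have hE : has_sup E by split; [exists (- B) | exists B].
exists (sup E).
  move=> eps e0.
  have [x expect xl] : exists2 x, E x & sup E - eps < x by apply: sup_adherent.
  have nE : ~ E (sup E + eps).
    by move=> /(sup_upper_bound hE); rewrite gerDl leNgt e0.
  have nU : U (~` [set i | sup E + eps <= b i])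
    by case: (in_ultra_setVsetC [set i | sup E + eps <= b i] UU).
  apply: filterS (filterI expect nU) => i [/= xi /negP]; rewrite -ltNge => bi.
  by rewrite ler_norml; lra.
rewrite ler_norml; apply/andP; split; first exact: sup_upper_bound hE _ EN.
by apply: ge_sup => //; exists (- B).
Qed.

Lemma ulim_unique b l l' : ulim b l -> ulim b l' -> l = l'.
Proof.
move=> bl bl'; apply/eqP; rewrite -subr_eq0 -normr_le0; apply/ler_addgt0Pr => eps e0.
rewrite add0r.
have e2 : 0 < eps / 2 by rewrite divr_gt0.
have [i [/= h1 h2]] := filter_ex (filterI (bl _ e2) (bl' _ e2)).
have -> : l - l' = (b i - l') - (b i - l) by ring.
by rewrite (le_trans (ler_normB _ _)) // [eps]splitr lerD.
Qed.

Lemma ulim_close b b' l :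
  (forall eps, 0 < eps -> U [set i | `|b i - b' i| <= eps]) -> ulim b l -> ulim b' l.
Proof.
move=> bb' bl eps e0; have e2 : 0 < eps / 2 by rewrite divr_gt0.
apply: filterS (filterI (bb' _ e2) (bl _ e2)) => i [/= h1 h2].
have -> : b' i - l = (b i - l) - (b i - b' i) by ring.
by rewrite (le_trans (ler_normB _ _)) // [eps]splitr lerD.
Qed.

Lemma ulimC l : ulim (fun=> l) l.
Proof.
by move=> eps e0; apply: filterS filterT => i _ /=; rewrite subrr normr0 ltW.
Qed.

Lemma ulimB b b' l l' : ulim b l -> ulim b' l' -> ulim (fun i => b i - b' i) (l - l').
Proof.
move=> bl bl' eps e0; have e2 : 0 < eps / 2 by rewrite divr_gt0.
apply: filterS (filterI (bl _ e2) (bl' _ e2)) => i [/= h1 h2].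
have -> : b i - b' i - (l - l') = (b i - l) - (b' i - l') by ring.
by rewrite (le_trans (ler_normB _ _)) // [eps]splitr lerD.
Qed.

Lemma ulim_dd (X : Type) (b : I -> seq X -> R) (l : seq X -> R) t :
  (forall t', (size t').+1 = size t -> ulim (b^~ t') (l t')) ->
  ulim (fun i => dd (b i) t) (dd l t).
Proof.
elim: t b l => [|x t IH] b l bl /=; first exact: ulimC.
apply: ulimB; first exact: bl.
by apply: (IH (fun i t' => b i (x :: t'))) => t' st; apply: bl; rewrite /= st.
Qed.

End Ultralimit.

(** An ascending union of subgroups [M j], extended by one element [z]; the model is
    the wreath product of [G] with the integers, where [M j] collects the lamps near
    the origin and [s j] moves them to disjoint places. *)
Record lamplighter (G : groupType) (N : set G) (M : nat -> set G) (s : nat -> G) (z : G) :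
    Prop := Lamplighter {
  lamplighter_subgroup : subgroup N;
  lamplighter_base j : subgroup (M j);
  lamplighter_incr j : M j `<=` M j.+1;
  lamplighter_sub j : M j `<=` N;
  lamplighter_shift j : N (s j);
  lamplighter_comm j x y i : M j x -> M j y -> (0 < i)%N ->
    commute x (s j ^+ i * y * s j ^- i)%g;
  lamplighter_gen : N z;
  lamplighter_norm j x : M j x -> exists j', M j' (z * x * z^-1)%g;
  lamplighter_span x : N x -> exists j m k, M j m /\ (x = m * z ^+ k \/ x = m * z ^- k)%g
}.

Section LamplighterAcyclic.
Variables (R : realType) (G : groupType) (N : set G) (M : nat -> set G) (s : nat -> G).
Variable z : G.
Hypothesis L : lamplighter N M s z.

Lemma lamplighter_le i j : (i <= j)%N -> M i `<=` M j.
Proof.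
move=> /subnK <-; elim: (j - i)%N => [//|d IH] x /IH.
exact: (lamplighter_incr L).
Qed.

(** Finitely many elements of the union, with all their conjugates by the first
    powers of [z], lie in one [M j]. *)
Lemma lamplighter_level (Phi : seq G) m : exists j, forall x, x \in Phi ->
  (exists j', M j' x) -> forall i, (i <= m)%N -> M j (z ^+ i * x * z ^- i)%g.
Proof.
elim: Phi => [|y Phi [j1 IH]]; first by exists 0%N.
have [[j0 My]|nMy] := pselect (exists j', M j' y); last first.
  by exists j1 => x; rewrite inE => /orP[/eqP -> //|]; exact: IH.
have [j2 h2] : exists j2, forall i, (i <= m)%N -> M j2 (z ^+ i * y * z ^- i)%g.
  elim: m {IH} => [|m [j2 IH]].
    exists j0 => i; rewrite leqn0 => /eqP ->.
    by rewrite expg0 invg1 mul1g mulg1.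
  have [j3 h3] := lamplighter_norm L (IH m (leqnn _)).
  exists (maxn j2 j3) => i; rewrite leq_eqVlt => /orP[/eqP ->|/IH].
    apply: (lamplighter_le (leq_maxr _ _)).
    by rewrite expgS invgM !mulgA in h3 *.
  exact: (lamplighter_le (leq_maxl _ _)).
exists (maxn j1 j2) => x; rewrite inE => /orP[/eqP -> _ i im|xP Mx i im].
  exact: (lamplighter_le (leq_maxr _ _)) (h2 i im).
exact: (lamplighter_le (leq_maxl _ _)) (IH x xP Mx i im).
Qed.

(** The tails of the directed set of pairs of a finite list [Phi] and a number [m]:
    the approximate primitive for [(Phi, m)] is good on [Phi] and is averaged over
    the powers [z^i], [i <= m]. *)
Definition exhaustion : set_system (seq G * nat) :=
  [set S : set (seq G * nat) | exists (Phi0 : seq G) m0,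
    forall (Phi : seq G) m, {subset Phi0 <= Phi} -> (m0 <= m)%N -> S (Phi, m)].

Lemma exhaustion_proper : ProperFilter exhaustion.
Proof.
split; first by move=> [Phi [m /(_ Phi m)]]; apply.
split.
- by exists [::], 0%N.
- move=> S T [P1 [m1 h1]] [P2 [m2 h2]]; exists (P1 ++ P2), (maxn m1 m2) => P m sP.
  rewrite geq_max => /andP[l1 l2]; split.
    by apply: h1 => // x xP; apply: sP; rewrite mem_cat xP.
  by apply: h2 => // x xP; apply: sP; rewrite mem_cat xP orbT.
- by move=> S T ST [P1 [m1 h1]]; exists P1, m1 => P m h h'; apply/ST/h1.
Qed.

(** The ultralimit over [Phi] and [m] is exactly a primitive; it is invariant
    under each [M j], and it is invariant under [z] because averaging over [m]
    powers leaves an error of order [1 / m]. *)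
Lemma lamplighter_acyclic n : uniformly_acyclic_in N n (n.+1%:R : R).
Proof.
move=> c B cB cN c0.
have B0 : 0 <= B by apply: le_trans (cB (nseq n.+1 1%g) _); rewrite ?size_nseq.
have C0 : 0 <= n.+1%:R * B by rewrite mulr_ge0.
(* The function [t |-> b (zt i t)] is invariant under [x] as soon as [b] is invariant
   under [z^i x z^-i]; all these lie in one [M j] by [lamplighter_level]. *)
pose zt i (t : seq G) := map (fun x => z ^+ i * x)%g t.
have /choice[b bP] : forall p : seq G * nat, exists b : seq G -> R,
   [/\ bounded_on n (n.+1%:R * B) b,
     forall x t i, x \in p.1 -> (exists j, M j x) -> (i <= p.2)%N -> size t = n ->
       b (zt i (map (fun y => x * y)%g t)) = b (zt i t) &
     forall t i, size t = n.+1 -> {subset t <= p.1} -> (i <= p.2)%N ->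
       `|dd b (zt i t) - c t| <= p.2.+1%:R^-1].
  move=> [Phi m] /=; have [j hj] := lamplighter_level Phi m.
  have [|b [bB bM bd]] := lamp_approximation
    [seq (z ^+ i * x)%g | x <- Phi, i <- iota 0 m.+1] (eps := m.+1%:R^-1)
    (lamplighter_subgroup L) (lamplighter_base L j) (@lamplighter_sub _ _ _ _ _ L j)
    (lamplighter_shift L j) (fun x y i => lamplighter_comm L (i := i)) cB cN c0.
    by rewrite invr_gt0.
  exists b; split=> // [x t i xP Mx im st|t i st tP im].
    have := bM _ (zt i t) (hj x xP Mx i im); rewrite size_map => /(_ st) <-.
    by congr b; rewrite /zt -!map_comp; apply: eq_map => y /=; rewrite !mulgA mulgVK.
  rewrite -(cN (z ^+ i)%g t) //; last first.
    exact: (subgroupX i (lamplighter_subgroup L) (lamplighter_gen L)).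
  apply: bd; first by rewrite size_map.
  move=> y /mapP[x xt ->]; apply/allpairsP; exists (x, i).
  by split=> //; [exact: tP | rewrite mem_iota ltnS im].
pose beta (p : seq G * nat) t : R := p.2.+1%:R^-1 * \sum_(i < p.2.+1) b p (zt i t).
have avgm m (F : 'I_m.+1 -> R) D : (forall i, `|F i| <= D) ->
    `|m.+1%:R^-1 * \sum_i F i| <= D by exact: avgK_bound.
have betaB p : bounded_on n (n.+1%:R * B) (beta p).
  move=> t st; apply: avgm => i; have [+ _ _] := bP p; apply.
  by rewrite size_map.
have betaM p x t : x \in p.1 -> (exists j, M j x) -> size t = n ->
    beta p (map (fun y => x * y)%g t) = beta p t.
  move=> xp Mx st; congr (_ * _); apply: eq_bigr => i _.
  by have [_ + _] := bP p; apply => //; rewrite -ltnS.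
have betaz p t : size t = n ->
    `|beta p (map (fun y => z * y)%g t) - beta p t| <= p.2.+1%:R^-1 * (2 * (n.+1%:R * B)).
  move=> st; rewrite /beta -mulrBr normrM ger0_norm ?invr_ge0 // ler_wpM2l ?invr_ge0 //.
  have -> : \sum_(i < p.2.+1) b p (zt i (map (fun y => z * y)%g t)) =
            \sum_(i < p.2.+1) b p (zt i.+1 t).
    apply: eq_bigr => i _; congr (b p _); rewrite /zt -map_comp.
    by apply: eq_map => y /=; rewrite expgSr mulgA.
  rewrite -sumrB -(big_mkord predT (fun i => b p (zt i.+1 t) - b p (zt i t))).
  rewrite (telescope_sumr (fun i => b p (zt i t))) //.
  rewrite (le_trans (ler_normB _ _)) // mulr2n mulrDl mul1r.
  by have [bB _ _] := bP p; apply: lerD; apply: bB; rewrite size_map.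
have betad p t : size t = n.+1 -> {subset t <= p.1} -> `|dd (beta p) t - c t| <= p.2.+1%:R^-1.
  move=> st tp; rewrite /beta ddZ dd_sum.
  have -> : p.2.+1%:R^-1 * (\sum_(i < p.2.+1) dd (fun t => b p (zt i t)) t) - c t =
     p.2.+1%:R^-1 * (\sum_(i < p.2.+1) (dd (b p) (zt i t) - c t)).
    rewrite sumrB sumr_const card_ord -[c t *+ _]mulr_natl mulrBr mulKf ?pnatr_eq0 //.
    by congr (_ * _ - _); apply: eq_bigr => i _; rewrite dd_map.
  apply: avgm => i; have [_ _ +] := bP p; apply => //.
  by rewrite -ltnS.
have [U [UU exU]] := ultraFilterLemma exhaustion_proper.
have small (D eps : R) : 0 <= D -> 0 < eps ->
    exists m0, forall m, (m0 <= m)%N -> m.+1%:R^-1 * D <= eps.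
  move=> D0 e0; exists (Num.bound (D / eps)) => m mm.
  rewrite ler_pdivrMl ?ltr0n // -ler_pdivrMr //.
  have De : 0 <= D / eps by rewrite divr_ge0 // ltW.
  rewrite ltW // (lt_trans (archi_boundP De)) // ltr_nat.
  by rewrite ltnS.
have /choice[binf binfP] : forall t, exists l, size t = n ->
    ulim U (beta^~ t) l /\ `|l| <= n.+1%:R * B.
  move=> t; have [st|nst] := eqVneq (size t) n; last first.
    by exists 0 => st; rewrite st eqxx in nst.
  have [l h1 h2] := ulim_exists UU (b := beta^~ t) (fun p => betaB p t st).
  by exists l.
have invM x t : (exists j, M j x) -> size t = n ->
    binf (map (fun y => x * y)%g t) = binf t.
  move=> Mx st; apply: (ulim_unique UU (b := beta^~ t)); last by have [] := binfP t st.
  have [h _] := binfP (map (fun y => x * y)%g t) (etrans (size_map _ _) st).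
  apply: (ulim_close UU _ h) => eps e0; apply: exU; exists [:: x], 0%N => Phi m xP _ /=.
  by rewrite betaM ?subrr ?normr0 ?ltW //; apply: xP; rewrite inE.
have invz t : size t = n -> binf (map (fun y => z * y)%g t) = binf t.
  move=> st; apply: (ulim_unique UU (b := beta^~ t)); last by have [] := binfP t st.
  have [h _] := binfP (map (fun y => z * y)%g t) (etrans (size_map _ _) st).
  apply: (ulim_close UU _ h) => eps e0; apply: exU.
  have [|m0 hm] := small (2 * (n.+1%:R * B)) eps _ e0; first by rewrite mulr_ge0.
  exists [::], m0 => Phi m _ mm /=.
  by rewrite (le_trans (betaz (Phi, m) t st)) //; exact: hm.
have invzk k t : size t = n -> binf (map (fun y => z ^+ k * y)%g t) = binf t.
  elim: k t => [|k IH] t st.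
    by congr binf; rewrite -[RHS]map_id; apply: eq_map => y; rewrite expg0 mul1g.
  rewrite -[RHS](IH t st) -[RHS]invz ?size_map //.
  by congr binf; rewrite -map_comp; apply: eq_map => y /=; rewrite expgS mulgA.
exists binf; split.
- by move=> t st; have [] := binfP t st.
- move=> x t /(lamplighter_span L)[j [m [k [Mm [->|->]]]]] st.
    rewrite -[RHS](invzk k) // -[RHS](invM m) ?size_map //; last by exists j.
    by congr binf; rewrite -map_comp; apply: eq_map => y; rewrite /= mulgA.
  rewrite -[RHS](_ : binf (map (fun y => z ^- k * y)%g t) = _).
    rewrite -[RHS](invM m) ?size_map //; last by exists j.
    by congr binf; rewrite -map_comp; apply: eq_map => y; rewrite /= mulgA.
  rewrite -[LHS](invzk k) ?size_map // -map_comp.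
  by congr binf; rewrite -[RHS]map_id; apply: eq_map => y /=; rewrite mulVKg.
- move=> t st; apply: (ulim_unique UU (b := fun p => dd (beta p) t)).
    by apply: (ulim_dd UU) => t'; rewrite st => -[st']; have [] := binfP t' st'.
  apply: (ulim_close UU _ (ulimC UU (c t))) => eps e0; apply: exU.
  have [m0 hm] := small 1 eps ler01 e0.
  exists t, m0 => Phi m tP mm /=; rewrite distrC.
  by rewrite (le_trans (betad (Phi, m) t st tP)) //= -[_^-1]mulr1; exact: hm.
Qed.

End LamplighterAcyclic.

Local Close Scope ring_scope.

(** * Bijections, words and presentations *)

Section Bijections.
Variable X : Type.

Record bijection := Bijection {
  bij_fun :> X -> X;
  bij_inv : X -> X;
  bijK : cancel bij_fun bij_inv;
  bijVK : cancel bij_inv bij_fun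
}.

(** The inverse is determined by the bijection. *)
Lemma bijection_eq (f g : bijection) : f =1 g -> f = g.
Proof.
case: f g => [f f' fK f'K] [g g' gK g'K] /= fg.
have {}fg : f = g by apply: funext.
move: fK f'K; rewrite fg => fK f'K.
have f'g' : f' = g' by apply: funext => x; apply: (can_inj gK); rewrite f'K g'K.
move: fK f'K; rewrite f'g' => fK f'K.
by rewrite (Prop_irrelevance fK gK) (Prop_irrelevance f'K g'K).
Qed.

HB.instance Definition _ := gen_eqMixin bijection.
HB.instance Definition _ := gen_choiceMixin bijection.

Definition bij1 : bijection := @Bijection id id (frefl _) (frefl _).
Definition bijV (f : bijection) : bijection := Bijection (bijVK f) (bijK f).
Definition bijM (f g : bijection) : bijection :=
  Bijection (can_comp (bijK f) (bijK g)) (can_comp (bijVK g) (bijVK f)).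

Fact bijMA : associative bijM. Proof. by move=> f g h; exact: bijection_eq. Qed.
Fact bij1M : left_id bij1 bijM. Proof. by move=> f; exact: bijection_eq. Qed.
Fact bijM1 : right_id bij1 bijM. Proof. by move=> f; exact: bijection_eq. Qed.
Fact bijVM : left_inverse bij1 bijV bijM.
Proof. by move=> f; apply: bijection_eq => x; exact: (bijK f x). Qed.
Fact bijMV : right_inverse bij1 bijV bijM.
Proof. by move=> f; apply: bijection_eq => x; exact: (bijVK f x). Qed.

HB.instance Definition _ := isGroup.Build bijection bijMA bij1M bijM1 bijVM bijMV.

Lemma bijME (f g : bijection) x : (f * g) x = f (g x). Proof. by []. Qed.
Lemma bij_iter (f : bijection) n x : (f ^+ n) x = iter n f x.
Proof. by elim: n x => [|n IH] x; rewrite ?expg0 // expgS bijME IH. Qed.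

End Bijections.

Section Action.
Variables (G : groupType) (X : Type) (act : G -> X -> X).
Hypotheses (act1 : act 1 =1 id) (actM : forall g h x, act (g * h) x = act g (act h x)).

Fact actK g : cancel (act g) (act g^-1).
Proof. by move=> x; rewrite -actM mulVg act1. Qed.
Fact actVK g : cancel (act g^-1) (act g).
Proof. by move=> x; rewrite -actM mulgV act1. Qed.

Definition act_bij g : bijection X := Bijection (actK g) (actVK g).

Fact act_bij_morph : (act_bij 1 = 1) * {morph act_bij : g h / g * h}.
Proof.
by split=> [|g h]; apply: bijection_eq => x /=; [exact: act1 | exact: actM].
Qed.

HB.instance Definition _ := isUMagmaMorphism.Build G (bijection X) act_bij act_bij_morph.

End Action.

Section Words.
Variable X : choiceType.
(** The boolean marks inverse letters. *)
Definition word := seq (bool * X).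
Implicit Types (u v w : word).

Definition winv w : word := rev (map (fun l => (~~ l.1, l.2)) w).

Definition evalw (H : groupType) (f : X -> H) w : H :=
  \prod_(l <- w) (if l.1 then (f l.2)^-1 else f l.2).

Lemma evalw_nil (H : groupType) (f : X -> H) : evalw f [::] = 1.
Proof. exact: big_nil. Qed.

Lemma evalw_cons (H : groupType) (f : X -> H) l w :
  evalw f (l :: w) = (if l.1 then (f l.2)^-1 else f l.2) * evalw f w.
Proof. exact: big_cons. Qed.

Lemma evalw_cat (H : groupType) (f : X -> H) u v : evalw f (u ++ v) = evalw f u * evalw f v.
Proof. exact: big_cat. Qed.

Lemma evalw1 (H : groupType) (f : X -> H) x : evalw f [:: (false, x)] = f x.
Proof. by rewrite evalw_cons evalw_nil mulg1. Qed.

Lemma evalw_inv (H : groupType) (f : X -> H) w : evalw f (winv w) = (evalw f w)^-1.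
Proof.
elim: w => [|[b x] w IH]; first by rewrite /winv evalw_nil invg1.
rewrite /winv map_cons rev_cons -cats1 evalw_cat -/(winv w) IH [in RHS]evalw_cons invgM.
by congr (_ * _); rewrite evalw_cons evalw_nil mulg1 /=; case: b; rewrite ?invgK.
Qed.

Lemma evalw_morph (H K : groupType) (phi : {ghom H -> K}) (f : X -> H) w :
  phi (evalw f w) = evalw (fun x => phi (f x)) w.
Proof.
elim: w => [|[b x] w IH]; first by rewrite !evalw_nil gmulf1.
by rewrite !evalw_cons gmulfM IH /=; case: b; rewrite ?gmulfV.
Qed.

Lemma evalw_eq (H : groupType) (f f' : X -> H) w :
  (forall l, l \in w -> f l.2 = f' l.2) -> evalw f w = evalw f' w.
Proof.
by move=> ff'; rewrite /evalw big_seq [RHS]big_seq; apply: eq_bigr => l /ff' ->.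
Qed.

Definition wcomm u v : word := u ++ v ++ winv u ++ winv v.
Definition wconj k x v : word := nseq k (false, x) ++ v ++ nseq k (true, x).

Lemma evalw_nseq (H : groupType) (f : X -> H) k x : evalw f (nseq k (false, x)) = f x ^+ k.
Proof.
by elim: k => [|k IH] /=; rewrite ?evalw_nil ?expg0 // evalw_cons IH expgS.
Qed.

Lemma evalw_nseqV (H : groupType) (f : X -> H) k x : evalw f (nseq k (true, x)) = f x ^- k.
Proof.
elim: k => [|k IH] /=; first by rewrite evalw_nil expg0 invg1.
by rewrite evalw_cons IH expgSr invgM.
Qed.

Lemma evalw_conj (H : groupType) (f : X -> H) k x v :
  evalw f (wconj k x v) = f x ^+ k * evalw f v * f x ^- k.
Proof. by rewrite !evalw_cat evalw_nseq evalw_nseqV mulgA. Qed.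

Lemma evalw_comm (H : groupType) (f : X -> H) u v :
  evalw f (wcomm u v) = 1 <-> commute (evalw f u) (evalw f v).
Proof.
rewrite !evalw_cat !evalw_inv mulgA -invgM; split=> [/divg1_eq //|->].
by rewrite mulgV.
Qed.

End Words.

Section Presentation.
Variables (X : choiceType) (Rel : word X -> Prop).
Implicit Types (u v w : word X).

(** Generating the congruence inductively, rather than as a normal closure, gives
    lifting of homomorphisms by an induction on derivations, and shows that each
    derivation uses finitely many relations. *)
Inductive cong : word X -> word X -> Prop :=
| cong_refl u : cong u u
| cong_sym u v : cong u v -> cong v u
| cong_trans u v w : cong u v -> cong v w -> cong u w
| cong_cat u u' v v' : cong u u' -> cong v v' -> cong (u ++ v) (u' ++ v')
| cong_cancel b x : cong [:: (b, x); (~~ b, x)] [::]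
| cong_rel r : Rel r -> cong r [::].

Definition congb : rel (word X) := fun u v => `[< cong u v >].

Fact congb_equiv : equiv_class_of congb.
Proof.
split=> [u|u v|v u w].
- exact/asboolP/cong_refl.
- by apply/asboolP/asboolP => /cong_sym.
- by move=> /asboolP uv /asboolP vw; apply/asboolP/(cong_trans uv vw).
Qed.

Canonical congb_equivRel := EquivRelPack congb_equiv.
Canonical congb_encModRel := defaultEncModRel congb.

Definition presented := {eq_quot congb}%qT.
HB.instance Definition _ := Choice.on presented.
HB.instance Definition _ : EqQuotient _ congb presented := EqQuotient.on presented.

Definition cls w : presented := \pi_(presented)%qT w.

Lemma clsP u v : cls u = cls v <-> cong u v.
Proof.
split=> [/eqmodP/asboolP //|uv].
exact/eqmodP/asboolP.
Qed.

Lemma cls_repr x : cls (repr x) = x. Proof. exact: reprK. Qed.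

Lemma repr_cls w : cong (repr (cls w)) w.
Proof. exact/clsP/cls_repr. Qed.

Lemma winvK : involutive (@winv X).
Proof.
move=> w; rewrite /winv map_rev revK -map_comp -[RHS]map_id; apply: eq_map => -[b x] /=.
by rewrite negbK.
Qed.

Lemma cong_winv w : cong (w ++ winv w) [::].
Proof.
elim: w => [|[b x] w IH]; first exact: cong_refl.
rewrite /winv map_cons rev_cons -cats1 -/(winv w) -cat1s -catA (catA w).
apply: cong_trans (cong_cancel b x).
apply: (cong_cat (cong_refl [:: (b, x)])).
exact: (cong_cat IH (cong_refl [:: (~~ b, x)])).
Qed.

Lemma cong_winvl w : cong (winv w ++ w) [::].
Proof. by rewrite -{2}(winvK w); exact: cong_winv. Qed.

Lemma cong_inv u v : cong u v -> cong (winv u) (winv v).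
Proof.
move=> uv; rewrite -[winv u]cats0.
apply: cong_trans (cong_cat (cong_refl _) (cong_sym (cong_winv v))) _.
rewrite catA -[X in cong _ X]cat0s; apply: cong_cat (cong_refl _).
apply: cong_trans (cong_winvl u); apply: cong_cat (cong_refl _) (cong_sym uv).
Qed.

Definition pmul (x y : presented) : presented := cls (repr x ++ repr y).
Definition pinv (x : presented) : presented := cls (winv (repr x)).

Lemma cls_cat u v : cls (u ++ v) = pmul (cls u) (cls v).
Proof. by apply/clsP/cong_cat; apply: cong_sym; exact: repr_cls. Qed.

Lemma cls_inv u : cls (winv u) = pinv (cls u).
Proof. by apply/clsP/cong_inv/cong_sym; exact: repr_cls. Qed.

Fact pmulA : associative pmul.
Proof.
by move=> x y z; rewrite -[x]cls_repr -[y]cls_repr -[z]cls_repr -!cls_cat catA.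
Qed.
Fact pmul1 : left_id (cls [::]) pmul.
Proof. by move=> x; rewrite -[x]cls_repr -cls_cat. Qed.
Fact pmulr1 : right_id (cls [::]) pmul.
Proof. by move=> x; rewrite -[x]cls_repr -cls_cat cats0. Qed.
Fact pmulV : left_inverse (cls [::]) pinv pmul.
Proof. by move=> x; rewrite -[x]cls_repr -cls_inv -cls_cat; exact/clsP/cong_winvl. Qed.
Fact pmulrV : right_inverse (cls [::]) pinv pmul.
Proof. by move=> x; rewrite -[x]cls_repr -cls_inv -cls_cat; exact/clsP/cong_winv. Qed.

HB.instance Definition _ := isGroup.Build presented pmulA pmul1 pmulr1 pmulV pmulrV.

Definition gen (x : X) : presented := cls [:: (false, x)].

Lemma clsM u v : cls (u ++ v) = cls u * cls v. Proof. exact: cls_cat. Qed.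
Lemma clsV u : cls (winv u) = (cls u)^-1. Proof. exact: cls_inv. Qed.

Lemma clsE w : cls w = evalw gen w.
Proof.
elim: w => [|[b x] w IH]; first by rewrite evalw_nil.
rewrite evalw_cons -IH -cat1s clsM; congr (_ * _).
by case: b; rewrite //= -clsV.
Qed.

Lemma gen_rel r : Rel r -> evalw gen r = 1.
Proof. by move=> Rr; rewrite -clsE; exact/clsP/cong_rel. Qed.

Lemma presented_ind (P : presented -> Prop) : P 1 ->
  (forall x y, P y -> P (gen x * y)) -> (forall x y, P y -> P ((gen x)^-1 * y)) ->
  forall x, P x.
Proof.
move=> P1 Pg PV x; rewrite -[x]cls_repr clsE; elim: (repr x) => [|[b y] w IH].
  by rewrite evalw_nil.
by rewrite evalw_cons /=; case: b; [exact: PV | exact: Pg].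
Qed.

Section Lift.
Variables (H : groupType) (f : X -> H).

(** The proof [fR] is an argument so that the morphism structure below can be
    inferred from the term. *)
Definition plift (fR : forall r, Rel r -> evalw f r = 1) (x : presented) : H :=
  evalw f (repr x).

Hypothesis fR : forall r, Rel r -> evalw f r = 1.

Lemma evalw_cong u v : cong u v -> evalw f u = evalw f v.
Proof.
elim=> {u v}.
- by [].
- by [].
- by move=> u v w _ -> _ ->.
- by move=> u u' v v' _ uu' _ vv'; rewrite !evalw_cat uu' vv'.
- by move=> b x; rewrite !evalw_cons /= evalw_nil mulg1; case: b; rewrite ?mulVg ?mulgV.
- by move=> r /fR ->; rewrite evalw_nil.
Qed.

Lemma plift_cls w : plift fR (cls w) = evalw f w.
Proof. exact/evalw_cong/repr_cls. Qed.

Fact plift_morph : (plift fR 1 = 1) * {morph plift fR : x y / x * y}.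
Proof.
split=> [|x y]; first by rewrite -[1]/(cls [::]) plift_cls evalw_nil.
by rewrite -[x]cls_repr -[y]cls_repr -clsM !plift_cls evalw_cat.
Qed.

HB.instance Definition _ := isUMagmaMorphism.Build presented H (plift fR) plift_morph.

Lemma plift_gen x : plift fR (gen x) = f x.
Proof. by rewrite plift_cls evalw1. Qed.

End Lift.

Lemma presented_hom_eq (H : groupType) (phi psi : {ghom presented -> H}) :
  (forall x, phi (gen x) = psi (gen x)) -> phi =1 psi.
Proof.
move=> pp; apply: presented_ind; first by rewrite !gmulf1.
  by move=> x y IH; rewrite !gmulfM pp IH.
by move=> x y IH; rewrite !gmulfM !gmulfV pp IH.
Qed.

End Presentation.

(** * Torsion and crossings *)

(** The facts about torsion in an amalgam of [A] and [B] over [C] are derived here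
    from a cocycle that counts edges, not from a tree. *)
Definition right_invariant (E : groupType) (T : Type) (S : set E) (f : E -> T) :=
  forall g s, S s -> f (g * s) = f g.

Lemma torsion_order (E : groupType) (q : E) : torsion q ->
  exists k, [/\ (0 < k)%N, q ^+ k = 1 & forall s, (0 < s < k)%N -> q ^+ s <> 1].
Proof.
case=> n n0 qn.
have ex : exists k, `[< (0 < k)%N /\ q ^+ k = 1 >] by exists n; exact/asboolP.
case: (ex_minnP ex) => k /asboolP[k0 qk] kmin; exists k; split=> // s /andP[s0 sk] qs.
have /kmin : `[< (0 < s)%N /\ q ^+ s = 1 >] by exact/asboolP.
by rewrite leqNgt sk.
Qed.

Lemma torsion_conj (E : groupType) (q g : E) : torsion q -> torsion (q ^ g).
Proof. by case=> n n0 qn; exists n => //; rewrite -conjXg qn conj1g. Qed.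

Lemma torsionX (E : groupType) (q : E) s : torsion q -> torsion (q ^+ s).
Proof. by case=> n n0 qn; exists n => //; rewrite -expgnA mulnC expgnA qn expg1n. Qed.

(** If no nontrivial power of [q] is conjugate into [S], then [q] acts freely, as a
    cyclic group of order [k], on the cosets of [S].  A choice of a base point in
    each orbit labels the cosets modulo [k], and [q] changes the labels by one. *)
Section Phase.
Variables (E : groupType) (S : set E) (q : E) (k : nat).
Hypotheses (sgS : subgroup S) (k0 : (0 < k)%N) (qk : q ^+ k = 1).
Hypothesis qfree : forall g s, (0 < s < k)%N -> ~ S (q ^+ s ^ g).

Lemma phase_exists : exists p : E -> nat,
  [/\ forall g, (p g < k)%N, right_invariant S p & forall g, p g = ((p (q * g)%g).+1 %% k)%N].
Proof.
pose O g := [set h | exists i, S (h^-1 * (q ^+ i * g))].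
pose rep g := xget 1 (O g).
have repP g : O g (rep g).
  rewrite /rep; case: xgetP => [//|/(_ g)/=[]].
  by exists 0%N; rewrite expg0 mul1g mulVg; exact: subgroup1 sgS.
have OS g s : S s -> O (g * s) = O g.
  move=> Ss; apply/seteqP; split=> h [i hi]; exists i.
    have := subgroupM sgS hi (subgroupV sgS Ss).
    by rewrite -!mulgA mulgV mulg1.
  by rewrite !mulgA; apply: (subgroupM sgS) => //; rewrite -!mulgA.
have Oq g : O (q * g) = O g.
  apply/seteqP; split=> h [i hi].
    by exists i.+1; rewrite expgSr -mulgA.
  exists (i + k.-1)%N; rewrite [q ^+ _ * _]mulgA -expgSr -addnS prednK // expgnDr qk mulg1.
  exact: hi.
have redk i : q ^+ (i %% k) = q ^+ i.
  by rewrite [in RHS](divn_eq i k) expgnDr mulnC expgnA qk expg1n mul1g.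
have /choice[p pP] : forall g, exists i, (i < k)%N /\ S ((rep g)^-1 * (q ^+ i * g)).
  move=> g; have [i hi] := repP g; exists (i %% k)%N.
  by rewrite ltn_mod k0 redk.
have puniq g i j : (i < k)%N -> (j < k)%N -> S ((rep g)^-1 * (q ^+ i * g)) ->
    S ((rep g)^-1 * (q ^+ j * g)) -> i = j.
  wlog ij : i j / (i <= j)%N => [H|].
    by case: (leqP i j) => [|/ltnW] ij ik jk Si Sj; [|symmetry]; apply: H.
  move=> ik jk Si Sj; apply/eqP; rewrite eqn_leq ij /= leqNgt; apply/negP => lij.
  apply: (qfree (g := g) (s := j - i)); first by rewrite subn_gt0 lij (leq_ltn_trans (leq_subr _ _)).
  have := subgroupM sgS (subgroupV sgS Si) Sj.
  rewrite invgM invgK [(q ^+ i * g)^-1]invgM -!mulgA mulVKg.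
  by rewrite conjgE -{1}(subnKC ij) expgnDr -!mulgA mulKg.
exists p; split=> [g|g s Ss|g]; first by have [] := pP g.
  have [pk Sp] := pP g; have [pk' Sp'] := pP (g * s).
  have rgs : rep (g * s) = rep g by rewrite /rep OS.
  apply: (puniq g) => //; rewrite rgs in Sp'.
  have := subgroupM sgS Sp' (subgroupV sgS Ss).
  by rewrite !mulgA mulgK.
have [pk Sp] := pP g; have [pk' Sp'] := pP (q * g).
have rgs : rep (q * g) = rep g by rewrite /rep Oq.
apply: (puniq g) => //; first by rewrite ltn_mod.
by rewrite redk expgSr -mulgA -rgs.
Qed.

End Phase.

Local Open Scope ring_scope.

Lemma mulz_neq1 (k : nat) (z : int) : (1 < k)%N -> k%:Z * z <> 1.
Proof. by move=> k1; have [z0|z1] := lerP z 0; nia. Qed.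

(** In the tree of an amalgam the vertices are the cosets of [A] and of [B], and
    the coset [g C] is the edge between [g A] and [g B].  Functions on edges are
    right [C]-invariant functions on [E]. *)
Section Amalgam.
Variables (E : groupType) (A B C : set E) (b : E).
Hypotheses (sgA : subgroup A) (sgB : subgroup B) (sgC : subgroup C).
Hypotheses (CA : C `<=` A) (CB : C `<=` B) (Bb : B b).
Hypothesis E_gen : forall P : E -> Prop, P 1%g -> (forall a x, A a -> P x -> P (a * x)%g) ->
  (forall x, P x -> P (b * x)%g) -> (forall x, P x -> P (b^-1 * x)%g) -> forall x, P x.
Hypothesis B_torsion_free : forall y, B y -> torsion y -> y = 1%g.

Definition lact (y : E) (f : E -> int) : E -> int := fun g => f (y^-1 * g)%g.

(** [D x f] stands for the sum of [f], with signs, over the edges of the path from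
    the vertex [A] to its translate [x^-1 A].  For [b] in [B] the path has two
    edges, [C] and [b^-1 C], with opposite signs; for elements of [A] it is
    trivial. *)
Record crossing (D : E -> (E -> int) -> int) : Prop := Crossing {
  crossingM x y f : right_invariant C f -> D (x * y)%g f = D y f + D x (lact y f);
  crossingB x f f' : right_invariant C f -> right_invariant C f' ->
    D x (fun g => f g - f' g) = D x f - D x f';
  crossingZ x (k : int) f : right_invariant C f -> D x (fun g => k * f g) = k * D x f;
  crossing_base a f : right_invariant C f -> A a -> D a f = 0;
  crossing_step f : right_invariant C f -> D b f = f 1%g - f b^-1%g
}.

Variable D : E -> (E -> int) -> int.
Hypothesis DC : crossing D.

Lemma right_invariantS (T : Type) (S S' : set E) (f : E -> T) :
  S' `<=` S -> right_invariant S f -> right_invariant S' f.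
Proof. by move=> SS' fS g s /SS'; exact: fS. Qed.

Lemma right_invariant_lact S y f : right_invariant S f -> right_invariant S (lact y f).
Proof. by move=> fS g s Ss; rewrite /lact mulgA fS. Qed.

Lemma crossing1 f : right_invariant C f -> D 1%g f = 0.
Proof.
move=> fC; have := crossingM DC 1%g 1%g fC; rewrite mulg1.
have -> : lact 1%g f = f by apply: funext => g; rewrite /lact invg1 mul1g.
by move=> /eqP; rewrite -subr_eq subrr => /eqP.
Qed.

Lemma crossing_stepV f : right_invariant C f -> D b^-1%g f = f 1%g - f b.
Proof.
move=> fC; have := crossingM DC b b^-1%g fC.
rewrite mulgV crossing1 // (crossing_step DC); last exact: right_invariant_lact.
by rewrite /lact invgK mulg1 mulgV => /eqP; rewrite eq_sym addr_eq0 opprB => /eqP.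
Qed.

(** When [f] only depends on the [A]-vertex of an edge, the sum telescopes along the
    path, which alternates between the two kinds of vertices. *)
Lemma crossing_vertexA x f : right_invariant A f -> D x f = f 1%g - f x^-1%g.
Proof.
move: x f; apply: E_gen.
- by move=> f fA; rewrite crossing1 ?invg1 ?subrr //; exact: right_invariantS fA.
- move=> a x Aa IH f fA; have fC := right_invariantS CA fA.
  rewrite (crossingM DC) // (crossing_base DC _ Aa); last exact: right_invariant_lact.
  by rewrite IH // addr0 invgM fA //; exact: subgroupV.
- move=> x IH f fA; have fC := right_invariantS CA fA.
  rewrite (crossingM DC) // (crossing_step DC); last exact: right_invariant_lact.
  by rewrite IH // /lact invgM mulg1 addrA subrK.
- move=> x IH f fA; have fC := right_invariantS CA fA.
  rewrite (crossingM DC) // crossing_stepV; last exact: right_invariant_lact.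
  by rewrite IH // /lact invgM invgK mulg1 addrA subrK.
Qed.

(** When [f] only depends on the [B]-vertex, the two edges at each inner
    [B]-vertex of the path cancel, and both ends of the path are [A]-vertices. *)
Lemma crossing_vertexB x f : right_invariant B f -> D x f = 0.
Proof.
move: x f; apply: E_gen.
- by move=> f fB; rewrite crossing1 //; exact: right_invariantS fB.
- move=> a x Aa IH f fB; have fC := right_invariantS CB fB.
  rewrite (crossingM DC) // (crossing_base DC _ Aa); last exact: right_invariant_lact.
  by rewrite IH // addr0.
- move=> x IH f fB; have fC := right_invariantS CB fB.
  rewrite (crossingM DC) // (crossing_step DC); last exact: right_invariant_lact.
  by rewrite IH // add0r /lact mulg1 fB ?subrr //; exact: subgroupV.
- move=> x IH f fB; have fC := right_invariantS CB fB.
  rewrite (crossingM DC) // crossing_stepV; last exact: right_invariant_lact.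
  by rewrite IH // add0r /lact mulg1 fB ?subrr.
Qed.

(** For [f] fixed by [q] the count is additive along the powers of [q]. *)
Lemma crossing_fixed q k f : right_invariant C f -> (forall g, f (q * g)%g = f g) ->
  (0 < k)%N -> (q ^+ k)%g = 1%g -> D q f = 0.
Proof.
move=> fC fq k0 qk.
have fqX n : lact (q ^+ n)%g f = f.
  apply: funext => g; rewrite /lact; elim: n g => [|n IH] g.
    by rewrite expg0 invg1 mul1g.
  by rewrite expgS invgM -mulgA IH -(fq (q^-1 * g)%g) mulVKg.
have DX n : D (q ^+ n)%g f = n%:Z * D q f.
  elim: n => [|n IH]; first by rewrite expg0 crossing1 // mul0r.
  by rewrite expgS (crossingM DC) // fqX IH intS mulrDl mul1r addrC.
have := DX k; rewrite qk crossing1 // => /esym/eqP.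
by rewrite mulf_eq0 gt_eqF ?ltz_nat //= => /eqP.
Qed.

(** A nontrivial torsion element [r] of [A] fixes no vertex [g A] other than [A],
    as the path to it would start with an edge fixed by [r].  Here: if [y] commutes
    with [r] and moves the vertex [A], then [r] permutes freely the edges at [A],
    and the count of these edges along the path, which is one, is also [k] times the
    count of the edges with label zero. *)
Lemma torsion_centralizer r y : A r -> torsion r -> r <> 1%g -> commute r y -> A y.
Proof.
move=> Ar tr r1 ry; apply: contrapT => nAy.
have [k [k0 rk kmin]] := torsion_order tr.
have k1 : (1 < k)%N.
  by rewrite ltn_neqAle k0 andbT; apply/eqP => k1; apply: r1; rewrite -rk -k1.
have [|p [pk pC pr]] := @phase_exists E C r k sgC k0 rk.
  move=> g s sk Cs; apply: (kmin s sk); apply/eqP; rewrite -(conjg_eq1 _ g); apply/eqP.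
  apply: B_torsion_free; first exact: CB.
  exact/torsion_conj/torsionX.
pose th g : int := if `[< A g >] then 1 else 0.
have thA : right_invariant A th.
  move=> g a Aa; rewrite /th; congr (if _ then _ else _); apply: asbool_equiv_eq; split=> [Aga|Ag].
    by have := subgroupM sgA Aga (subgroupV sgA Aa); rewrite mulgK.
  exact: subgroupM.
have thr g : th (r * g)%g = th g.
  rewrite /th; congr (if _ then _ else _); apply: asbool_equiv_eq; split=> [Aga|Ag].
    by have := subgroupM sgA (subgroupV sgA Ar) Aga; rewrite mulKg.
  exact: subgroupM.
have Dth : D y th = 1.
  rewrite crossing_vertexA // /th asboolT; last exact: subgroup1.
  by rewrite asboolF ?subr0 // => /(subgroupV sgA); rewrite invgK.
have thC := right_invariantS CA thA.
have Dr f : right_invariant C f -> D y (fun g => f (r * g)%g) = D y f.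
  move=> fC; pose f' g := f (r * g)%g; rewrite -/f'.
  have f'C : right_invariant C f' by move=> g c Cc; rewrite /f' mulgA; exact: fC.
  have -> : f = lact r f' by apply: funext => g; rewrite /lact /f' mulVKg.
  have := crossingM DC r y f'C; rewrite ry (crossingM DC) //.
  rewrite !(crossing_base DC _ Ar) //; last exact: right_invariant_lact.
  by rewrite add0r addr0 => ->.
(* [f] is the label on the edges at the vertex [A]; moving it by [r] lowers the label
   by one except where it wraps around, and [e] marks these edges. *)
pose f g : int := th g * (p g)%:Z.
have fC : right_invariant C f by move=> g c Cc; rewrite /f thC // pC.
pose e g : int := th g * (p g == 0%N)%:Z.
have eC : right_invariant C e by move=> g c Cc; rewrite /e thC // pC.
have f'C : right_invariant C (fun g => f (r * g)%g) by move=> g c Cc; rewrite mulgA; exact: fC.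
have kC : right_invariant C (fun g => k%:Z * e g) by move=> g c Cc; rewrite eC.
have := crossingB DC y fC f'C; rewrite Dr // subrr.
have -> : (fun g => f g - f (r * g)%g) = (fun g => th g - k%:Z * e g).
  apply: funext => g; rewrite /f /e thr -mulrBr.
  suff -> : (p g)%:Z - (p (r * g)%g)%:Z = 1 - k%:Z * (p g == 0%N)%:Z by ring.
  have := pr g; have := pk (r * g)%g; rewrite leq_eqVlt => /orP[/eqP pk1|lt].
    by rewrite pk1 modnn => ->; rewrite eqxx -pk1; lia.
  by rewrite modn_small // => ->; lia.
rewrite (crossingB DC y thC kC) (crossingZ DC) // Dth => /eqP.
by rewrite subr_eq0 => /eqP/esym; exact: mulz_neq1.
Qed.

(** Either some nontrivial power of [q] is conjugate into [A], and then [q] is by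
    [torsion_centralizer], or there are labels [pA], [pB] of both kinds of
    vertices.  The difference [c] of the labels modulo [k] is invariant under [q],
    so it counts zero; hence the counts for [pA] and [pB] agree modulo [k].  But
    [pB] counts zero, while [pA] counts the difference of the labels of [A] and
    [q^-1 A], which is one modulo [k]. *)
Lemma torsion_base q : torsion q -> exists g, A (q ^ g)%g.
Proof.
move=> tq; have [k [k0 qk kmin]] := torsion_order tq.
have [k1|k1] := eqVneq k 1%N.
  by exists 1%g; rewrite conjg1 -[q]expg1 -k1 qk; exact: subgroup1.
have {}k1 : (1 < k)%N by rewrite ltn_neqAle eq_sym k1.
have [[g [s [sk Ag]]]|nfix] := pselect (exists g s, (0 < s < k)%N /\ A (q ^+ s ^ g)%g).
  exists g; apply: (torsion_centralizer Ag).
  - exact/torsion_conj/torsionX.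
  - by move/eqP; rewrite conjg_eq1 => /eqP; exact: kmin.
  - by rewrite conjXg; apply: commute_sym; apply/commuteX/commute_refl.
have [|pA [pAk pAA pAq]] := @phase_exists E A q k sgA k0 qk.
  by move=> g s sk Ag; apply: nfix; exists g, s.
have [|pB [pBk pBB pBq]] := @phase_exists E B q k sgB k0 qk.
  move=> g s sk Bg; apply: (kmin s sk); apply/eqP; rewrite -(conjg_eq1 _ g); apply/eqP.
  by apply: B_torsion_free => //; exact/torsion_conj/torsionX.
pose c g : int := ((pA g + (k - pB g)) %% k)%N%:Z.
(* The shift by [k] in [pA g + (k - pB g)] keeps the difference a natural number; it
   is compensated by the [- 1] in the quotient [h]. *)
pose h g : int := ((pA g + (k - pB g)) %/ k)%N%:Z - 1.
have fA : right_invariant C (fun g => (pA g)%:Z) by move=> g s /CA /pAA ->.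
have fB : right_invariant C (fun g => (pB g)%:Z) by move=> g s /CB /pBB ->.
have hC : right_invariant C h by move=> g s Cs; rewrite /h pAA ?pBB //; [exact: CB | exact: CA].
have cC : right_invariant C c by move=> g s Cs; rewrite /c pAA ?pBB //; [exact: CB | exact: CA].
have cq g : c (q * g)%g = c g.
  rewrite /c; congr Posz; rewrite [in RHS]pAq [in RHS]pBq.
  have := pBk (q * g)%g; rewrite leq_eqVlt => /orP[/eqP pk1|lt].
    by rewrite pk1 modnn subn0 modnDr modn_mod; congr (_ %% _)%N; lia.
  by rewrite (modn_small lt) modnDml; congr (_ %% _)%N; lia.
have Dc := crossing_fixed cC cq k0 qk.
have cE : c = fun g => ((pA g)%:Z - (pB g)%:Z) - k%:Z * h g.
  apply: funext => g; rewrite /c /h.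
  have := divn_eq (pA g + (k - pB g)) k; have := pBk g.
  by move: (_ %/ k)%N (_ %% k)%N => d m; nia.
have kC : right_invariant C (fun g => k%:Z * h g) by move=> g s Cs; rewrite hC.
have dC : right_invariant C (fun g => (pA g)%:Z - (pB g)%:Z).
  by move=> g s Cs; rewrite [in LHS](fA g s Cs) (fB g s Cs).
rewrite cE (crossingB DC q dC kC) (crossingB DC q fA fB) (crossingZ DC q _ hC) in Dc.
rewrite (crossing_vertexA q (f := fun g => (pA g)%:Z)) in Dc; last by move=> g s /pAA ->.
rewrite (crossing_vertexB q (f := fun g => (pB g)%:Z)) in Dc; last by move=> g s /pBB ->.
have := pAq q^-1%g; have := pAk 1%g; rewrite mulgV leq_eqVlt => /orP[/eqP pk1|lt].
  rewrite pk1 modnn => pq; rewrite pq in Dc.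
  by exfalso; apply: (@mulz_neq1 k (1 - D q h) k1); lia.
rewrite modn_small // => pq; rewrite pq in Dc.
by exfalso; apply: (@mulz_neq1 k (- D q h) k1); lia.
Qed.

End Amalgam.

Local Close Scope ring_scope.

(** * The tower *)

(** The model for all the relations that say that translates commute: a group [H]
    acts on pairs of an element and an integer site by left multiplication at one
    site, and [site_shift] moves the sites. *)
Section Sites.
Variable H : groupType.
Implicit Types (x y : H) (n m : int).

Definition site_act n x (p : H * int) : H * int :=
  (if p.2 == n then x * p.1 else p.1, p.2).

Fact site_act1 n : site_act n 1 =1 id.
Proof. by case=> h m; rewrite /site_act /= mul1g if_same. Qed.

Fact site_actM n x y p : site_act n (x * y) p = site_act n x (site_act n y p).
Proof. by case: p => h m; rewrite /site_act /=; case: eqP; rewrite ?mulgA. Qed.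

Definition at_site n : {ghom H -> bijection (H * int)} :=
  act_bij (site_act1 n) (site_actM n).

Fact site_shiftK : cancel (fun p : H * int => (p.1, p.2 + 1)%R) (fun p => (p.1, p.2 - 1)%R).
Proof. by case=> h m /=; rewrite addrK. Qed.
Fact site_shiftVK : cancel (fun p : H * int => (p.1, p.2 - 1)%R) (fun p => (p.1, p.2 + 1)%R).
Proof. by case=> h m /=; rewrite subrK. Qed.

Definition site_shift : bijection (H * int) := Bijection site_shiftK site_shiftVK.

Lemma site_shiftX k p : (site_shift ^+ k) p = (p.1, p.2 + k%:Z)%R.
Proof.
case: p => h n; elim: k => [|k IH]; first by rewrite expg0 /= addr0.
by rewrite expgS bijME IH /=; congr (_, _); lia.
Qed.

Lemma site_shiftVX k p : (site_shift ^- k) p = (p.1, p.2 - k%:Z)%R.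
Proof.
apply: (can_inj (bijK (site_shift ^+ k))); rewrite -bijME mulgV site_shiftX /= subrK.
by case: p.
Qed.

Lemma at_site_conj n k x :
  site_shift ^+ k * at_site n x * site_shift ^- k = at_site (n + k%:Z)%R x.
Proof.
apply: bijection_eq => -[h m]; rewrite !bijME site_shiftVX /= site_shiftX /= /site_act /=.
by rewrite subrK subr_eq.
Qed.

Lemma at_site_comm n m x y : n != m -> commute (at_site n x) (at_site m y).
Proof.
move=> nm; apply: bijection_eq => -[h k]; rewrite !bijME /= /site_act /=.
by case: (eqVneq k m) => // ->; rewrite eq_sym (negbTE nm).
Qed.

Lemma at_site_shift_comm k x y : (0 < k)%N ->
  commute (at_site 0%R x) (site_shift ^+ k * at_site 0%R y * site_shift ^- k).
Proof. by move=> k0; rewrite at_site_conj; apply: at_site_comm; lia. Qed.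

Lemma at_site_inj n : injective (at_site n).
Proof.
move=> x y /(congr1 (fun f : bijection _ => f (1, n))) /=.
by rewrite /site_act /= eqxx !mulg1 => -[].
Qed.

End Sites.

Arguments at_site {H} n.

Section Tower.
Variable G : groupType.

(** One alphabet serves all the groups below; [inr None] is the letter [t] and
    [inr (Some j)] is the letter [b_j].  In [lamp_rel] the letters [b_j] are killed,
    so that a word can be evaluated there without any conversion. *)
Definition letter : choiceType := (G + option int)%type.
Definition gl (g : G) : letter := inl g.
Definition tl : letter := inr None.
Definition bl (j : int) : letter := inr (Some j).

Implicit Types (u v w : word letter) (j : int) (J : set int).

Inductive lamp_rel : word letter -> Prop :=
| lamp_mul g h : lamp_rel [:: (false, gl g); (false, gl h); (true, gl (g * h))]
| lamp_kill j : lamp_rel [:: (false, bl j)]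
| lamp_comm g h k : (0 < k)%N ->
    lamp_rel (wcomm [:: (false, gl g)] (wconj k tl [:: (false, gl h)])).

Definition lampgroup := presented lamp_rel.

Section LampLift.
Variables (H : groupType) (f : letter -> H).
Hypotheses (fM : {morph (fun g => f (gl g)) : g h / g * h}) (fb : forall j, f (bl j) = 1).
Hypothesis fC : forall g h k, (0 < k)%N ->
  commute (f (gl g)) (f tl ^+ k * f (gl h) * f tl ^- k).

Lemma lamp_lift r : lamp_rel r -> evalw f r = 1.
Proof.
case=> [g h|j|g h k k0].
- by rewrite !evalw_cons evalw_nil mulg1 /= fM mulgA mulgV.
- by rewrite evalw1.
- by apply/evalw_comm; rewrite evalw_conj !evalw1; exact: fC.
Qed.

End LampLift.

Notation lgen := (@gen letter lamp_rel).

Lemma lgenM : {morph (fun g => lgen (gl g)) : g h / g * h}.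
Proof.
move=> g h; have := gen_rel (lamp_mul g h); rewrite !evalw_cons evalw_nil mulg1 /= mulgA.
by move/divg1_eq.
Qed.

Lemma lgen_b j : lgen (bl j) = 1.
Proof. by have := gen_rel (lamp_kill j); rewrite evalw1. Qed.

Lemma lgen_comm g h k : (0 < k)%N ->
  commute (lgen (gl g)) (lgen tl ^+ k * lgen (gl h) * lgen tl ^- k).
Proof.
by move=> k0; have /evalw_comm := gen_rel (lamp_comm g h k0); rewrite evalw_conj !evalw1.
Qed.

Lemma morph1 (H : groupType) (f : G -> H) : {morph f : g h / g * h} -> f 1 = 1.
Proof. by move=> fM; apply: (@mulgI H (f 1)); rewrite -fM !mulg1. Qed.

Definition lamp_config (l : letter) : bijection (G * int) :=
  match l with
  | inl g => at_site 0%R g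
  | inr None => site_shift G
  | inr (Some _) => 1
  end.

Fact lamp_configP r : lamp_rel r -> evalw lamp_config r = 1.
Proof.
apply: lamp_lift => //= [g h|g h k]; first exact: gmulfM.
exact: at_site_shift_comm.
Qed.

(** The group embeds because it acts faithfully at the site zero. *)
Lemma lgen_inj : injective (fun g => lgen (gl g)).
Proof.
move=> g h /(congr1 (plift lamp_configP)); rewrite !plift_gen /=.
exact: at_site_inj.
Qed.

Definition lamp_value w : lampgroup := evalw lgen w.

Definition below j w :=
  all (fun l : bool * letter => if l.2 is inr (Some i) then (i < j)%R else true) w.

(** The letters outside [J] are killed, again so that all towers share one alphabet
    and words need not be translated between them. *)
Inductive tower_rel J : word letter -> Prop :=
| tower_mul g h : tower_rel J [:: (false, gl g); (false, gl h); (true, gl (g * h))]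
| tower_kill j : ~ J j -> tower_rel J [:: (false, bl j)]
| tower_comm j k u v : J j -> (0 < k)%N -> below j u -> below j v ->
    lamp_value u = 1 -> lamp_value v = 1 -> tower_rel J (wcomm u (wconj k (bl j) v)).

Definition tower J := presented (tower_rel J).

Section TowerLift.
Variables (J : set int) (H : groupType) (f : letter -> H).
Hypotheses (fM : {morph (fun g => f (gl g)) : g h / g * h}).
Hypotheses (fb : forall j, ~ J j -> f (bl j) = 1).
Hypothesis fC : forall j k u v, J j -> (0 < k)%N -> below j u -> below j v ->
    lamp_value u = 1 -> lamp_value v = 1 ->
  commute (evalw f u) (f (bl j) ^+ k * evalw f v * f (bl j) ^- k).

Lemma tower_lift r : tower_rel J r -> evalw f r = 1.
Proof.
case=> [g h|j|j k u v *].
- by rewrite !evalw_cons evalw_nil mulg1 /= fM mulgA mulgV.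
- by rewrite evalw1; exact: fb.
- by apply/evalw_comm; rewrite evalw_conj; exact: fC.
Qed.

End TowerLift.

Notation tgen J := (@gen letter (tower_rel J)).

Lemma tgenM J : {morph (fun g => tgen J (gl g)) : g h / g * h}.
Proof.
move=> g h; have := gen_rel (tower_mul J g h); rewrite !evalw_cons evalw_nil mulg1 /= mulgA.
by move/divg1_eq.
Qed.

Lemma tgen_kill J j : ~ J j -> tgen J (bl j) = 1.
Proof. by move=> /tower_kill /gen_rel; rewrite evalw1. Qed.

Lemma tgen_comm J j k u v : J j -> (0 < k)%N -> below j u -> below j v ->
  lamp_value u = 1 -> lamp_value v = 1 ->
  commute (evalw (tgen J) u) (tgen J (bl j) ^+ k * evalw (tgen J) v * tgen J (bl j) ^- k).
Proof.
move=> Jj k0 bu bv lu lv; have := gen_rel (tower_comm Jj k0 bu bv lu lv).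
by move/evalw_comm; rewrite evalw_conj.
Qed.

Fact tower_projP J r : tower_rel J r -> evalw lgen r = 1.
Proof.
apply: tower_lift => [|j _|j k u v _ k0 _ _ lu _]; [exact: lgenM|exact: lgen_b|].
by rewrite -/(lamp_value u) lu; exact/commute_sym/commute1.
Qed.

Definition tower_proj J : {ghom tower J -> lampgroup} := plift (@tower_projP J).

Lemma tower_proj_cls J w : tower_proj J (cls _ w) = lamp_value w.
Proof. exact: plift_cls. Qed.

Lemma tower_proj_surj J x : exists y, tower_proj J y = x.
Proof. by exists (cls _ (repr x)); rewrite tower_proj_cls /lamp_value -clsE cls_repr. Qed.

Lemma tower_proj_gl J g : tower_proj J (tgen J (gl g)) = lgen (gl g).
Proof. exact: plift_gen. Qed.

Lemma tgen_inj J : injective (fun g => tgen J (gl g)).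
Proof. by move=> g h /(congr1 (tower_proj J)); rewrite !tower_proj_gl; exact: lgen_inj. Qed.

(** A word of a larger tower is moved to a smaller one by erasing the letters that
    are dead there; this changes neither its height nor its value in [lampgroup]. *)
Definition alive J (l : letter) := if l is inr (Some j) then `[< J j >] else true.

Definition restrictw J w := [seq l <- w | alive J l.2].

Lemma evalw_restrict J (H : groupType) (f : letter -> H) w :
  evalw (fun l => if alive J l then f l else 1) w = evalw f (restrictw J w).
Proof.
elim: w => [|l w IH] /=; first by rewrite !evalw_nil.
rewrite evalw_cons IH; case: (alive J l.2); first by rewrite evalw_cons.
by rewrite invg1 if_same mul1g.
Qed.

Lemma lamp_value_restrict J w : lamp_value (restrictw J w) = lamp_value w.
Proof.
rewrite /lamp_value -evalw_restrict; apply: evalw_eq => -[b [g|[j|]]] _ //=.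
by rewrite lgen_b if_same.
Qed.

Lemma below_restrict J j w : below j w -> below j (restrictw J w).
Proof.
by move=> /allP bw; apply/allP => l; rewrite mem_filter => /andP[_ /bw].
Qed.

Section SubTower.
Variables (J J' : set int).
Hypothesis JJ' : J `<=` J'.

Fact subtowerP r : tower_rel J r ->
  evalw (fun l => if alive J l then tgen J' l else 1) r = 1.
Proof.
apply: tower_lift => [|j nJ|j k u v Jj k0 bu bv lu lv]; first exact: tgenM.
  by rewrite /= asboolF.
rewrite !evalw_restrict /= asboolT //; apply: tgen_comm => //; first exact: JJ'.
- exact: below_restrict.
- exact: below_restrict.
- by rewrite lamp_value_restrict.
- by rewrite lamp_value_restrict.
Qed.

Definition subtower : {ghom tower J -> tower J'} := plift subtowerP.

Lemma subtower_gen l : alive J l -> subtower (tgen J l) = tgen J' l.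
Proof. by move=> Jl; rewrite /= plift_gen Jl. Qed.

Lemma subtower_cls w : (forall l, l \in w -> alive J' l.2 -> alive J l.2) ->
  subtower (cls _ w) = cls _ w.
Proof.
move=> Jw; rewrite /= plift_cls clsE; apply: evalw_eq => -[b l] /Jw /=.
case: ifP => // nJ J'l; case: l nJ J'l => [//|[j|//]] /= nJ J'l.
by rewrite tgen_kill // => J'j; move: (J'l (asboolT J'j)).
Qed.

End SubTower.

Definition seg (i j : int) : set int := [set l | (i <= l)%R && (l < j)%R].

Lemma alive_seg i j l : alive (seg i j) l =
  if l is inr (Some k) then (i <= k < j)%R else true.
Proof. by case: l => // -[k|//] /=; rewrite asboolb. Qed.

Lemma seg_sub i j j' : (j <= j')%R -> seg i j `<=` seg i j'.
Proof. by move=> jj' l /andP[il lj]; rewrite /seg /= il (lt_le_trans lj). Qed.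

(** Adding the top letter [b_j]: the larger tower acts on pairs of an element of
    the smaller tower and a site, with [b_j] as shift and the other letters at the
    site zero.  The relations for [b_j] hold as different sites commute, and those
    for the lower letters hold already in the smaller tower.  In particular the
    smaller tower embeds. *)
Section OneMoreFloor.
Variables (i j : int).
Hypothesis ij : (i <= j)%R.
Local Notation H := (tower (seg i j)).
Local Notation E := (tower (seg i (j + 1)%R)).

Definition floor_act (l : letter) : bijection (H * int) :=
  if l == bl j then site_shift H else at_site 0%R (tgen (seg i j) l).

Lemma below_neq k w (l : bool * letter) : (k <= j)%R -> below k w -> l \in w -> l.2 != bl j.
Proof.
move=> kj /allP bw /bw; case: l => b [g|[m|]] //= mk.
by apply/eqP => -[] mj; lia.
Qed.

Lemma floor_act_below k w : (k <= j)%R -> below k w ->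
  evalw floor_act w = at_site 0%R (cls _ w).
Proof.
move=> kj bw; rewrite clsE evalw_morph; apply: evalw_eq => l lw.
by rewrite /floor_act (negbTE (below_neq kj bw lw)).
Qed.

Fact floor_actP r : tower_rel (seg i (j + 1)%R) r -> evalw floor_act r = 1.
Proof.
apply: tower_lift => [g h|k nk|k n u v kij n0 bu bv lu lv].
- by rewrite /floor_act /= tgenM gmulfM.
- rewrite /floor_act ifF; last first.
    by apply/eqP => -[] kj; apply: nk; rewrite /seg /=; lia.
  rewrite tgen_kill ?gmulf1 // => kij; apply: nk; move: kij; rewrite /seg /=; lia.
- have kj : (k <= j)%R by move: kij; rewrite /seg /=; lia.
  rewrite !(floor_act_below kj) //.
  have [->|nkj] := eqVneq k j.
    by rewrite /floor_act eqxx; exact: at_site_shift_comm.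
  rewrite /floor_act ifF; last by apply/eqP => -[]; exact/eqP.
  rewrite -gmulfXn -gmulfV -!gmulfM; apply: gmulf_commute.
  rewrite !clsE; apply: tgen_comm => //; move: kij nkj; rewrite /seg /=; lia.
Qed.

Definition floor_hom : {ghom E -> bijection (H * int)} := plift floor_actP.

Lemma floor_sub : seg i j `<=` seg i (j + 1)%R.
Proof. by apply: seg_sub; rewrite lerDl. Qed.

Local Notation up := (subtower floor_sub).

Lemma floor_hom_up x : floor_hom (up x) = at_site 0%R x.
Proof.
move: x; apply: (presented_hom_eq (phi := floor_hom \o up) (psi := at_site 0%R)) => l /=.
rewrite plift_gen; have := alive_seg i j l; case: ifP => al /esym als.
  rewrite plift_gen /floor_act ifF //; apply/eqP => lj; move: als.
  by rewrite lj /=; lia.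
rewrite gmulf1.
case: l al als => [//|[k|//]] /= nk _.
by rewrite tgen_kill ?gmulf1 // => /asboolP; rewrite nk.
Qed.

Lemma up_inj : injective up.
Proof. by move=> x y /(congr1 floor_hom); rewrite !floor_hom_up => /at_site_inj. Qed.

Lemma up_cls w : (forall l, l \in w -> l.2 != bl j) -> up (cls _ w) = cls _ w.
Proof.
move=> wj; apply: subtower_cls => l /wj; rewrite !alive_seg.
case: l => b [g|[k|]] //= /eqP kj; suff : k <> j by lia.
by move=> kj'; apply: kj; rewrite kj'.
Qed.

End OneMoreFloor.

Lemma subtower_id J (s : J `<=` J) : subtower s =1 id.
Proof. by move=> x; rewrite -[x]cls_repr subtower_cls. Qed.

Lemma subtower_comp J J' J'' (s : J `<=` J') (s' : J' `<=` J'') (s'' : J `<=` J'') x :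
  subtower s'' x = subtower s' (subtower s x).
Proof.
move: x; apply: (presented_hom_eq (phi := subtower s'') (psi := subtower s' \o subtower s)) => l /=.
rewrite !plift_gen; case: ifP => al; last by rewrite gmulf1.
rewrite plift_gen ifT //; case: l al => [//|[k|//]] /= /asboolP /s J'k; exact/asboolP.
Qed.

Lemma subtower_seg_inj i j (n : nat) k (s : seg i j `<=` seg i k) :
  (i <= j)%R -> k = (j + n%:Z)%R -> injective (subtower s).
Proof.
move=> ij; elim: n k s => [|n IH] k s kE.
  move: s; rewrite kE addr0 => s x y; by rewrite !subtower_id.
have {}kE : (k = (j + n%:Z) + 1)%R by lia.
move: s; rewrite kE => s x y.
have s1 : seg i j `<=` seg i (j + n%:Z)%R by apply: seg_sub; lia.
rewrite !(subtower_comp s1 (@floor_sub i (j + n%:Z)%R)).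
by move/up_inj => H; apply: (IH _ s1) => //; apply: H; lia.
Qed.

End Tower.

Arguments tower_proj {G} J.
Arguments subtower {G J J'} JJ'.
Arguments floor_hom {G i j} ij.
Arguments alive {G} J l.
Arguments restrictw {G} J w.

(** * Torsion in the tower *)

(** Right [C]-invariant functions, with an integer to accumulate the edges crossed.
    The shear adds the value at the base edge; it commutes with [C] because [C]
    fixes that edge. *)
Section InvariantFunctions.
Variables (E : groupType) (C : set E).

Record inv_fun := InvFun { inv_val :> E -> int; inv_valP : right_invariant C inv_val }.

Lemma inv_fun_eq (c d : inv_fun) : inv_val c = inv_val d -> c = d.
Proof.
case: c d => [c cP] [d dP] /= cd; move: cP dP; rewrite cd => cP dP.
by rewrite (Prop_irrelevance cP dP).
Qed.

Fact lact_invP y (c : inv_fun) : right_invariant C (lact y c).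
Proof. by apply: right_invariant_lact; exact: inv_valP. Qed.

Definition translate_act y (p : inv_fun * int) : inv_fun * int :=
  (InvFun (lact_invP y p.1), p.2).

Fact translate_act1 : translate_act 1 =1 id.
Proof.
case=> c m; congr (_, _); apply: inv_fun_eq; apply: funext => g.
by rewrite /= /lact invg1 mul1g.
Qed.

Fact translate_actM x y p : translate_act (x * y) p = translate_act x (translate_act y p).
Proof.
case: p => c m; congr (_, _); apply: inv_fun_eq; apply: funext => g.
by rewrite /= /lact invgM mulgA.
Qed.

Definition translate : {ghom E -> bijection (inv_fun * int)} :=
  act_bij translate_act1 translate_actM.

Fact shearK : cancel (fun p : inv_fun * int => (p.1, p.2 + p.1 1%g)%R)
  (fun p => (p.1, p.2 - p.1 1%g)%R).
Proof. by case=> c m /=; rewrite addrK. Qed.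
Fact shearVK : cancel (fun p : inv_fun * int => (p.1, p.2 - p.1 1%g)%R)
  (fun p => (p.1, p.2 + p.1 1%g)%R).
Proof. by case=> c m /=; rewrite subrK. Qed.

Definition shear : bijection (inv_fun * int) := Bijection shearK shearVK.

Lemma shear_comm x : subgroup C -> C x -> commute (translate x) shear.
Proof.
move=> sgC Cx; apply: bijection_eq => -[c m]; rewrite !bijME /=; congr (_, (_ + _)%R).
by rewrite /= /lact mulg1 -[in RHS](mul1g x^-1) (inv_valP c) //; exact: subgroupV.
Qed.

End InvariantFunctions.

Arguments translate {E C}.
Arguments shear {E C}.

(** A presentation in which the letter [beta] only occurs in relations that make an
    element of [C] commute with conjugates of elements of [C] by powers of [beta]. *)
Section HNN.
Variables (X : choiceType) (Rel : word X -> Prop) (beta : X).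
Local Notation E := (presented Rel).
Local Notation b := (gen Rel beta).

Definition avoids (w : word X) := all (fun l : bool * X => l.2 != beta) w.

(** The vertex group is the subgroup generated by the other letters. *)
Definition vertex : set E := [set x | exists2 w, avoids w & x = cls Rel w].

Lemma vertex_subgroup : subgroup vertex.
Proof.
split; first by exists [::].
- by move=> x y [u au ->] [v av ->]; exists (u ++ v); rewrite ?clsM // /avoids all_cat; apply/andP.
- move=> x [u au ->]; exists (winv u); last by rewrite clsV.
  by rewrite /avoids /winv all_rev all_map.
Qed.

Lemma vertex_gen l : l != beta -> vertex (gen Rel l).
Proof. by move=> lb; exists [:: (false, l)]; rewrite //= lb. Qed.

Variable C : set E.
Hypotheses (sgC : subgroup C) (CV : C `<=` vertex).
Hypothesis RelC : forall r, Rel r -> avoids r \/ exists u v k,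
  [/\ r = wcomm u (wconj k beta v), avoids u, avoids v, C (cls Rel u) & C (cls Rel v)].

(** All letters translate functions, but [beta] is conjugated by the shear, so
    that it records the edges between the base vertex and its translate. *)
Definition twisted (l : X) : bijection (inv_fun C * int) :=
  if l == beta then shear^-1 * translate b * shear else translate (gen Rel l).

Lemma twisted_avoids w : avoids w -> evalw twisted w = translate (cls Rel w).
Proof.
move=> /allP aw; rewrite clsE evalw_morph; apply: evalw_eq => l /aw lb.
by rewrite /twisted (negbTE lb).
Qed.

(** Elements of [C] commute with the shear, so in the relations of [beta] the whole
    word is conjugated by the shear and the relation is inherited. *)
Fact twistedP r : Rel r -> evalw twisted r = 1.
Proof.
move=> Rr; case: (RelC Rr) => [/twisted_avoids ->|[u [v [k [rE au av Cu Cv]]]]].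
  by rewrite clsE gen_rel // gmulf1.
have: evalw (gen Rel) r = 1 by exact: gen_rel.
rewrite {}rE => /evalw_comm; rewrite evalw_conj -!clsE => uv.
apply/evalw_comm; rewrite evalw_conj !twisted_avoids // /twisted eqxx.
have tJ x n : (shear^-1 * x * shear) ^+ n = x ^+ n ^ (@shear E C).
  by rewrite conjXg conjgE mulgA.
have Ju w : C (cls Rel w) -> translate (cls Rel w) = translate (cls Rel w) ^ (@shear E C).
  by move=> Cw; rewrite conjgE (shear_comm sgC Cw) mulKg.
rewrite !tJ (Ju u Cu) (Ju v Cv) -conjVg -!conjMg.
rewrite -gmulfXn -gmulfV -!gmulfM /commute -!conjMg -!gmulfM.
by rewrite uv.
Qed.

Definition twist : {ghom E -> bijection (inv_fun C * int)} := plift twistedP.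

Local Open Scope ring_scope.

(** The accumulated integer is a signed sum over a finite list of edges.  Stated in
    this form, linearity in the function is immediate. *)
Lemma twist_formula x : exists d : seq (int * E), forall (c : inv_fun C) m,
  twist x (c, m) = (InvFun (lact_invP x c), m + \sum_(p <- d) p.1 * c p.2).
Proof.
have trE y c m : translate y (c, m) = (InvFun (lact_invP y c), m) by [].
have step (h : bijection (inv_fun C * int)) y d z e :
    (forall c m, h (c, m) = (InvFun (lact_invP y c), m + \sum_(p <- d) p.1 * c p.2)) ->
    (forall c m, twist z (c, m) = (InvFun (lact_invP z c), m + \sum_(p <- e) p.1 * c p.2)) ->
  forall c m, (h * twist z)%g (c, m) = (InvFun (lact_invP (y * z)%g c),
    m + \sum_(p <- e ++ [seq (p.1, z^-1 * p.2)%g | p <- d]) p.1 * c p.2).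
  move=> hE zE c m; rewrite bijME zE hE big_cat big_map /= addrA; congr (_, _).
  by apply: inv_fun_eq; apply: funext => g; rewrite /= /lact invgM mulgA.
have gE l (s : bool) : exists d : seq (int * E), forall c m,
   (twist (if s then (gen Rel l)^-1 else gen Rel l)%g) (c, m) =
   (InvFun (lact_invP (if s then (gen Rel l)^-1 else gen Rel l)%g c),
    m + \sum_(p <- d) p.1 * c p.2).
  have tgE : twist (gen Rel l) = twisted l by exact: plift_gen.
  have [lb|lb] := eqVneq l beta; last first.
    by exists [::] => c m; rewrite big_nil addr0; case: s; rewrite ?gmulfV tgE /twisted
      (negbTE lb) -?gmulfV.
  exists [:: (1, 1%g); (-1, if s then b else b^-1)%g] => c m.
  rewrite !big_cons big_nil addr0 /= mul1r mulN1r.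
  case: s; rewrite ?gmulfV tgE /twisted lb eqxx.
    rewrite !invgM invgK mulgA.
    rewrite !bijME /=; congr (_, _); rewrite -addrA; congr (_ + (_ - _)).
    by rewrite /lact invgK mulg1.
  rewrite !bijME /=; congr (_, _); rewrite -addrA; congr (_ + (_ - _)).
  by rewrite /lact mulg1.
move: x; apply: presented_ind.
- exists [::] => c m; rewrite gmulf1 big_nil addr0; congr (_, _).
  by apply: inv_fun_eq; apply: funext => g; rewrite /= /lact invg1 mul1g.
- move=> l y [e eE]; have [d dE] := gE l false.
  by rewrite gmulfM; eexists; apply: step.
- move=> l y [e eE]; have [d dE] := gE l true.
  by rewrite gmulfM; eexists; apply: step.
Qed.

Lemma crossing_exists : exists D, crossing vertex C b D.
Proof.
have /choice[d dE] := twist_formula.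
pose D x (f : E -> int) := \sum_(p <- d x) p.1 * f p.2.
have DE x f (fC : right_invariant C f) m :
  twist x (InvFun fC, m) = (InvFun (lact_invP x (InvFun fC)), m + D x f) by rewrite dE.
exists D; split.
- move=> x y f fC.
  have := DE (x * y)%g f fC 0; rewrite gmulfM bijME DE.
  have fC' := right_invariant_lact y fC.
  have -> : InvFun (lact_invP y (InvFun fC)) = InvFun fC' by exact: inv_fun_eq.
  by rewrite DE => /(congr1 snd) /=; rewrite !add0r.
- move=> x f f' _ _; rewrite /D -sumrB; apply: eq_bigr => p _; exact: mulrBr.
- by move=> x k f _; rewrite /D mulr_sumr; apply: eq_bigr => p _; rewrite mulrCA.
- move=> a f fC [w aw ->].
  have := DE (cls Rel w) f fC 0; rewrite -[twist _]/(plift _ _) plift_cls twisted_avoids //.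
  by move=> /(congr1 snd) /=; rewrite add0r.
- move=> f fC; have := DE b f fC 0; rewrite -[twist _]/(plift _ _) plift_gen /twisted eqxx.
  move=> /(congr1 snd) /=; rewrite !add0r => <-.
  by rewrite /lact mulg1.
Qed.

Lemma vertex_ind (P : E -> Prop) : P 1%g -> (forall a x, vertex a -> P x -> P (a * x)%g) ->
  (forall x, P x -> P (b * x)%g) -> (forall x, P x -> P (b^-1 * x)%g) -> forall x, P x.
Proof.
move=> P1 PA Pb PV; apply: presented_ind => // l x Px.
  by have [->|/vertex_gen lb] := eqVneq l beta; [exact: Pb | exact: PA].
have [->|/vertex_gen lb] := eqVneq l beta; first exact: PV.
by apply: PA => //; exact: (subgroupV vertex_subgroup).
Qed.

Lemma hnn_torsion (B : set E) (q : E) : subgroup B -> C `<=` B -> B b ->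
  (forall y, B y -> torsion y -> y = 1%g) -> torsion q -> exists g, vertex (q ^ g)%g.
Proof.
move=> sgB CB Bb Btf; have [D Dc] := crossing_exists.
exact: (torsion_base vertex_subgroup sgB sgC CV CB Bb vertex_ind Btf Dc).
Qed.

End HNN.

(** If a set [F] that contains 1 is stable under left multiplication by [C], [b]
    and [b^-1], its left stabilizer is a subgroup between [<C, b>] and [F].  So
    properties of the elements of [F] pass to a subgroup. *)
Section Stabilizer.
Variables (E : groupType) (C F : set E) (b : E).
Hypotheses (F1 : F 1) (FC : forall c x, C c -> F x -> F (c * x)).
Hypotheses (Fb : forall x, F x -> F (b * x)) (FbV : forall x, F x -> F (b^-1 * x)).

Definition stabilizer : set E := [set y | forall x, F (y * x) <-> F x].

Lemma stabilizer_subgroup : subgroup stabilizer.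
Proof.
split=> [x|x y Sx Sy z|x Sx z]; first by rewrite mul1g.
  by rewrite -mulgA; split=> [/Sx/Sy|/Sy/Sx].
by rewrite -(Sx (x^-1 * z)) mulVKg.
Qed.

Lemma stabilizer_sub : stabilizer `<=` F.
Proof. by move=> y /(_ 1); rewrite mulg1 => ->. Qed.

Lemma stabilizer_base : subgroup C -> C `<=` stabilizer.
Proof.
move=> sgC c Cc x; split=> [/(FC (subgroupV sgC Cc))|]; last exact: FC.
by rewrite mulKg.
Qed.

Lemma stabilizer_stable : stabilizer b.
Proof. by move=> x; split=> [/FbV|/Fb //]; rewrite mulKg. Qed.

End Stabilizer.

(** Products of conjugates [b^n x b^-n], where different [n] give commuting
    elements.  Such a list may repeat indices; it is not a normal form, but
    [spots_eq1] decides when it is trivial. *)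
Section ConjugateProducts.
Variables (H E : groupType) (up : {ghom H -> E}) (N : set H) (b : E).
Hypothesis comm : forall x y k, N x -> N y -> (0 < k)%N ->
  commute (up x) (b ^+ k * up y * b ^- k).
Implicit Types (s : seq (nat * H)) (p : nat * H).

Definition spot p := b ^+ p.1 * up p.2 * b ^- p.1.
Definition spots s : E := \prod_(p <- s) spot p.

Lemma spotX k p : b ^+ k * spot p * b ^- k = spot ((k + p.1)%N, p.2).
Proof. by rewrite /spot /= expgnDr invgM !mulgA. Qed.

Lemma spots_cat s s' : spots (s ++ s') = spots s * spots s'.
Proof. exact: big_cat. Qed.

Lemma spots_conjX k s : b ^+ k * spots s * b ^- k = spots [seq ((k + p.1)%N, p.2) | p <- s].
Proof.
elim: s => [|p s IH]; first by rewrite /spots !big_nil mulg1 mulgV.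
rewrite /spots !big_cons -/(spots s) -/(spots [seq _ | _ <- _]) -IH -spotX.
by rewrite !mulgA !mulgVK.
Qed.

Lemma spots_shift s : b * spots s = spots [seq (p.1.+1, p.2) | p <- s] * b.
Proof. by have := spots_conjX 1 s; rewrite expg1 => <-; rewrite mulgVK.
Qed.

Lemma spot_comm p q : N p.2 -> N q.2 -> p.1 != q.1 -> commute (spot p) (spot q).
Proof.
wlog pq : p q / (p.1 < q.1)%N => [W|] Np Nq npq.
  case: (ltngtP p.1 q.1) => [pq|pq|/eqP]; [exact: W| |by rewrite (negbTE npq)].
  by apply: commute_sym; apply: W => //; rewrite eq_sym.
have -> : spot q = b ^+ p.1 * spot ((q.1 - p.1)%N, q.2) * b ^- p.1.
  by rewrite spotX subnKC ?(ltnW pq) //; case: (q).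
have -> : spot p = b ^+ p.1 * spot (0%N, p.2) * b ^- p.1 by rewrite spotX addn0; case: (p).
have := comm Np Nq; rewrite -subn_gt0 in pq => /(_ _ pq).
rewrite [spot (0%N, _)]/spot /= expg0 invg1 mul1g mulg1 -/(spot ((q.1 - p.1)%N, q.2)).
set x := up _; set y := spot _ => xy.
clearbody x y; by rewrite /commute -!mulgA !mulKg (mulgA x) xy !mulgA.
Qed.

Lemma spots_comm p s : N p.2 -> (forall q, q \in s -> N q.2 /\ p.1 != q.1) ->
  commute (spot p) (spots s).
Proof.
move=> Np; rewrite /spots; elim: s => [|q s IH] Ns; first by rewrite big_nil; exact: commute1.
rewrite big_cons; apply: commuteM.
  by have [] := Ns q (mem_head _ _); exact: spot_comm.
by apply: IH => r rs; apply: Ns; rewrite inE rs orbT.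
Qed.

Lemma spots_indices_comm s s' : (forall p, p \in s -> N p.2) -> (forall p, p \in s' -> N p.2) ->
  (forall p q, p \in s -> q \in s' -> p.1 != q.1) ->
  commute (spots s) (spots s').
Proof.
elim: s => [|p s IH] Ns Ns' ss'.
  have -> : spots [::] = 1 by exact: big_nil.
  exact/commute_sym/commute1.
rewrite -cat1s spots_cat; apply/commute_sym/commuteM; apply: commute_sym.
  rewrite {1}/spots big_seq1; apply: spots_comm; first exact/Ns/mem_head.
  by move=> q qs'; split; [exact: Ns' | apply: ss' => //; exact: mem_head].
by apply: IH => // [q qs|q r qs]; [apply: Ns | apply: ss']; rewrite inE qs orbT.
Qed.

(** The factors with index [n] can be collected at the left. *)
Lemma spots_regroup n s : (forall p, p \in s -> N p.2) ->
  spots s = spots [seq p <- s | p.1 == n] * spots [seq p <- s | p.1 != n].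
Proof.
elim: s => [|p s IH] Ns; first by rewrite /spots !big_nil mulg1.
have Ns' q : q \in s -> N q.2 by move=> qs; apply: Ns; rewrite inE qs orbT.
have spots_cons q r : spots (q :: r) = spot q * spots r by exact: big_cons.
rewrite spots_cons IH //=; case: (eqVneq p.1 n) => [_|pn] /=.
  by rewrite spots_cons mulgA.
have c : commute (spot p) (spots [seq q <- s | q.1 == n]).
  apply: spots_comm; first exact/Ns/mem_head.
  by move=> q; rewrite mem_filter => /andP[/eqP-> /Ns'].
by rewrite spots_cons [LHS]mulgA c -[LHS]mulgA.
Qed.

(** If at each index the product of the entries is trivial, then so is the whole:
    collect the index of the first factor and proceed with the shorter rest. *)
Lemma spots_eq1 s : (forall p, p \in s -> N p.2) ->
  (forall n, \prod_(p <- s | p.1 == n) p.2 = 1) -> spots s = 1.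
Proof.
have [k] := ubnP (size s); elim: k s => // k IH [|p s] sk Ns s1; first exact: big_nil.
rewrite (spots_regroup p.1 Ns) (IH [seq q <- p :: s | q.1 != p.1]).
- have spotsE n r : spots [seq q <- r | q.1 == n] =
      b ^+ n * up (\prod_(q <- r | q.1 == n) q.2) * b ^- n.
    rewrite /spots; elim: r => [|q r IHr] /=.
      by rewrite !big_nil gmulf1 mulg1 mulgV.
    rewrite big_cons; case: eqP => [qn|//]; rewrite big_cons IHr gmulfM /spot qn.
    by rewrite !mulgA mulgVK.
  by rewrite spotsE s1 gmulf1 !mulg1 mulgV.
- rewrite /= eqxx /=; apply: leq_ltn_trans (_ : (size s < k)%N); last by [].
  by rewrite size_filter count_size.
- by move=> q; rewrite mem_filter => /andP[_ /Ns].
- move=> n; rewrite big_filter_cond.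
  have [->|np] := eqVneq n p.1.
    by apply: big_pred0 => q; case: eqP.
  by rewrite -[RHS](s1 n); apply: eq_bigl => q; case: (eqVneq q.1 n) => [->|_]; rewrite ?np ?andbF.
Qed.

(** Conjugation by a power of [b] makes all indices natural numbers. *)
Definition base_form : set E := [set y | exists K s L,
  (forall p, p \in s -> N p.2) /\ y = b ^- K * spots s * b ^+ L].

Lemma base_form1 : base_form 1.
Proof.
exists 0%N, [::], 0%N; split=> //.
by rewrite expg0 /spots big_nil invg1 !mulg1.
Qed.

Lemma base_formC x y : N x -> base_form y -> base_form (up x * y).
Proof.
move=> Nx [K [s [L [Ns ->]]]]; exists K, ((K, x) :: s), L; split.
  by move=> p; rewrite inE => /orP[/eqP->//|/Ns].
by rewrite /spots big_cons /spot /= !mulgA mulVg mul1g.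
Qed.

Lemma base_formb y : base_form y -> base_form (b * y).
Proof.
move=> [K [s [L [Ns ->]]]]; exists K, [seq (p.1.+1, p.2) | p <- s], L.+1; split.
  by move=> p /mapP[q /Ns ? ->].
have bK : b * b ^- K = b ^- K * b by apply: commuteV; exact/commuteX/commute_refl.
by rewrite !mulgA bK -(mulgA (b ^- K)) spots_shift expgS !mulgA.
Qed.

Lemma base_formbV y : base_form y -> base_form (b^-1 * y).
Proof.
move=> [K [s [L [Ns ->]]]]; exists K.+1, s, L; split=> //.
by rewrite expgSr invgM !mulgA.
Qed.

End ConjugateProducts.

(** A torsion bijection cannot move all sites by a nonzero amount. *)
Lemma drift (H : groupType) (f : bijection (H * int)) (d : int) :
  (forall p, (f p).2 = (p.2 + d)%R) -> torsion f -> d = 0%R.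
Proof.
move=> fd [n n0 fn].
have fnd k p : ((f ^+ k) p).2 = (p.2 + k%:Z * d)%R.
  elim: k => [|k IH]; first by rewrite expg0 mul0r addr0.
  by rewrite expgS bijME fd IH; lia.
have := fnd n (1, 0%R); rewrite fn /= add0r => /esym/eqP.
by rewrite mulf_eq0 gt_eqF ?ltz_nat //= => /eqP.
Qed.

Lemma gmulf_torsion (H K : groupType) (f : {ghom H -> K}) x : torsion x -> torsion (f x).
Proof. by case=> n n0 xn; exists n; rewrite -?gmulfXn ?xn ?gmulf1. Qed.

(** The subgroup generated by [b] and the image of [N] acts faithfully on sites:
    an element that acts trivially has trivial product at each index.  Since a
    torsion element has no drift, it acts at each site by a torsion element of [N],
    and [N] is torsion free. *)
Section BaseTorsion.
Variables (H E : groupType) (up : {ghom H -> E}) (N : set H) (b : E).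
Variable phi : {ghom E -> bijection (H * int)}.
Hypotheses (phi_up : forall x, phi (up x) = at_site 0%R x) (phi_b : phi b = site_shift H).
Hypothesis comm : forall x y k, N x -> N y -> (0 < k)%N ->
  commute (up x) (b ^+ k * up y * b ^- k).
Hypotheses (sgN : subgroup N) (N_torsion_free : forall x, N x -> torsion x -> x = 1).

Lemma phi_spots s h (m : int) :
  phi (spots up b s) (h, m) = (\prod_(p <- s | Posz p.1 == m) p.2 * h, m).
Proof.
rewrite /spots; elim: s => [|p s IH]; first by rewrite !big_nil gmulf1 mul1g.
rewrite !big_cons gmulfM bijME IH /spot !gmulfM gmulfV !gmulfXn phi_up !phi_b at_site_conj.
by rewrite /= /site_act /= add0r eq_sym; case: eqP; rewrite ?mulgA.
Qed.

Lemma base_form_torsion_free y : base_form up N b y -> torsion y -> y = 1.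
Proof.
case=> K [s [L [Ns yE]]] ty.
have LK : L = K.
  have := gmulf_torsion phi ty; move/(drift (d := (L%:Z - K%:Z)%R)) => H0.
  suff : (L%:Z - K%:Z)%R = 0%R by lia.
  apply: H0 => -[h m]; rewrite yE !gmulfM gmulfV !gmulfXn phi_b !bijME.
  by rewrite site_shiftX phi_spots site_shiftVX /=; lia.
have {yE LK}ys : y = spots up b s ^ (b ^+ K) by rewrite yE LK conjgE mulgA.
suff s1 : spots up b s = 1 by rewrite ys s1 conj1g.
have {ty} : torsion (spots up b s).
  have := torsion_conj (b ^- K) ty.
  by rewrite ys -conjgM mulgV conjg1.
case=> n n0 sn; apply: (spots_eq1 comm) => // m.
have WN : N (\prod_(p <- s | p.1 == m) p.2).
  elim: s Ns {sn ys} => [|p s IH] Ns; first by rewrite big_nil; exact: subgroup1.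
  have IH' := IH (fun q qs => Ns q (mem_behead (s := p :: s) qs)).
  rewrite big_cons; case: eqP => // _; apply: (subgroupM sgN) => //.
  exact/Ns/mem_head.
apply: N_torsion_free => //; exists n => //.
have := congr1 (fun z => (phi z) (1, Posz m)) sn; rewrite gmulfXn gmulf1 bij_iter.
set W := \prod_(p <- _ | _) _.
have -> k : iter k (phi (spots up b s)) (1, Posz m) = (W ^+ k, Posz m).
  by elim: k => [|k IH]; rewrite ?expg0 //= IH phi_spots expgS.
by case.
Qed.

End BaseTorsion.

Section TowerTorsion.
Variable G : groupType.
Local Notation tgen J := (@gen (letter G) (@tower_rel G J)).

Definition torsion_from J := forall x : tower G J, torsion x ->
  exists g y, x = tgen J (gl g) ^ y.

Lemma avoids_cat (beta : letter G) u v : avoids beta (u ++ v) = avoids beta u && avoids beta v.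
Proof. exact: all_cat. Qed.

Lemma avoids_winv (beta : letter G) u : avoids beta (winv u) = avoids beta u.
Proof. by rewrite /avoids /winv all_rev all_map. Qed.

Lemma avoids_comm_conj (beta l : letter G) u k v : l != beta -> avoids beta u -> avoids beta v ->
  avoids beta (wcomm u (wconj k l v)).
Proof.
move=> lb au av; have ac : avoids beta (wconj k l v).
  by rewrite !avoids_cat av /avoids !all_nseq /= lb !orbT.
by rewrite avoids_cat au avoids_cat ac avoids_cat !avoids_winv au.
Qed.

(** Torsion is conjugate into [G], which meets the kernel trivially. *)
Lemma ker_torsion_free J : torsion_from J ->
  forall x : tower G J, tower_proj J x = 1 -> torsion x -> x = 1.
Proof.
move=> tJ x px /tJ[g [y xE]]; move: px; rewrite xE gmulfJ => /eqP.
rewrite conjg_eq1 tower_proj_gl => /eqP.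
rewrite -(morph1 (@lgenM G)) => /lgen_inj ->.
by rewrite (morph1 (@tgenM G J)) conj1g.
Qed.

Fact tower_embed_morph J :
  (tgen J (gl 1) = 1) * {morph (fun g => tgen J (gl g)) : g h / g * h}.
Proof. by split; [exact: (morph1 (@tgenM G J)) | exact: tgenM]. Qed.

Definition tower_embed J (g : G) : tower G J := tgen J (gl g).

HB.instance Definition _ J :=
  isUMagmaMorphism.Build G (tower G J) (@tower_embed J) (tower_embed_morph J).

(** One step of the tower, for a letter [beta] adjoined to the image of [H]; the
    associated subgroup is the image of [N].  It is used with [H] the group [G] and
    [beta] the letter [t], and with [H] a smaller tower and [beta] its next letter. *)
Section Stage.
Variables (J : set int) (H : groupType) (up : {ghom H -> tower G J}) (beta : letter G).
Variables (N : set H) (phi : {ghom tower G J -> bijection (H * int)}).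
Local Notation b := (tgen J beta).
Local Notation C := (up @` N).
Hypotheses (sgN : subgroup N) (N_torsion_free : forall x, N x -> torsion x -> x = 1).
Hypotheses (phi_up : forall x, phi (up x) = at_site 0%R x) (phi_b : phi b = site_shift H).
Hypothesis comm : forall x y k, N x -> N y -> (0 < k)%N ->
  commute (up x) (b ^+ k * up y * b ^- k).
Hypotheses (up_vertex : C `<=` @vertex _ (@tower_rel G J) beta).
Hypotheses (vertex_up : forall w, avoids beta w -> exists x, cls (@tower_rel G J) w = up x).
Hypothesis relC : forall r, @tower_rel G J r -> avoids beta r \/ exists u v k,
  [/\ r = wcomm u (wconj k beta v), avoids beta u, avoids beta v, C (cls _ u) & C (cls _ v)].

Lemma stage_torsion q : torsion q -> exists x y, torsion x /\ q = up x ^ y.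
Proof.
move=> tq; have sgC : subgroup C.
  split; first by exists 1; [exact: subgroup1|rewrite gmulf1].
    move=> _ _ [x Nx <-] [y Ny <-]; exists (x * y); first exact: subgroupM.
    by rewrite gmulfM.
  by move=> _ [x Nx <-]; exists x^-1; [exact: subgroupV|rewrite gmulfV].
pose F := base_form up N b.
have FC c x : C c -> F x -> F (c * x) by move=> [y Ny <-]; exact: base_formC.
have Fb x : F x -> F (b * x) by exact: base_formb.
have FV x : F x -> F (b^-1 * x) by exact: base_formbV.
have [g [w aw qg]] : exists g, @vertex _ (@tower_rel G J) beta (q ^ g).
  apply: (hnn_torsion sgC up_vertex relC (stabilizer_subgroup F)) => //.
  - exact: stabilizer_base.
  - exact: stabilizer_stable.
  - move=> y /(stabilizer_sub (base_form1 up N b)).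
    exact: (base_form_torsion_free phi_up phi_b).
have [x xE] := vertex_up aw; exists x, g^-1.
have qE : q = up x ^ g^-1 by rewrite -xE -qg -conjgM mulgV conjg1.
split=> //; have := torsion_conj g tq; rewrite qg xE => -[n n0]; rewrite -gmulfXn => xn.
exists n => //; apply: (@at_site_inj H 0%R); rewrite -!phi_up xn.
by rewrite !gmulf1.
Qed.

End Stage.

(** With no letter [b_j] alive, the tower is the free product of [G] and [<t>]:
    the associated subgroup is trivial. *)
Lemma torsion_seg0 i : torsion_from (seg i i).
Proof.
have emp k : ~ seg i i k by rewrite /seg /=; lia.
move=> q tq.
suff [x [y [_ ->]]] : exists x y, torsion x /\ q = tower_embed (seg i i) x ^ y by exists x, y.
apply: (stage_torsion (N := [set 1]) (beta := tl G)
  (phi := plift (@lamp_configP G) \o tower_proj (seg i i)) _ _ _ _ _ _ _ _ tq).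
- by split=> [//|_ _ -> ->|_ ->]; rewrite /= ?mulg1 ?invg1.
- by move=> x ->.
- by move=> x /=; rewrite /tower_embed tower_proj_gl plift_gen.
- by rewrite /= !plift_gen.
- move=> x y k -> _ _; rewrite gmulf1; exact/commute_sym/commute1.
- by move=> _ [_ -> <-]; rewrite gmulf1; exists [::].
- elim=> [|[s l] w IH] /=; first by exists 1; rewrite gmulf1.
  move=> /andP[ls /IH[x wE]].
  have [y yE] : exists y, tgen (seg i i) l = tower_embed (seg i i) y.
    case: l ls => [g|[k|//]] _; first by exists g.
    by exists 1; rewrite gmulf1; exact: tgen_kill.
  exists ((if s then y^-1 else y) * x); rewrite gmulfM -wE !clsE evalw_cons /= yE.
  by case: s; rewrite ?gmulfV.
- move=> _ [g h|k _|k n u v /emp//]; by left.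
Qed.

(** The associated subgroup is the kernel of the smaller tower on [lampgroup]; it is
    torsion free by [ker_torsion_free]. *)
Lemma torsion_seg_step i j : (i <= j)%R -> torsion_from (seg i j) ->
  torsion_from (seg i (j + 1)%R).
Proof.
move=> ij tf q tq; pose up := @subtower G _ _ (@floor_sub i j).
suff [x [y [/tf[g [z ->]] ->]]] : exists x y, torsion x /\ q = up x ^ y.
  by exists g, (up z * y); rewrite gmulfJ -conjgM /up subtower_gen.
have cls_up w : avoids (bl G j) w -> up (cls _ w) = cls _ w.
  by move=> /allP aw; apply: (up_cls ij) => l /aw.
have below_avoids k w : (k <= j)%R -> below k w -> avoids (bl G j) w.
  by move=> kj bw; apply/allP => l; exact: below_neq bw.
apply: (stage_torsion (N := [set x | tower_proj (seg i j) x = 1]) (beta := bl G j)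
  (phi := floor_hom ij) _ _ _ _ _ _ _ _ tq).
- split; rewrite /mkset; first exact: gmulf1.
    by move=> x y px py; rewrite gmulfM px py mulg1.
  by move=> x px; rewrite gmulfV px invg1.
- exact: ker_torsion_free.
- exact: floor_hom_up.
- by rewrite /= plift_gen /floor_act eqxx.
- move=> x y k px py k0.
  rewrite -[x]cls_repr -[y]cls_repr /= !plift_cls !evalw_restrict.
  have bel z : below j (restrictw (seg i j) z).
    apply/allP => l; rewrite mem_filter alive_seg => /andP[]; case: l => s [g|[m|]] //=.
    by lia.
  apply: tgen_comm => //; rewrite ?lamp_value_restrict -?(tower_proj_cls (seg i j)) ?cls_repr //.
  by rewrite /seg /=; lia.
- move=> _ [x _ <-]; exists (restrictw (seg i j) (repr x)).
    apply/allP => l; rewrite mem_filter alive_seg => /andP[]; case: l => s [g|[m|]] //=.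
    by move=> mj _; apply/eqP => -[] mj'; lia.
  by rewrite clsE -evalw_restrict -[x in LHS]cls_repr /= plift_cls.
- by move=> w aw; exists (cls _ w); rewrite cls_up.
- move=> _ [g h|k nk|k n u v kij n0 bu bv lu lv]; first by left.
    left; rewrite /avoids /= andbT; apply/eqP => -[] kj; apply: nk.
    by rewrite kj /seg /=; lia.
  have kj : (k <= j)%R by move: kij; rewrite /seg /=; lia.
  have [kE|nkj] := eqVneq k j; last first.
    left; apply: avoids_comm_conj; [|exact: below_avoids kj _|exact: below_avoids kj _].
    by apply/eqP => -[]; exact/eqP.
  rewrite kE in bu bv *; have au := below_avoids _ _ (lexx j) bu.
  have av := below_avoids _ _ (lexx j) bv; right; exists u, v, n; split=> //.
    by exists (cls _ u); [rewrite /mkset tower_proj_cls | rewrite -/up cls_up].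
  by exists (cls _ v); [rewrite /mkset tower_proj_cls | rewrite -/up cls_up].
Qed.

Lemma torsion_seg i (n : nat) : torsion_from (seg i (i + n%:Z)%R).
Proof.
elim: n => [|n IH]; first by rewrite addr0; exact: torsion_seg0.
have -> : (i + n.+1%:Z = i + n%:Z + 1)%R by lia.
by apply: torsion_seg_step => //; lia.
Qed.

End TowerTorsion.

(** * The two lamplighter groups *)

Section Compactness.
Variable G : groupType.
Local Notation sym m := (seg (- Posz m)%R (Posz m)).

(** A derivation uses finitely many relations, each with one letter [b_j] on top. *)
Lemma cong_truncate u v : cong (@tower_rel G setT) u v ->
  exists m0, forall m, (m0 <= m)%N -> cong (@tower_rel G (sym m)) u v.
Proof.
elim=> {u v}.
- by move=> u; exists 0%N => m _; exact: cong_refl.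
- by move=> u v _ [m0 H]; exists m0 => m /H; exact: cong_sym.
- move=> u v w _ [m0 H] _ [m1 H']; exists (maxn m0 m1) => m.
  by rewrite geq_max => /andP[/H uv /H']; exact: cong_trans.
- move=> u u' v v' _ [m0 H] _ [m1 H']; exists (maxn m0 m1) => m.
  by rewrite geq_max => /andP[/H uv /H']; exact: cong_cat.
- by move=> b x; exists 0%N => m _; exact: cong_cancel.
- move=> _ [g h|j []//|j k u v _ k0 bu bv lu lv].
    by exists 0%N => m _; apply: cong_rel; exact: tower_mul.
  exists (`|j|.+1)%N => m jm; apply: cong_rel; apply: tower_comm => //.
  by rewrite /seg /=; lia.
Qed.

Lemma letters_bounded (w : word (letter G)) :
  exists m0, forall m, (m0 <= m)%N -> all (fun l => alive (sym m) l.2) w.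
Proof.
elim: w => [|[b l] w [m0 IH]]; first by exists 0%N.
have [m1 lm] : exists m1, forall m, (m1 <= m)%N -> alive (sym m) l.
  case: l => [g|[j|]]; [by exists 0%N | | by exists 0%N].
  by exists (`|j|.+1)%N => m jm; rewrite alive_seg; lia.
exists (maxn m0 m1) => m; rewrite geq_max => /andP[/IH /= -> /lm ->//].
Qed.

Lemma cls_flatten (X : choiceType) (Rel : word X -> Prop) n w :
  cls Rel (flatten (nseq n w)) = cls Rel w ^+ n.
Proof. by elim: n => [|n IH]; rewrite ?expg0 // expgS -IH -clsM. Qed.

Lemma tower_torsion : torsion_from G setT.
Proof.
move=> q [n n0 qn]; pose w := repr q.
have c : cong (@tower_rel G setT) (flatten (nseq n w)) [::].
  by apply/clsP; rewrite cls_flatten cls_repr qn.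
have [m0 H] := cong_truncate c.
have [m1 H1] := letters_bounded w.
pose m := maxn m0 m1.
have tw : torsion (cls (@tower_rel G (sym m)) w).
  by exists n => //; rewrite -cls_flatten; apply/clsP/H; rewrite leq_maxl.
have sT : sym m `<=` setT by [].
have := @torsion_seg G (- Posz m)%R m.*2.
have -> : (- Posz m + Posz m.*2 = Posz m)%R by lia.
move=> /(_ _ tw)[g [y wE]]; exists g, (subtower sT y).
have /allP wm := H1 m (leq_maxr _ _).
rewrite -[q]cls_repr -(subtower_cls sT); last by move=> l /wm.
by rewrite -/w wE gmulfJ subtower_gen.
Qed.

End Compactness.

Section LampgroupAcyclic.
Variable G : groupType.
Local Notation lgen := (@gen (letter G) (@lamp_rel G)).
Local Notation Q := (lampgroup G).
Local Notation t := (lgen (tl G)).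

Fact lamp_embed_morph :
  (lgen (gl 1) = 1) * {morph (fun g => lgen (gl g)) : g h / g * h}.
Proof. by split; [exact: (morph1 (@lgenM G)) | exact: lgenM]. Qed.

Definition lamp_embed (g : G) : Q := lgen (gl g).

HB.instance Definition _ := isUMagmaMorphism.Build G Q lamp_embed lamp_embed_morph.

Local Notation lspots := (spots lamp_embed t).

Lemma lamp_spots_comm x y k : setT x -> setT y -> (0 < k)%N ->
  commute (lamp_embed x) (t ^+ k * lamp_embed y * t ^- k).
Proof. by move=> _ _; exact: lgen_comm. Qed.

(** The subgroup generated by the conjugates [t^i g t^-i] with [|i| <= j], written with
    natural indices by conjugating with [t^j]. *)
Definition window j : set Q := [set x | exists2 s : seq (nat * G),
  forall p, p \in s -> (p.1 <= j.*2)%N & x = lspots s ^ (t ^+ j)].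

Lemma windowP j k s : (forall p, p \in s -> (k + p.1 <= (k + j).*2)%N) ->
  window (k + j)%N (lspots s ^ (t ^+ j)).
Proof.
move=> sk; exists [seq ((k + p.1)%N, p.2) | p <- s]; first by move=> p /mapP[q /sk ? ->].
by rewrite -spots_conjX expgnDr conjgM; congr (_ ^ _); rewrite conjgE !mulgA mulVg mul1g mulgVK.
Qed.

Lemma conjg_commute (K : groupType) (g h x : K) : commute g h ->
  h * x ^ g * h^-1 = (h * x * h^-1) ^ g.
Proof.
have hE y : h * y * h^-1 = y ^ h^-1 by rewrite conjgE invgK mulgA.
by move=> /commuteV gh; rewrite !hE -!conjgM gh.
Qed.

Lemma lampgroup_form (x : Q) : base_form lamp_embed setT t x.
Proof.
have formE : forall g y, base_form lamp_embed setT t y -> base_form lamp_embed setT t (lamp_embed g * y).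
  by move=> g y; exact: base_formC.
move: x; apply: presented_ind; first exact: base_form1.
  case=> [g|[j|]] y fy; [exact: formE | by rewrite lgen_b mul1g | exact: base_formb].
case=> [g|[j|]] y fy; last exact: base_formbV.
  by rewrite -/(gl g) -/(lamp_embed g) -gmulfV; exact: formE.
by rewrite lgen_b invg1 mul1g.
Qed.

Lemma indices_bounded (s : seq (nat * G)) : exists n, forall p, p \in s -> (p.1 <= n)%N.
Proof.
exists (\sum_(p <- s) p.1)%N => p ps; rewrite (big_rem p ps); exact: leq_addr.
Qed.

(** Conjugating by [t^(2j+1)] moves the window of width [2j+1] off itself. *)
Lemma lampgroup_lamplighter :
  lamplighter [set: Q] window (fun j => t ^+ j.*2.+1) t.
Proof.
split=> //.
- move=> j; split.
  + by exists [::]; rewrite // /spots big_nil conj1g.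
  + move=> _ _ [s sj ->] [s' s'j ->]; exists (s ++ s'); last by rewrite spots_cat conjMg.
    by move=> p; rewrite mem_cat => /orP[/sj|/s'j].
  + move=> _ [s sj ->]; exists (rev [seq (p.1, p.2^-1) | p <- s]).
      by move=> p; rewrite mem_rev => /mapP[q /sj ? ->].
    rewrite -conjVg; congr (_ ^ _).
    elim: s {sj} => [|p s IH]; first by rewrite /spots !big_nil invg1.
    rewrite -cat1s spots_cat invgM IH map_cat rev_cat spots_cat; congr (_ * _).
    by rewrite /spots !big_seq1 /spot /= gmulfV !invgM invgK mulgA.
- move=> j _ [s sj ->]; rewrite -add1n; apply: windowP => p /sj.
  suff : forall a, (a <= j.*2)%N -> (1 + a <= (1 + j).*2)%N by apply.
  by lia.
- move=> j _ _ i [s sj ->] [s' s'j ->] i0; rewrite -expgnA.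
  set n := (j.*2.+1 * i)%N.
  have -> : t ^+ n * lspots s' ^ (t ^+ j) * t ^- n = (t ^+ n * lspots s' * t ^- n) ^ (t ^+ j).
    by apply: conjg_commute; exact/commuteX2/commute_refl.
  rewrite spots_conjX /commute -!conjMg; congr (_ ^ _).
  apply: (spots_indices_comm lamp_spots_comm) => //.
  move=> p q ps /mapP[r rs' ->]; apply/eqP => /= pr.
  have := sj p ps; rewrite pr leqNgt => /negP[].
  by rewrite (leq_trans _ (leq_addr _ _)) // /n leq_pmulr.
- move=> j _ [s sj ->]; exists j.+1.
  have -> : t * lspots s ^ (t ^+ j) * t^-1 = (t ^+ 1 * lspots s * t ^- 1) ^ (t ^+ j).
    by rewrite expg1; apply: conjg_commute; exact/commute_sym/commuteX/commute_refl.
  rewrite spots_conjX -add1n; apply: windowP => p /mapP[q /sj qj ->] /=.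
  suff : forall a, (a <= j.*2)%N -> (1 + (1 + a) <= (1 + j).*2)%N by apply.
  by lia.
- move=> x _; have [K [s [L [_ ->]]]] := lampgroup_form x.
  have [n sn] := indices_bounded s.
  have Wj : window (n + K)%N (lspots s ^ (t ^+ K)).
    apply: windowP => p /sn.
    suff : forall a, (a <= n)%N -> (n + a <= (n + K).*2)%N by apply.
    by lia.
  exists (n + K)%N, (lspots s ^ (t ^+ K)).
  have xE : t ^- K * lspots s * t ^+ L = lspots s ^ (t ^+ K) * (t ^- K * t ^+ L).
    by rewrite conjgE !mulgA mulgK.
  have [KL|/ltnW LK] := leqP K L.
    exists (L - K)%N; split=> //; left; rewrite xE; congr (_ * _).
    by rewrite -{1}(subnKC KL) expgnDr mulKg.
  exists (K - L)%N; split=> //; right; rewrite xE; congr (_ * _).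
  by rewrite -{1}(subnKC LK) expgnDr invgM mulgVK.
Qed.

Lemma lampgroup_acyclic (R : realType) n : acyclic_in R Q n.
Proof.
move=> c B cB ci c0; have [b [bB bi bE]] := lamplighter_acyclic lampgroup_lamplighter cB ci c0.
by exists b; split=> //; eexists; exact: bB.
Qed.

End LampgroupAcyclic.

(** The shift of the letters [b_j] extends the tower to a semidirect product with the
    integers. *)
Section Telescope.
Variable G : groupType.
Local Notation T := (tower G setT).
Local Notation tgen := (@gen (letter G) (@tower_rel G setT)).
Local Notation lgen := (@gen (letter G) (@lamp_rel G)).

Definition shift_letter (k : int) (l : letter G) : letter G :=
  if l is inr (Some j) then bl G (j + k)%R else l.

Definition shift_word k (w : word (letter G)) := [seq (l.1, shift_letter k l.2) | l <- w].

Lemma evalw_shift (H : groupType) (f : letter G -> H) k w :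
  evalw (fun l => f (shift_letter k l)) w = evalw f (shift_word k w).
Proof. by rewrite /evalw big_map. Qed.

Lemma lamp_value_shift k w : lamp_value (shift_word k w) = lamp_value w.
Proof.
rewrite /lamp_value -evalw_shift; apply: evalw_eq => -[b [g|[j|]]] _ //=.
by rewrite !lgen_b.
Qed.

Lemma below_shift k j w : below j w -> below (j + k)%R (shift_word k w).
Proof.
move=> /allP bw; apply/allP => _ /mapP[l /bw lj ->]; case: l lj => b [g|[i|]] //= ij.
by rewrite ltrD2r.
Qed.

Fact shift_towerP k r : @tower_rel G setT r ->
  evalw (fun l => tgen (shift_letter k l)) r = 1.
Proof.
apply: tower_lift => [|j []//|j n u v _ n0 bu bv lu lv]; first exact: tgenM.
rewrite !evalw_shift /=; apply: tgen_comm => //; rewrite ?lamp_value_shift //; exact: below_shift.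
Qed.

Definition shift_tower k : {ghom T -> T} := plift (shift_towerP k).

Lemma shift_tower_gen k l : shift_tower k (tgen l) = tgen (shift_letter k l).
Proof. exact: plift_gen. Qed.

Lemma shift_tower_cls k w : shift_tower k (cls _ w) = cls _ (shift_word k w).
Proof. by rewrite /= plift_cls evalw_shift clsE. Qed.

Lemma shift_tower0 : shift_tower 0 =1 id.
Proof.
apply: (presented_hom_eq (phi := shift_tower 0) (psi := idfun)) => l.
by rewrite shift_tower_gen; case: l => [g|[j|]] //=; rewrite addr0.
Qed.

Lemma shift_towerD k l x : shift_tower (k + l)%R x = shift_tower k (shift_tower l x).
Proof.
move: x; apply: (presented_hom_eq (phi := shift_tower (k + l)%R)
  (psi := shift_tower k \o shift_tower l)) => y.
rewrite /= !plift_gen; case: y => [g|[j|]] //=.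
by congr (tgen (bl G _)); lia.
Qed.

Lemma shift_tower_proj k x : tower_proj setT (shift_tower k x) = tower_proj setT x.
Proof. by rewrite -[x]cls_repr shift_tower_cls !tower_proj_cls lamp_value_shift. Qed.

(** A record instead of a pair, since a pair already has the structure of a direct
    product. *)
Record telescope := Telescope { base : T; level : int }.

HB.instance Definition _ := gen_eqMixin telescope.
HB.instance Definition _ := gen_choiceMixin telescope.

Definition tele1 := Telescope 1 0%R.
Definition teleM x y := Telescope (base x * shift_tower (level x) (base y)) (level x + level y)%R.
Definition teleV x := Telescope (shift_tower (- level x)%R (base x)^-1) (- level x)%R.

Fact teleMA : associative teleM.
Proof.
move=> [x k] [y l] [z m]; rewrite /teleM /= addrA.
by rewrite shift_towerD gmulfM mulgA.
Qed.
Fact tele1M : left_id tele1 teleM.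
Proof. by move=> [x k]; rewrite /teleM /= mul1g add0r shift_tower0. Qed.
Fact teleM1 : right_id tele1 teleM.
Proof. by move=> [x k]; rewrite /teleM /= gmulf1 mulg1 addr0. Qed.
Fact teleVM : left_inverse tele1 teleV teleM.
Proof. by move=> [x k]; rewrite /teleM /teleV /= -gmulfM mulVg gmulf1 addNr. Qed.
Fact teleMV : right_inverse tele1 teleV teleM.
Proof.
by move=> [x k]; rewrite /teleM /teleV /= -shift_towerD subrr shift_tower0 mulgV.
Qed.

HB.instance Definition _ := isGroup.Build telescope teleMA tele1M teleM1 teleVM teleMV.

Lemma teleME x y : x * y = teleM x y. Proof. by []. Qed.
Lemma teleVE x : x^-1 = teleV x. Proof. by []. Qed.

Definition tele_base (x : T) : telescope := Telescope x 0%R.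

Fact tele_base_morph : (tele_base 1 = 1) * {morph tele_base : x y / x * y}.
Proof.
by split=> // x y; rewrite teleME /teleM /= addr0 shift_tower0.
Qed.

HB.instance Definition _ := isUMagmaMorphism.Build T telescope tele_base tele_base_morph.

Definition tele_proj (x : telescope) : lampgroup G := tower_proj setT (base x).

Fact tele_proj_morph : (tele_proj 1 = 1) * {morph tele_proj : x y / x * y}.
Proof.
split=> [|x y]; first exact: gmulf1.
by rewrite /tele_proj gmulfM shift_tower_proj.
Qed.

HB.instance Definition _ :=
  isUMagmaMorphism.Build telescope (lampgroup G) tele_proj tele_proj_morph.

Definition tele_pi : {ghom telescope -> lampgroup G} := tele_proj.

Definition tele_gen : telescope := Telescope 1 1%R.

Lemma tele_genX k : tele_gen ^+ k = Telescope 1 k%:Z.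
Proof.
elim: k => [|k IH]; first by rewrite expg0.
by rewrite expgS IH teleME /teleM /= gmulf1 mulg1 intS.
Qed.

Lemma tele_genV k : tele_gen ^- k = Telescope 1 (- k%:Z)%R.
Proof. by rewrite tele_genX teleVE /teleV /= invg1 gmulf1. Qed.

Lemma tele_gen_conj x : tele_gen * tele_base x * tele_gen^-1 = tele_base (shift_tower 1 x).
Proof.
rewrite teleVE !teleME /teleV /teleM /= invg1 !gmulf1 mulg1 mul1g.
by rewrite /tele_base; congr Telescope.
Qed.

Lemma telescopeE x : exists k, x = tele_base (base x) * tele_gen ^+ k \/
  x = tele_base (base x) * tele_gen ^- k.
Proof.
case: x => x k; exists `|k|%N; rewrite tele_genV tele_genX !teleME /teleM /= gmulf1 mulg1 add0r.
by have [k0|k0] := lerP 0%R k; [left|right]; congr Telescope; lia.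
Qed.

(** These subgroups exhaust the kernel of [tele_pi] on the tower, since a word has
    finitely many letters. *)
Definition floors (j : nat) : set telescope := [set x | exists w : word (letter G),
  [/\ below j%:Z w, lamp_value w = 1 & x = tele_base (cls _ w)]].

Lemma below_bound (w : word (letter G)) : exists j : nat, below j%:Z w.
Proof.
have [m0 H] := letters_bounded w; exists m0.
have /allP aw := H m0 (leqnn _); apply/allP => l /aw; rewrite alive_seg.
by case: l => b [g|[j|]] //=; lia.
Qed.

Lemma below_le (j k : int) (w : word (letter G)) : (j <= k)%R -> below j w -> below k w.
Proof.
by move=> jk /allP bw; apply/allP => l /bw; case: l => b [g|[i|]] //= /lt_le_trans ->.
Qed.

(** The relations of the letter [b_j] are exactly the commutation that is required,
    and conjugation by [z] raises the height of a word by one. *)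
Lemma telescope_lamplighter : lamplighter [set x | tele_pi x = 1] floors
  (fun j => tele_base (tgen (bl G j%:Z))) tele_gen.
Proof.
split.
- split; rewrite /mkset; first exact: gmulf1.
    by move=> x y px py; rewrite gmulfM px py mulg1.
  by move=> x px; rewrite gmulfV px invg1.
- move=> j; split.
  + by exists [::]; split; rewrite // ?/lamp_value ?evalw_nil //.
  + move=> _ _ [u [bu lu ->]] [v [bv lv ->]]; exists (u ++ v).
    rewrite clsM gmulfM; split=> //; first by rewrite /below all_cat; exact/andP.
    by rewrite /lamp_value evalw_cat -/(lamp_value u) -/(lamp_value v) lu lv mulg1.
  + move=> _ [u [bu lu ->]]; exists (winv u).
    rewrite clsV gmulfV; split=> //; first by rewrite /below all_rev all_map.
    by rewrite /lamp_value evalw_inv -/(lamp_value u) lu invg1.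
- by move=> j _ [u [bu lu ->]]; exists u; split=> //; apply: below_le bu; lia.
- by move=> j _ [u [bu lu ->]]; rewrite /mkset /= /tele_proj /= -/(tower_proj setT) tower_proj_cls.
- by move=> j; rewrite /mkset /= /tele_proj /= plift_gen lgen_b.
- move=> j _ _ i [u [bu lu ->]] [v [bv lv ->]] i0.
  rewrite -gmulfXn -gmulfV -!gmulfM; apply: gmulf_commute.
  by rewrite !clsE; exact: tgen_comm.
- by rewrite /mkset /= /tele_proj /= gmulf1.
- move=> j _ [u [bu lu ->]]; exists j.+1, (shift_word 1 u); split.
  + by rewrite -addn1 PoszD; exact: below_shift.
  + by rewrite lamp_value_shift.
  + by rewrite tele_gen_conj shift_tower_cls.
- move=> x; rewrite /mkset => px; have [k xE] := telescopeE x.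
  have [j bj] := below_bound (repr (base x)).
  exists j, (tele_base (base x)), k; split=> //; exists (repr (base x)).
  by split; rewrite ?cls_repr // -(tower_proj_cls setT) cls_repr.
Qed.

Lemma telescope_acyclic (R : realType) : boundedly_acyclic R telescope.
Proof.
apply: acyclic_boundedly; apply: (extension_acyclic (pi := tele_pi)).
- move=> y; have [x <-] := tower_proj_surj setT y.
  by exists (tele_base x).
- move=> n _; exists (n.+1%:R)%R; first exact: ler0n.
  exact: (lamplighter_acyclic telescope_lamplighter).
- by move=> n _; exact: lampgroup_acyclic.
Qed.

Lemma telescope_torsion (x : telescope) : torsion x ->
  exists g y, x = tele_base (tgen (gl g)) ^ y.
Proof.
case=> n n0 xn.
have lev k : level (x ^+ k) = (k%:Z * level x)%R.
  elim: k => [|k IH]; first by rewrite expg0 mul0r.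
  by rewrite expgS /= IH; lia.
have l0 : level x = 0%R.
  have := lev n; rewrite xn /= => /esym/eqP.
  by rewrite mulf_eq0 gt_eqF ?ltz_nat //= => /eqP.
have xE : x = tele_base (base x) by case: x l0 {xn lev} => ? ? /= ->.
have tb : torsion (base x).
  by exists n => //; move: xn; rewrite xE -gmulfXn => /(congr1 base).
have [g [y yE]] := tower_torsion tb; exists g, (tele_base y).
by rewrite xE yE gmulfJ.
Qed.

Definition tele_embed (g : G) : telescope := tele_base (tgen (gl g)).

Fact tele_embed_morph : (tele_embed 1 = 1) * {morph tele_embed : g h / g * h}.
Proof.
split=> [|g h]; rewrite /tele_embed.
  by rewrite (morph1 (@tgenM G setT)) gmulf1.
by rewrite (@tgenM G setT) gmulfM.
Qed.

HB.instance Definition _ := isUMagmaMorphism.Build G telescope tele_embed tele_embed_morph.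

Lemma tele_embed_inj : injective tele_embed.
Proof. by move=> g h /(congr1 base) /tgen_inj. Qed.

End Telescope.

(** * Functoriality *)

(** The relations of the tower refer to words trivial in [lampgroup], so it is
    the functoriality of [lampgroup] that carries them over. *)
Section Functoriality.
Variables (G H : groupType) (f : {ghom G -> H}).
Local Notation tgen K := (@gen (letter K) (@tower_rel K setT)).
Local Notation lgen K := (@gen (letter K) (@lamp_rel K)).

Definition map_letter (l : letter G) : letter H :=
  match l with inl g => inl (f g) | inr o => inr o end.

Definition map_word (w : word (letter G)) := [seq (l.1, map_letter l.2) | l <- w].

Lemma evalw_map (K : groupType) (h : letter H -> K) w :
  evalw (fun l => h (map_letter l)) w = evalw h (map_word w).
Proof. by rewrite /evalw big_map. Qed.

Lemma below_map j w : below j w -> below j (map_word w).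
Proof.
by move=> /allP bw; apply/allP => _ /mapP[l /bw lj ->]; case: l lj => b [g|[i|]].
Qed.

Fact lamp_mapP r : @lamp_rel G r -> evalw (fun l => lgen H (map_letter l)) r = 1.
Proof.
apply: lamp_lift => [g h|j|g h k k0] /=; last exact: lgen_comm.
  by rewrite gmulfM; exact: lgenM.
exact: lgen_b.
Qed.

Lemma lamp_value_map w : lamp_value w = 1 -> lamp_value (map_word w) = 1.
Proof.
move=> w1; have : plift lamp_mapP (lamp_value w) = 1 by rewrite w1 gmulf1.
by rewrite /lamp_value -clsE plift_cls evalw_map.
Qed.

Fact tower_mapP r : @tower_rel G setT r -> evalw (fun l => tgen H (map_letter l)) r = 1.
Proof.
apply: tower_lift => [g h|j []//|j k u v _ k0 bu bv lu lv].
  by rewrite /= gmulfM; exact: tgenM.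
rewrite !evalw_map /=; apply: tgen_comm => //; [exact: below_map|exact: below_map| |];
  exact: lamp_value_map.
Qed.

Definition tower_map : {ghom tower G setT -> tower H setT} := plift tower_mapP.

Lemma tower_map_shift k x : tower_map (shift_tower G k x) = shift_tower H k (tower_map x).
Proof.
move: x; apply: (presented_hom_eq (phi := tower_map \o shift_tower G k)
  (psi := shift_tower H k \o tower_map)) => l.
by rewrite /= !plift_gen; case: l => [g|[j|]].
Qed.

Definition tele_map (x : telescope G) : telescope H := Telescope (tower_map (base x)) (level x).

Fact tele_map_morph : (tele_map 1 = 1) * {morph tele_map : x y / x * y}.
Proof.
split=> [|x y]; first by rewrite /tele_map gmulf1.
by rewrite !teleME /tele_map /teleM /= -tower_map_shift -gmulfM.
Qed.

HB.instance Definition _ :=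
  isUMagmaMorphism.Build (telescope G) (telescope H) tele_map tele_map_morph.

End Functoriality.

Lemma tele_map_id (G : groupType) : tele_map (@idfun G : {ghom G -> G}) =1 idfun.
Proof.
case=> x k; congr Telescope => /=; move: x.
apply: (presented_hom_eq (phi := tower_map (@idfun G : {ghom G -> G})) (psi := idfun)) => l.
by rewrite /= plift_gen; case: l.
Qed.

Lemma tele_map_comp (G H K : groupType) (g : {ghom H -> K}) (f : {ghom G -> H}) :
  tele_map (g \o f : {ghom G -> K}) =1 tele_map g \o tele_map f.
Proof.
case=> x k; congr Telescope => /=; move: x.
apply: (presented_hom_eq (phi := tower_map (g \o f : {ghom G -> K}))
  (psi := tower_map g \o tower_map f)) => l.
by rewrite /= !plift_gen; case: l.
Qed.

Definition telescope_functor : group_functor :=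
  @GroupFunctor (fun G => telescope G) (fun G H f => tele_map f : {ghom telescope G -> telescope H})
    tele_map_id tele_map_comp.

(** * A free subgroup *)

Section FreeGroup.
Variable X : choiceType.

Definition free := presented (fun _ : word X => False).

Fact free_liftP (H : groupType) (f : X -> H) (r : word X) : False -> evalw f r = 1.
Proof. by []. Qed.

Local Notation fgen := (@gen X (fun=> False)).

Lemma free_free : free_group free.
Proof.
exists (range fgen) => H f.
exists (plift (free_liftP (fun x => f (fgen x))) : {ghom free -> H}).
  by move=> _ [x _ <-]; rewrite /= plift_gen.
move=> psi psif; apply: presented_hom_eq => x.
by rewrite /= plift_gen psif //; exists x.
Qed.

End FreeGroup.

Section FreeSubgroup.
Variable G : groupType.
Local Notation F2 := (free bool).
Local Notation fgen := (@gen bool (fun=> False)).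
Local Notation tgen J := (@gen (letter G) (@tower_rel G J)).

Definition basis (x : bool) : letter G := if x then tl G else bl G 0%R.

Definition free_hom J : {ghom F2 -> tower G J} := plift (free_liftP (fun x => tgen J (basis x))).

Definition basis_word (w : word bool) : word (letter G) := [seq (l.1, basis l.2) | l <- w].

Lemma free_hom_cls J w : free_hom J (cls _ w) = cls _ (basis_word w).
Proof. by rewrite /= plift_cls clsE /evalw big_map. Qed.

(** In the tower with letters up to [b_0], sending [t] and [b_0] to the basis and
    everything else to 1 respects the relations: a word below [b_0] that is trivial
    in [lampgroup] goes to a power of the image of [t] with exponent zero.  This
    would fail for relations of a letter above [b_0], whose words may contain
    [b_0]. *)
Definition unbasis (l : letter G) : F2 :=
  match l with
  | inl _ => 1
  | inr None => fgen true
  | inr (Some j) => if j == 0%R then fgen false else 1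
  end.

Fact unbasis_lampP r : @lamp_rel G r ->
  evalw (fun l => if l is inr None then fgen true else 1) r = 1.
Proof.
apply: lamp_lift => //= [g h|g h k _]; first by rewrite mulg1.
exact/commute_sym/commute1.
Qed.

Variable m : nat.
Local Notation low := (seg (- m%:Z)%R 1%R).

Fact unbasisP r : @tower_rel G low r -> evalw unbasis r = 1.
Proof.
have lamp u : below 0%R u -> lamp_value u = 1 -> evalw unbasis u = 1.
  move=> /allP bu lu; have := congr1 (plift unbasis_lampP) lu.
  rewrite gmulf1 /lamp_value -clsE plift_cls => <-; apply: evalw_eq => l /bu.
  case: l => b [g|[j|]] //= j0; by rewrite lt_eqF.
apply: tower_lift => [g h|j nj|j k u v ij k0 bu bv lu lv] /=; first by rewrite mulg1.
  by case: eqP => // j0; case: nj; rewrite j0 /seg /=; lia.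
have j0 : (j <= 0)%R by move: ij; rewrite /seg /=; lia.
by rewrite (lamp u (below_le j0 bu) lu); exact/commute_sym/commute1.
Qed.

Lemma free_low_inj : injective (free_hom low).
Proof.
apply: gmulf_inj => x /(congr1 (plift unbasisP)); rewrite gmulf1 => <-.
move: x; apply: (presented_hom_eq (phi := idfun) (psi := plift unbasisP \o free_hom low)).
by move=> l; rewrite /= !plift_gen; case: l.
Qed.

End FreeSubgroup.

Section FreeTelescope.
Variable G : groupType.
Local Notation F2 := (free bool).
Local Notation fgen := (@gen bool (fun=> False)).

(** A word that is trivial in the tower is trivial with finitely many letters, and
    the tower with letters up to [b_0] embeds in the one with those letters. *)
Lemma free_hom_inj : injective (@free_hom G setT).
Proof.
apply: gmulf_inj => x; rewrite -[x]cls_repr; set w := repr x.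
rewrite free_hom_cls => /clsP /cong_truncate[m0 /(_ m0.+1 (leqnSn _))/clsP w1].
apply: (@free_low_inj G m0.+1); rewrite gmulf1.
have s : seg (- m0.+1%:Z)%R 1%R `<=` seg (- m0.+1%:Z)%R m0.+1%:Z by apply: seg_sub; lia.
have up : injective (@subtower G _ _ s).
  by apply: (subtower_seg_inj (n := m0)) => //; lia.
apply: up; rewrite gmulf1 free_hom_cls subtower_cls ?w1 //.
move=> _ /mapP[l _ ->]; rewrite !alive_seg; case: l => b []//= _; lia.
Qed.

Definition nat_flip : bijection int := Bijection (@opprK int) (@opprK int).

Definition translation : bijection int := Bijection (addrK 1%R) (subrK 1%R).

Lemma free_nonabelian : ~ commute (fgen true) (fgen false).
Proof.
pose f b := if b then nat_flip else translation.
move=> /(congr1 (plift (free_liftP f))); rewrite !gmulfM /= !plift_gen.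
by move/(congr1 (fun h : bijection int => h 0%R)).
Qed.

Lemma telescope_free : has_nonabelian_free_subgroup (telescope G).
Proof.
exists F2, (@tele_base G \o @free_hom G setT : {ghom F2 -> telescope G}); split.
- by move=> x y /(congr1 (@base G)); exact: free_hom_inj.
- exact: free_free.
- by exists (fgen true), (fgen false); exact: free_nonabelian.
Qed.

End FreeTelescope.

(** * Generators *)

Lemma group_closedP (G : groupType) (M : set G) : group_closed [in M] <-> subgroup M.
Proof.
split=> [gM|sM].
  have [M1 _] := gM; split; first by move: M1; rewrite !inE.
    by move=> x y Mx My; have := group_closedM gM (mem_set Mx) (mem_set My); rewrite !inE.
  by move=> x Mx; have := group_closedV gM (mem_set Mx); rewrite !inE.
split; first by rewrite !inE; exact: subgroup1.
move=> x y; rewrite !inE => Mx My; apply: (subgroupM sM) => //; exact: subgroupV.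
Qed.

Lemma generatedP (G : groupType) (S : set G) :
  generated S = setT <-> forall M : set G, subgroup M -> S `<=` M -> forall x, M x.
Proof.
split=> [gS M sM SM x|SM].
  have : generated S x by rewrite gS.
  by apply: smallest_sub => //; exact/group_closedP.
by apply/seteqP; split=> // x _ M [/group_closedP sM SM']; exact: SM.
Qed.

Lemma card_setU1 (T : pointedType) (A : set T) (x : T) (n : nat) :
  ~ A x -> A #= `I_n -> (x |` A) #= `I_n.+1.
Proof.
move=> nAx; rewrite card_eq_sym => /card_set_bijP[g [gA gi gs]].
rewrite card_eq_sym; apply/card_set_bijP.
exists (fun k => if (k < n)%N then g k else x); split.
- move=> k /=; rewrite ltnS => kn; case: ltnP => [lt|_]; [right; exact: gA|by left].
- move=> k l; rewrite !inE /= !ltnS => kn ln; case: ltnP => k'; case: ltnP => l'.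
  + by apply: gi; rewrite inE.
  + by move=> gx; case: nAx; rewrite -gx; exact: gA.
  + by move=> gx; case: nAx; rewrite gx; exact: gA.
  + by move=> _; apply/eqP; rewrite eqn_leq (leq_trans kn) // (leq_trans ln).
- move=> y [->|/gs[k kn <-]]; first by exists n; rewrite /= ?ltnn.
  by move: kn => /= kn; exists k; [exact: ltnW | rewrite kn].
Qed.

Section Generators.
Variable G : groupType.
Local Notation tgen := (@gen (letter G) (@tower_rel G setT)).
Local Notation t := (tele_base (tgen (tl G))).
Local Notation b := (tele_base (tgen (bl G 0%R))).
Local Notation z := (tele_gen G).

HB.instance Definition _ := isPointed.Build (telescope G) 1.

Definition enlarged (S : set G) : set (telescope G) := t |` (b |` (z |` (@tele_embed G @` S))).

Lemma enlarged_generated S : generated S = setT -> generated (enlarged S) = setT.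
Proof.
move=> /generatedP gS; apply/generatedP => M sM SM.
have Mg g : M (tele_embed g).
  apply: (gS [set h | M (tele_embed h)]) => [|h Sh]; last first.
    by apply: SM; right; right; right; exists h.
  split; rewrite /mkset; first by rewrite gmulf1; exact: subgroup1.
    by move=> x y Mx My; rewrite gmulfM; exact: subgroupM.
  by move=> x Mx; rewrite gmulfV; exact: subgroupV.
have Mt : M t by apply: SM; left.
have Mb : M b by apply: SM; right; left.
have Mz : M z by apply: SM; right; right; left.
have MzX k : M (z ^+ k) by apply: subgroupX.
have Mbk k : M (tele_base (tgen (bl G k))).
  have conj n x : z ^+ n * tele_base x * z ^- n = tele_base (shift_tower G n%:Z x).
    rewrite tele_genX teleVE !teleME /teleV /teleM /= invg1 !gmulf1 mulg1 mul1g.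
    by rewrite /tele_base; congr Telescope; lia.
  have conjV n x : z ^- n * tele_base x * z ^+ n = tele_base (shift_tower G (- n%:Z)%R x).
    rewrite tele_genX teleVE !teleME /teleV /teleM /= invg1 !gmulf1 mulg1 mul1g.
    by rewrite /tele_base; congr Telescope; lia.
  have [k0|k0] := lerP 0%R k.
    have -> : tgen (bl G k) = shift_tower G `|k|%N%:Z (tgen (bl G 0%R)).
      by rewrite shift_tower_gen /=; congr (tgen (bl G _)); lia.
    rewrite -conj; apply: (subgroupM sM); first exact: (subgroupM sM).
    exact: subgroupV.
  have -> : tgen (bl G k) = shift_tower G (- `|k|%N%:Z)%R (tgen (bl G 0%R)).
    by rewrite shift_tower_gen /=; congr (tgen (bl G _)); lia.
  rewrite -conjV; apply: (subgroupM sM) => //; apply: (subgroupM sM) => //.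
  exact: subgroupV.
have Mgen l : M (tele_base (tgen l)) by case: l => [g|[k|]]; [exact: Mg|exact: Mbk|exact: Mt].
have Mbase x : M (tele_base x).
  move: x; apply: presented_ind; first by rewrite gmulf1; exact: subgroup1.
    by move=> l x Mx; rewrite gmulfM; exact: (subgroupM sM (Mgen l) Mx).
  by move=> l x Mx; rewrite gmulfM gmulfV; exact: (subgroupM sM (subgroupV sM (Mgen l)) Mx).
move=> x; have [k [->|->]] := telescopeE x; apply: (subgroupM sM) => //.
exact: subgroupV.
Qed.

Lemma lamp_t_notin g : @gen _ (@lamp_rel G) (tl G) <> @gen _ (@lamp_rel G) (gl g).
Proof.
move=> /(congr1 (plift (@lamp_configP G))); rewrite !plift_gen /=.
by move/(congr1 (fun h : bijection (G * int) => (h (1, 0%R)).2)).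
Qed.

Lemma tgen_b_neq1 : tgen (bl G 0%R) <> 1.
Proof.
move=> b1; apply: free_nonabelian.
have -> : @gen bool (fun=> False) false = 1.
  apply: (@free_hom_inj G); rewrite gmulf1 /= plift_gen; exact: b1.
exact: commute1.
Qed.

(** Only [z] has a nonzero level; in [lampgroup] the letter [t] is not in [G], and
    [b_0] becomes trivial there although it is not trivial in the tower. *)
Lemma enlarged_card S n : S #= `I_n -> enlarged S #= `I_(n + 3).
Proof.
move=> Sn; have lgM := @lgenM G; have lg1 := morph1 lgM.
have pr (x y : tower G setT) : tele_base x = tele_base y -> tower_proj setT x = tower_proj setT y.
  by move=> xy; rewrite -[x]/(base (tele_base x)) xy.
have prb : tower_proj setT (tgen (bl G 0%R)) = 1 by rewrite /= plift_gen lgen_b.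
have prt : tower_proj setT (tgen (tl G)) = @gen _ (@lamp_rel G) (tl G) by exact: plift_gen.
rewrite addn3; apply: card_setU1; [|apply: card_setU1; [|apply: card_setU1]].
- move=> [/pr|[/(congr1 (@level G))//|[g _ /esym/pr]]]; rewrite prt.
    by rewrite prb -lg1; exact: lamp_t_notin.
  by rewrite tower_proj_gl; exact: lamp_t_notin.
- move=> [/(congr1 (@level G))//|[g _ gb]].
  have := pr _ _ gb; rewrite tower_proj_gl prb -lg1 => /lgen_inj g1.
  apply: tgen_b_neq1; move: gb => /(congr1 (@base G)) /= <-.
  by rewrite g1 (morph1 (@tgenM G setT)).
- by move=> [g _ /(congr1 (@level G))].
- by rewrite (card_eql (inj_card_eq (in2W (@tele_embed_inj G)))).
Qed.

Lemma enlarged_finite S : finite_set S -> finite_set (enlarged S).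
Proof.
by move=> fS; rewrite !finite_setU; do !split; by [exact: finite_set1 | exact: finite_image].
Qed.

End Generators.

(** * Cardinality *)

Section Hessenberg.
Variable X : Type.

Definition embeds (A B : set X) := exists f : X -> X,
  (forall x, A x -> B (f x)) /\ (forall x y, A x -> A y -> f x = f y -> x = y).

Lemma chosen_function (P : X -> X -> Prop) (A : set X) :
  (forall x, A x -> exists y, P x y) -> exists f, forall x, A x -> P x (f x).
Proof.
move=> AP; suff /choice[f fP] : forall x, exists y, A x -> P x y by exists f.
move=> x; have [/AP[y Pxy]|nA] := pselect (A x); by [exists y | exists x].
Qed.

(** A maximal partial injection is total on one side. *)
Lemma embeds_total (A B : set X) : embeds A B \/ embeds B A.
Proof.
pose P (g : set (X * X)) := (forall p, g p -> A p.1 /\ B p.2) /\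
  forall p q, g p -> g q -> (p.1 = q.1 <-> p.2 = q.2).
have [|g [[gAB g1] gmax]] := @Zorn_bigcup _ P.
  move=> F FP tF; split=> [p [C FC /(FP _ FC).1]//|p q [C FC Cp] [C' FC' C'q]].
  have [CC|CC] := tF _ _ FC FC'; first exact: (FP _ FC').2 (CC _ Cp) C'q.
  exact: (FP _ FC).2 Cp (CC _ C'q).
have [gA|/existsNP[a /not_implyP[Aa na]]] := pselect (forall a, A a -> exists b, g (a, b)).
  have [f fP] := chosen_function gA; left; exists f; split=> [x /fP/gAB[]//|x y Ax Ay fxy].
  exact: (g1 _ _ (fP x Ax) (fP y Ay)).2.
have [gB|/existsNP[b /not_implyP[Bb nb]]] := pselect (forall b, B b -> exists a, g (a, b)).
  have [f fP] := chosen_function gB; right; exists f; split=> [x /fP/gAB[]//|x y Ax Ay fxy].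
  exact: (g1 _ _ (fP x Ax) (fP y Ay)).1.
exfalso; apply: (gmax (g `|` [set (a, b)])).
  split=> [p gp|]; first by left.
  by move=> /(_ (a, b)) gab; apply: na; exists b; apply: gab; right.
split=> [p [/gAB//|->//]|p q [gp|->] [gq|->] //]; first exact: g1.
- case: p gp => x y gxy; split=> /= E; subst; exfalso.
    by apply: na; exists y.
  by apply: nb; exists x.
- case: q gq => x y gxy; split=> /= E; subst; exfalso.
    by apply: na; exists y.
  by apply: nb; exists x.
Qed.

Definition domain (g : set ((X * X) * X)) : set X := [set d | exists y, g ((d, d), y)].

(** Graphs of injections [D * D -> D]; the set [D] is read off the diagonal, so that
    a graph alone carries all the data and inclusion of graphs is the order for
    Zorn's lemma. *)
Definition pairing (g : set ((X * X) * X)) := [/\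
  forall p q, g p -> g q -> (p.1 = q.1 <-> p.2 = q.2),
  forall a b, domain g a -> domain g b -> exists y, g ((a, b), y) &
  forall a b y, g ((a, b), y) -> [/\ domain g a, domain g b & domain g y]].

Lemma pairing_chain (F : set (set ((X * X) * X))) :
  F `<=` pairing -> total_on F subset -> pairing (\bigcup_(g in F) g).
Proof.
move=> FP tF; have domS g h : g `<=` h -> domain g `<=` domain h.
  by move=> gh x [y /gh]; exists y.
have FU g : F g -> g `<=` \bigcup_(g in F) g by move=> Fg x gx; exists g.
split=> [p q [C FC Cp] [C' FC' C'q]|a b [y [C FC Ca]] [y' [C' FC' C'b]]|a b y [C FC Cab]].
- have [CC|CC] := tF _ _ FC FC'.
    by have [+ _ _] := FP _ FC'; apply=> //; exact: CC.
  by have [+ _ _] := FP _ FC; apply=> //; exact: CC.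
- have [CC|CC] := tF _ _ FC FC'.
    have [_ + _] := FP _ FC' => /(_ a b)[||z Cz]; last by exists z, C'.
      by exists y; exact: CC.
    by exists y'.
  have [_ + _] := FP _ FC => /(_ a b)[||z Cz]; last by exists z, C.
    by exists y.
  by exists y'; exact: CC.
- by have [_ _ /(_ _ _ _ Cab)[*]] := FP _ FC; split; apply: domS (FU _ FC) _ _.
Qed.

(** Zorn's lemma is applied to the sets that give a pairing when joined with [g0];
    in this way the empty chain also has an upper bound. *)
Lemma max_pairing (g0 : set ((X * X) * X)) : pairing g0 ->
  exists g, [/\ pairing g, g0 `<=` g & forall h, g `<` h -> ~ pairing h].
Proof.
move=> p0; have [|B [PB Bmax]] := @Zorn_bigcup _ (fun B => pairing (g0 `|` B)).
  move=> F FP tF.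
  have -> : g0 `|` \bigcup_(B in F) B =
      \bigcup_(g in [set g0] `|` [set g0 `|` B | B in F]) g.
    apply/seteqP; split=> [x [gx|[B FB Bx]]|x [g [->|[B FB <-]]]]; first by exists g0 => //; left.
    - by exists (g0 `|` B); [right; exists B | right].
    - by left.
    - by move=> [gx|Bx]; [left | right; exists B].
  apply: pairing_chain => [g [->//|[B /FP PB <-]//]|g h].
  move=> [->|[B FB <-]] [->|[B' FB' <-]]; [by left|by left=> x; left|by right=> x; left|].
  by have [BB|BB] := tF _ _ FB FB'; [left|right] => x [|/BB]; [left|right|left|right].
exists (g0 `|` B); split=> // h [gh hg] Ph.
apply: (Bmax h); first by split=> [x Bx|hB]; [apply: gh; right|apply: hg => x /hB; right].
suff -> : g0 `|` h = h by [].
by apply/setUidPr => x gx; apply: gh; left.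
Qed.

(** Take a maximal pairing on a set [D] that contains a countable set.  If [D]
    embeds in its complement, adjoin a copy [h D] of [D]: the pairs not in [D * D]
    can be mapped injectively to [h D], using the pairing once to combine the two
    entries and once more to record in which parts they lie, which contradicts
    maximality.  Otherwise the complement embeds in [D], so that the whole type
    embeds in [D] by pairing with one of two marks. *)
Theorem square_embeds (e : nat -> X) : injective e -> exists f : X * X -> X, injective f.
Proof.
move=> ei; pose g0 := [set p | exists m n, p = ((e m, e n), e (pickle (m, n)))].
have dom0 x : domain g0 x <-> exists n, x = e n.
  split=> [[y [m [n [-> _ _]]]]|[n ->]]; first by exists m.
  by exists (e (pickle (n, n))), n, n.
have P0 : pairing g0.
  split=> [_ _ [m [n ->]] [m' [n' ->]]|a b /dom0[m ->] /dom0[n ->]|a b y [m [n [-> -> ->]]]].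
  - split=> /=; first by move=> [/ei -> /ei ->].
    by move=> /ei /(pcan_inj pickleK) [-> ->].
  - by exists (e (pickle (m, n))), m, n.
  - by split; apply: (dom0 _).2; [exists m|exists n|exists (pickle (m, n))].
have [g [[g1 gD Dg] g0g gmax]] := max_pairing P0; set D := domain g in gD Dg.
have eD n : D (e n).
  by exists (e (pickle (n, n))); apply: g0g; exists n, n.
have [f fP] : exists f : X -> X -> X, forall a b, D a -> D b -> g ((a, b), f a b).
  have /choice[f fP] : forall a, exists fa : X -> X, D a -> forall b, D b -> g ((a, b), fa b).
    move=> a; have [Da|] := pselect (D a); last by exists id.
    have [fa faP] : exists fa, forall b, D b -> g ((a, b), fa b).
      by apply: (@chosen_function (fun b y => g ((a, b), y)) D) => b; exact: gD.
    by exists fa.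
  by exists f => a b Da; exact: fP.
have fD a b : D a -> D b -> D (f a b) by move=> Da Db; have [] := Dg _ _ _ (fP a b Da Db).
have fi a b a' b' : D a -> D b -> D a' -> D b' -> f a b = f a' b' -> a = a' /\ b = b'.
  by move=> Da Db Da' Db' /(g1 _ _ (fP _ _ Da Db) (fP _ _ Da' Db')).2 [].
have [[h [hD hi]]|[h [hD hi]]] := embeds_total D (~` D); last first.
  pose phi x := if `[< D x >] then f x (e 0%N) else f (h x) (e 1%N).
  have phiD x : D (phi x).
    by rewrite /phi; case: asboolP => [Dx|/hD Dh]; apply: fD.
  have phii : injective phi.
    move=> x y; rewrite /phi; case: asboolP => Dx; case: asboolP => Dy.
    - by move=> /fi[].
    - by have Dhy := hD _ Dy; move=> /fi[]// _ /ei.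
    - by have Dhx := hD _ Dx; move=> /fi[]// _ /ei.
    - have Dhx := hD _ Dx; have Dhy := hD _ Dy; move=> /fi[]// hxy _; exact: hi.
  exists (fun p => f (phi p.1) (phi p.2)) => -[a b] [a' b'] /= /fi[]//.
  by move=> /phii -> /phii ->.
exfalso.
pose D' := D `|` h @` D.
have [r rP] : exists r, forall x, D' x -> D (r x) /\ ((D x /\ r x = x) \/ (~ D x /\ x = h (r x))).
  apply: (@chosen_function (fun x y => D y /\ ((D x /\ y = x) \/ (~ D x /\ x = h y))) D')
    => x [Dx|[d Dd <-]]; first by exists x; split=> //; left.
  by exists d; split=> //; right; split=> //; exact: hD.
pose code a b := e (`[< D a >] + (`[< D b >]).*2)%N.
pose k a b := h (f (f (r a) (r b)) (code a b)).
pose g' := g `|` [set p | exists a b, [/\ D' a, D' b, ~ (D a /\ D b) & p = ((a, b), k a b)]].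
have rD x : D' x -> D (r x) by move=> /rP[].
have ri x y : D' x -> D' y -> `[< D x >] = `[< D y >] -> r x = r y -> x = y.
  move=> /rP[_ [[Dx rx]|[Dx rx]]] /rP[_ [[Dy ry]|[Dy ry]]].
  - by rewrite rx ry.
  - by rewrite asboolT // asboolF.
  - by rewrite asboolF // asboolT.
  - by move=> _ rxy; rewrite rx ry rxy.
have kD a b : D' a -> D' b -> (h @` D) (k a b).
  move=> Da Db; exists (f (f (r a) (r b)) (code a b)) => //.
  exact: (fD _ _ (fD _ _ (rD _ Da) (rD _ Db)) (eD _)).
have ki a b a' b' : D' a -> D' b -> D' a' -> D' b' -> k a b = k a' b' -> a = a' /\ b = b'.
  move=> Da Db Da' Db' /hi kk.
  have := rD _ Da; have := rD _ Db; have := rD _ Da'; have := rD _ Db' => rb' ra' rb ra.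
  have fr := fD _ _ ra rb; have fr' := fD _ _ ra' rb'.
  have {}kk := kk (fD _ _ fr (eD _)) (fD _ _ fr' (eD _)).
  have [ff /ei cc] := fi _ _ _ _ fr (eD _) fr' (eD _) kk.
  have [raa rbb] := fi _ _ _ _ ra rb ra' rb' ff.
  suff [ca cb] : `[< D a >] = `[< D a' >] /\ `[< D b >] = `[< D b' >] by split; exact: ri.
  by move: cc; do 4!case: (`[< _ >]).
have dom' x : domain g' x <-> D' x.
  split=> [[y [gx|[a [b [Da _ _ [-> _ _]]]]]]|D'x]; first by left; exists y.
    by [].
  have [[y gx]|nD] := pselect (D x); first by exists y; left.
  by exists (k x x); right; exists x, x; split=> // -[].
apply: (gmax g').
  split=> [x|/(_ ((h (e 0%N), h (e 0%N)), k (h (e 0%N)) (h (e 0%N))))]; first by left.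
  have nD := hD _ (eD 0%N).
  have D'h : D' (h (e 0%N)) by right; exists (e 0%N).
  move=> gh; apply: nD; suff : g (h (e 0%N), h (e 0%N), k (h (e 0%N)) (h (e 0%N))) by case/Dg.
  by apply: gh; right; exists (h (e 0%N)), (h (e 0%N)); split=> // -[/(hD _ (eD 0%N))].
split.
- move=> p q [gp|[a [b [Da Db nab ->]]]] [gq|[a' [b' [Da' Db' nab' ->]]]]; first exact: g1.
  + case: p gp => -[a b] y gp /=; have [Da Db Dy] := Dg _ _ _ gp; split.
      by move=> [aa bb]; case: nab'; rewrite -aa -bb.
    by move=> yk; have [d Dd hd] := kD _ _ Da' Db'; case: (hD d Dd); rewrite hd -yk.
  + case: q gq => -[a' b'] y gq /=; have [Da' Db' Dy] := Dg _ _ _ gq; split.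
      by move=> [aa bb]; case: nab; rewrite aa bb.
    by move=> yk; have [d Dd hd] := kD _ _ Da Db; case: (hD d Dd); rewrite hd yk.
  + by split=> /= [[-> ->]//|/ki[]// -> ->].
- move=> a b /dom' Da /dom' Db.
  have [[Da' Db']|nab] := pselect (D a /\ D b); first by exists (f a b); left; exact: fP.
  by exists (k a b); right; exists a, b.
- move=> a b y [/Dg[Da Db Dy]|[a' [b' [Da Db nab [-> -> ->]]]]].
    by split; apply: (dom' _).2; left.
  by split; apply: (dom' _).2 => //; right; exact: kD.
Qed.

End Hessenberg.

(** Lists are encoded by their length and iterated pairing, and an element of the
    telescope by a word and an integer. *)
Section Encoding.
Variables (X : Type) (F : X * X -> X) (e : nat -> X).
Hypotheses (F_inj : injective F) (e_inj : injective e).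

Lemma seq_encoding (T : Type) (a : T -> X) : injective a ->
  exists c : seq T -> X, injective c.
Proof.
move=> ai; pose c' s := foldr (fun y x => F (a y, x)) (e 0%N) s.
exists (fun s => F (e (size s), c' s)) => s s' /F_inj[/e_inj].
elim: s s' => [|y s IH] [|y' s'] //= [/IH ss] /F_inj[/ai -> /ss ->//].
Qed.

Lemma telescope_encoding (G : groupType) (a : G -> X) : injective a ->
  exists c : telescope G -> X, injective c.
Proof.
move=> ai.
pose l (x : bool * letter G) := F (e (pickle (x.1, if x.2 is inr o then Some o else None)),
  if x.2 is inl g then a g else e 0%N).
have li : injective l.
  move=> [b x] [b' x'] /F_inj[/e_inj/(pcan_inj pickleK)/=].
  by case: x x' => [g|o] [g'|o'] //; [move=> [->] /ai -> | move=> [-> ->]].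
have [c ci] := seq_encoding li.
exists (fun x => F (c (repr (base x)), e (pickle (level x)))).
move=> [x k] [y m] /F_inj[/ci xy /e_inj/(pcan_inj pickleK) /= ->].
by congr Telescope; rewrite -[x]cls_repr xy cls_repr.
Qed.

End Encoding.

Lemma injection_card_le (T : Type) (U : choiceType) (f : T -> U) :
  injective f -> [set: T] #<= [set: U].
Proof.
move=> fi; rewrite -(card_le_eql (inj_card_eq (in2W fi))).
exact: subset_card_le.
Qed.

Section TelescopeCard.
Variable G : groupType.

Lemma telescope_card_infinite : infinite_set [set: G] -> [set: telescope G] #= [set: G].
Proof.
move=> /infiniteP nG.
pose pG : pointedType := HB.pack (Choice.sort G) (isPointed.Build G 1).
have /(@pcard_injP _ pG)[e ei'] := nG.
have ei : injective (e : nat -> G) by move=> m n; apply: ei'; exact: in_setT.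
have [F Fi] := square_embeds ei.
have [c ci] := telescope_encoding Fi ei (@inj_id G).
rewrite card_eq_le (injection_card_le ci).
exact: (injection_card_le (@tele_embed_inj G)).
Qed.

Lemma telescope_card_finite : finite_set [set: G] -> [set: telescope G] #= [set: nat].
Proof.
move=> /finite_set_countable cG.
have [a ai] : exists a : G -> nat, injective a.
  have /pcard_injP[a ai] := cG; exists a => x y; apply: ai; exact: in_setT.
have Fi : injective (@pickle (nat * nat)%type : nat * nat -> nat) by exact: pcan_inj pickleK.
have [c ci] := telescope_encoding Fi (@inj_id nat) ai.
rewrite card_eq_le (injection_card_le ci).
apply: (injection_card_le (f := fun k => tele_gen G ^+ k)) => k l.
by rewrite !tele_genX => /(congr1 (@level G)) [].
Qed.

End TelescopeCard.

Theorem theorem2 (R : realType) :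
  exists mu : group_functor, forall G : groupType,
    boundedly_acyclic R (mu G) /\
    exists iota : {ghom G -> mu G},
      injective iota /\
      (forall x : mu G, torsion x ->
         exists (g : G) (y : mu G), x = iota g ^ y) /\
      (infinite_set [set: G] -> [set: mu G] #= [set: G]) /\
      (finite_set [set: G] -> [set: mu G] #= [set: nat]) /\
      has_nonabelian_free_subgroup (mu G) /\
      (forall n : nat, n_generated n G -> n_generated (n + 3) (mu G)) /\
      (finitely_generated G -> finitely_generated (mu G)).
Proof.
exists telescope_functor => G; split; first exact: telescope_acyclic.
exists (@tele_embed G); split; first exact: tele_embed_inj.
split; first by move=> x /telescope_torsion[g [y ->]]; exists g, y.
split; first exact: telescope_card_infinite.
split; first exact: telescope_card_finite.
split; first exact: telescope_free.
split=> [n [S [Sn gS]]|[S [fS gS]]]; exists (enlarged S).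
  by split; [exact: enlarged_card | exact: enlarged_generated].
by split; [exact: enlarged_finite | exact: enlarged_generated].
Qed.
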